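(* Let $V$ be a rational vertex operator algebra of CFT type, and let $S^1,\dots,S^m$ be representatives of the isomorphism classes of simple admissible $V$-modules, $S^i=\bigoplus_{j\in\mathbb{Z}_{\ge0}}S^i_j$. Then for every $d\in\mathbb{N}$ there is an isomorphism of rings $$\mathsf{A}_d(V)\cong\prod_{j=0}^d\prod_{i=1}^m\mathrm{Mat}_{D^i_j}(\mathbb{C}),\qquad D^i_j=\dim_{\mathbb{C}}(S^i_j),$$ where $\mathsf{A}_d(V)$ is the $d$-th (level $d$) Zhu algebra of $V$.
   Context: $V=\bigoplus_{n\in\mathbb{N}}V_n$ is a vertex operator algebra over $\mathbb{C}$ of CFT type ($\mathbb{N}=\mathbb{Z}_{\ge0}$-graded, $\dim V_n<\infty$, $\dim V_0=1$). An ($\mathbb{N}$-graded) admissible $V$-module is a weak $V$-module $W=\bigoplus_{d\in\mathbb{N}}W_d$ with $a_{(n)}W_d\subseteq W_{d+\deg a-n-1}$ for homogeneous $a\in V$; it is simple if nonzero with no nonzero proper graded submodules. For simple $S$ the grading is normalized so that $S_0\neq0$. $V$ is rational if every admissible $V$-module is a direct sum of simple admissible $V$-modules (it is then known that there are finitely many simple admissible modules up to isomorphism and that their graded pieces are finite-dimensional). $\mathsf{A}_d(V)$ is the level-$d$ Zhu algebra of Dong–Li–Mason. Equivalently, $\mathsf{A}_d(V)=\mathscr{U}_0/(\mathscr{U}\cdot\mathscr{U}_{\le-d-1})_0$, where $\mathscr{U}=\bigoplus_k\mathscr{U}_k$ is the (completed, graded) universal enveloping algebra of $V$, topologically generated by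 modes $a_{[n]}$ of degree $\deg a-n-1$ subject to the commutator (Borcherds) and normal-ordering relations of $V$, with $\mathbf{1}_{[-1]}=1$. $\mathrm{Mat}_0(\mathbb{C})$ is the zero ring. *)

(* Defs.v *)
From HB Require Import structures.
From mathcomp Require Import all_boot all_order all_algebra.
From mathcomp Require Import ring_quotient generic_quotient complex.
From mathcomp Require Import boolp classical_sets reals.

Set Implicit Arguments.
Unset Strict Implicit.
Unset Printing Implicit Defensive.

Import Order.TTheory GRing.Theory Num.Theory.

Local Open Scope classical_set_scope.
Local Open Scope ring_scope.

Section LinearAlgebra.
Context {K : fieldType} {W : lmodType K}.

Definition subspace (A : set W) : Prop :=
  A 0 /\ forall (c : K) u v, A u -> A v -> A (c *: u + v).

Definition is_direct_sum {I : choiceType} (S : I -> set W) (U : set W) : Prop :=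
  [/\ forall i, subspace (S i) /\ S i `<=` U,
      forall w, U w -> exists (s : seq I) (x : I -> W),
        [/\ uniq s, forall i, S i (x i) & w = \sum_(i <- s) x i]
    & forall (s : seq I) (x : I -> W), uniq s -> (forall i, S i (x i)) ->
        \sum_(i <- s) x i = 0 -> forall i, i \in s -> x i = 0].

Definition has_dim (A : set W) (n : nat) : Prop :=
  exists b : 'I_n -> W, (forall i, A (b i)) /\
    forall w, A w -> exists! c : 'rV[K]_n, w = \sum_(i < n) c 0 i *: b i.

(* Components of negative degree are zero. *)
Definition gr_int (g : nat -> set W) (k : int) : set W :=
  if k is Posz n then g n else [set 0].

End LinearAlgebra.

Definition binz {K : fieldType} (m : int) (j : nat) : K :=
  (\prod_(i < j) (m - i%:Z)%:~R) / j`!%:R.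

(* For the modes [a_(n) b = mode a n b] and [a_(n) w = act a n w]:
     sum_j binom(m, j) (a_(k+j) b)_(m+n-j) w
       = sum_j (-1)^j binom(k, j)
           (a_(m+k-j) b_(n+j) w - (-1)^k b_(n+k-j) a_(m+j) w).
   Only finitely many terms are nonzero when the modes satisfy truncation, so
   the infinite sums are the eventual values of their partial sums. *)
Definition borcherds_identity {K : fieldType} {V W : lmodType K}
    (mode : V -> int -> V -> V) (act : V -> int -> W -> W) : Prop :=
  forall (a b : V) (w : W) (m n k : int), exists N0 : nat,
  forall N : nat, (N0 <= N)%N ->
    \sum_(j < N) binz m j *: act (mode a (k + j%:Z) b) (m + n - j%:Z) w =
    \sum_(j < N) ((-1) ^+ j * binz k j) *:
       (act a (m + k - j%:Z) (act b (n + j%:Z) w)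
        - (-1) ^+ `|k|%N *: act b (n + k - j%:Z) (act a (m + j%:Z) w)).

Definition truncated {K : fieldType} {V W : lmodType K}
    (act : V -> int -> W -> W) : Prop :=
  forall a w, exists N : int, forall n, N <= n -> act a n w = 0.

Definition bilinear_modes {K : fieldType} {V W : lmodType K}
    (act : V -> int -> W -> W) : Prop :=
  (forall n w, linear (fun a => act a n w)) /\
  (forall a n, linear (act a n)).

Record voa (R : realType) := VOA {
  voa_sort :> lmodType R[i];
  mode : voa_sort -> int -> voa_sort -> voa_sort;
  vac : voa_sort;
  conf : voa_sort;
  central_charge : R[i];
  vgr : nat -> set voa_sort;
  mode_bilinear : bilinear_modes mode;
  mode_truncated : truncated mode;
  vac_mode : forall n v, mode vac n v = if n == -1 then v else 0;
  mode_vac_ge0 : forall a n, 0 <= n -> mode a n vac = 0;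
  mode_vac_N1 : forall a, mode a (-1) vac = a;
  mode_borcherds : borcherds_identity mode mode;
  (* The Virasoro operators are [L_m = conf_(m+1)]. *)
  virasoro : forall (m n : int) v,
    mode conf (m + 1) (mode conf (n + 1) v)
    - mode conf (n + 1) (mode conf (m + 1) v) =
    (m - n)%:~R *: mode conf (m + n + 1) v
    + (if m + n == 0 then (m ^+ 3 - m)%:~R / 12%:R * central_charge else 0)
        *: v;
  translation : forall a n v,
    mode (mode conf 0 a) n v = - n%:~R *: mode a (n - 1) v;
  vgr_direct_sum : is_direct_sum vgr setT;
  vgr_L0 : forall n v, vgr n v -> mode conf 1 v = n%:R *: v;
  vgr_fin : forall n, exists N, has_dim (vgr n) N;
  vac_deg : vgr 0%N vac;
  conf_deg : vgr 2%N conf;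
  mode_deg : forall (p q : nat) (n : int) a b, vgr p a -> vgr q b ->
    gr_int vgr (p%:Z + q%:Z - n - 1) (mode a n b)
}.

Arguments mode {R v} : rename.
Arguments vac {R v} : rename.
Arguments conf {R v} : rename.
Arguments vgr {R} v : rename.

Definition CFT_type (R : realType) (V : voa R) : Prop := has_dim (vgr V 0%N) 1.

Record adm_module (R : realType) (V : voa R) := AdmModule {
  adm_sort :> lmodType R[i];
  act : V -> int -> adm_sort -> adm_sort;
  mgr : nat -> set adm_sort;
  act_bilinear : bilinear_modes act;
  act_truncated : truncated act;
  vac_act : forall n w, act vac n w = if n == -1 then w else 0;
  act_borcherds : borcherds_identity (@mode R V) act;
  mgr_direct_sum : is_direct_sum mgr setT;
  act_deg : forall (p q : nat) (n : int) a w, vgr V p a -> mgr q w ->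
    gr_int mgr (p%:Z + q%:Z - n - 1) (act a n w)
}.

Arguments act {R V a} : rename.
Arguments mgr {R V} a : rename.

Section Modules.
Context {R : realType} {V : voa R}.
Implicit Types W : adm_module V.

Definition graded_submodule W (U : set W) : Prop :=
  [/\ subspace U,
      forall a n w, U w -> U (act a n w)
    & is_direct_sum (fun n => U `&` mgr W n) U].

Definition simple_submodule W (S : set W) : Prop :=
  [/\ graded_submodule S,
      exists2 w, S w & w <> 0
    & forall U : set W, graded_submodule U -> U `<=` S ->
        U = [set 0] \/ U = S].

Definition simple_module W : Prop := simple_submodule (setT : set W).

Definition normalized W : Prop := exists2 w, mgr W 0%N w & w <> 0.

(* Isomorphisms of graded modules.  Between simple modules with nonzero degree
   zero part, every isomorphism of the underlying weak modules is one: [L_0]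
   acts on the degree [n] part of such a module by [h + n], [h] a constant. *)
Definition adm_iso W1 W2 : Prop :=
  exists f : {linear W1 -> W2},
    [/\ bijective f,
        forall a n w, f (act a n w) = act a n (f w)
      & forall n w, mgr W1 n w -> mgr W2 n (f w)].

End Modules.

Definition rational_voa (R : realType) (V : voa R) : Prop :=
  forall W : adm_module V, exists (I : choiceType) (S : I -> set W),
    (forall i, simple_submodule (S i)) /\ is_direct_sum S setT.

Section Zhu.
Context {R : realType} (V : voa R) (d : nat).

(* With Y(a, z) = sum_k a_(k) z^(-k-1) and [a] of degree [p], these are
     Res_z (1+z)^(p+d) / z^(2d+2) Y(a, z) b   and
     sum_(l <= d) (-1)^l binom(l+d, d) Res_z (1+z)^(p+d) / z^(d+l+1) Y(a, z) b.
   The two products on [V] are their extensions by linearity in [a]. *)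
Definition zhu_circ (p : nat) (a b : V) : V :=
  \sum_(j < (p + d).+1)
    'C(p + d, j)%:R *: mode a (j%:Z - (d.*2 + 2)%:Z) b.

Definition zhu_mul (p : nat) (a b : V) : V :=
  \sum_(l < d.+1) ((-1) ^+ l * 'C(l + d, d)%:R) *:
    \sum_(j < (p + d).+1)
      'C(p + d, j)%:R *: mode a (j%:Z - (d + l + 1)%:Z) b.

(* [O_d(V)]; recall [L_(-1) = conf_(0)] and [L_0 = conf_(1)]. *)
Definition zhu_O : set V :=
  smallest subspace
    ([set x | exists p a b, vgr V p a /\ x = zhu_circ p a b] `|`
     [set x | exists a, x = mode conf 0 a + mode conf 1 a]).

Definition zhu_O_pred : {pred V} := fun v => `[< zhu_O v >].

Lemma zhu_O_zmod_closed : zmod_closed zhu_O_pred.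
Proof.
split; first by apply/asboolP => A [[A0 _] _].
move=> u v /asboolP Ou /asboolP Ov; apply/asboolP => A [sA GA].
rewrite addrC -scaleN1r; apply: sA.2; first exact: Ov.
exact: Ou.
Qed.

HB.instance Definition _ :=
  GRing.isZmodClosed.Build V zhu_O_pred zhu_O_zmod_closed.

Definition zhu_algebra : zmodType := Quotient.quot zhu_O_pred.

Definition zhu_class (v : V) : zhu_algebra := \pi_(Quotient.quot zhu_O_pred)%qT v.

(* The ring structure of [V / O_d(V)] has unit the class of the vacuum and
   product induced by [zhu_mul]; as [phi] is additive, multiplicativity for
   homogeneous left factors is multiplicativity for all of them. *)
Definition zhu_ring_iso (P : pzRingType) : Prop :=
  exists phi : {additive zhu_algebra -> P},
    [/\ bijective phi,
        phi (zhu_class vac) = 1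
      & forall p a b, vgr V p a ->
          phi (zhu_class (zhu_mul p a b)) =
          phi (zhu_class a) * phi (zhu_class b)].

End Zhu.

Section ProductRing.
Variables (I : finType) (T : I -> pzRingType).

Definition prod_ring := {dffun forall i : I, T i}.
HB.instance Definition _ := Choice.on prod_ring.

Let zero : prod_ring := [ffun i : I => 0 : T i].
Let opp (f : prod_ring) : prod_ring := [ffun i : I => - f i : T i].
Let add (f g : prod_ring) : prod_ring := [ffun i : I => f i + g i : T i].
Let one : prod_ring := [ffun i : I => 1 : T i].
Let mul (f g : prod_ring) : prod_ring := [ffun i : I => f i * g i : T i].

Let addA : associative add.
Proof. by move=> f g h; apply/ffunP => i; rewrite !ffunE addrA. Qed.
Let addC : commutative add.
Proof. by move=> f g; apply/ffunP => i; rewrite !ffunE addrC. Qed.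
Let add0 : left_id zero add.
Proof. by move=> f; apply/ffunP => i; rewrite !ffunE add0r. Qed.
Let addN : left_inverse zero opp add.
Proof. by move=> f; apply/ffunP => i; rewrite !ffunE addNr. Qed.
Let mulA : associative mul.
Proof. by move=> f g h; apply/ffunP => i; rewrite !ffunE mulrA. Qed.
Let mul1 : left_id one mul.
Proof. by move=> f; apply/ffunP => i; rewrite !ffunE mul1r. Qed.
Let mulr1' : right_id one mul.
Proof. by move=> f; apply/ffunP => i; rewrite !ffunE mulr1. Qed.
Let mulDl : left_distributive mul add.
Proof. by move=> f g h; apply/ffunP => i; rewrite !ffunE mulrDl. Qed.
Let mulDr : right_distributive mul add.
Proof. by move=> f g h; apply/ffunP => i; rewrite !ffunE mulrDr. Qed.

HB.instance Definition _ := GRing.isPzRing.Build prod_ring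
  addA addC add0 addN mulA mul1 mulr1' mulDl mulDr.

End ProductRing.

Definition matrix_product (C : pzRingType) (d m : nat) (D : 'I_m -> nat -> nat)
    : pzRingType :=
  prod_ring (fun ji : 'I_d.+1 * 'I_m => 'M[C]_(D ji.2 ji.1) : pzRingType).

(* Main.v *)
(** The classes in [V / O_d(V)] act by zero modes on the degrees [<= d] of every
    admissible module.  For the converse, a linear map [al : V -> V / O_d(V)]
    is regarded as the coefficient [v |-> w' Y(v, 1) w] of a vector [w]: expanding
    the rational function [x |-> al (Y(a, x - 1) v)] at [x = 0] instead of
    [x = 1] defines modes on a space of such maps, and the Borcherds identity at
    [0] follows from the one of [V] at [1] by the residue theorem.  This gives an
    admissible module containing the class map [V -> V / O_d(V)] in degree [d],
    on which [a] acts by zero only if [a] is in [O_d(V)].  By rationality that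
    vector is a finite sum of vectors of simple submodules, so [O_d(V)] is the
    annihilator of finitely many homogeneous vectors of degree [<= d] in the
    [S^i].  By Schur's lemma (in Dixmier's form, as [V] has countable dimension)
    and Jacobson density, the [S^i_j] are spanned by these vectors, hence finite
    dimensional, and [V] surjects onto the product of their matrix algebras. *)
Require Import Defs.
From HB Require Import structures.
From mathcomp Require Import all_boot all_order all_algebra.
From mathcomp Require Import ring_quotient generic_quotient.
From mathcomp Require Import complex boolp classical_sets reals functions.
From mathcomp Require Import zify ring lra.
Set Implicit Arguments.
Unset Strict Implicit.
Unset Printing Implicit Defensive.
Import Order.TTheory GRing.Theory Num.Theory.
Local Open Scope ring_scope.

(** No rational function is ever formed. A function with poles at 0, 1 and infinity is recorded by
    its residues against [x^n (x-1)^r], and the only relation used among them is [x^(n+1) (x-1)^r =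
    x^n (x-1)^(r+1) + x^n (x-1)^r]. The residue theorem becomes the statement that the residues at 0
    and at 1 are opposite where [n + r] is too small for a residue at infinity; uniqueness
    principles for the recurrence then spread identities to all exponents. For [a] of degree [p] the
    function grows at most like [x^(d-p)] at infinity, so the safe region is [n + r <= p - d - 2].
    The test function of [zhu_circ] has [n = p + d] and [r = - 2d - 2], on the boundary of that
    region and of the pole bound at 0 for a vector of degree [d]; this is how [O_d(V)] enters. The
    coefficients lie in an arbitrary vector space, so that the quotient map to [V / O_d(V)] is
    itself a functional and a single vector detects all of [O_d(V)]. The product on this quotient is
    not shown beforehand to be well defined; it is transported from the matrices. *)

Lemma int_ind2 (P : int -> Prop) :
  P 0 -> (forall k : int, 0 <= k -> P k -> P (k + 1)) ->
  (forall k : int, k <= 0 -> P k -> P (k - 1)) -> forall k : int, P k.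
Proof.
move=> P0 PS PN; apply: int_ind => // n Pn.
  by rewrite -addn1 PoszD; apply: PS.
by rewrite -addn1 PoszD opprD; apply: PN => //; lia.
Qed.

Lemma int_down_ind (N : int) (P : int -> Prop) :
  (forall n : int, N <= n -> P n) -> (forall n : int, P (n + 1) -> P n) ->
  forall n : int, P n.
Proof.
move=> PN PD n; have [/PN//|ltn] := leP N n.
have -> : n = N - (`|N - n|%N)%:Z by lia.
elim: `|_|%N => [|j IH]; first by apply: PN; lia.
by apply: PD; have -> : N - j.+1%:Z + 1 = N - j%:Z by lia.
Qed.

Lemma sum_widen (E : nmodType) (y : nat -> E) (L L' : nat) : (L <= L')%N ->
  (forall i, (L <= i)%N -> y i = 0) -> \sum_(i < L') y i = \sum_(i < L) y i.
Proof.
move=> leL y0; rewrite -(subnKC leL) big_split_ord /= [X in _ + X]big1 ?addr0 //.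
by move=> i _; rewrite y0 // leq_addr.
Qed.

(** * Binomial coefficients with an integer upper argument *)

Section Binz.
Context {K : numFieldType}.

Definition sgn (k : int) : K := (-1) ^+ `|k|%N.

Lemma sgnS k : sgn (k + 1) = - sgn k.
Proof.
rewrite /sgn -signr_odd -[in RHS]signr_odd.
have -> : odd (absz (k + 1)%R) = ~~ odd (absz k) by lia.
by case: (odd _); rewrite ?expr0 ?expr1 ?opprK.
Qed.

Lemma sgnK k : sgn k * sgn k = 1.
Proof. by rewrite /sgn -expr2 sqrr_sign. Qed.

Lemma binz0 m : binz m 0 = 1 :> K.
Proof. by rewrite /binz big_ord0 fact0 invr1 mulr1. Qed.

Lemma binzS m j : (j.+1)%:R * binz m j.+1 = (m - j%:Z)%:~R * binz m j :> K.
Proof.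
rewrite /binz big_ord_recr /= factS natrM.
have a0 : j.+1%:R != 0 :> K by rewrite pnatr_eq0.
have f0 : j`!%:R != 0 :> K by rewrite pnatr_eq0 -lt0n fact_gt0.
move: (\prod_(i < j) _) (_%:~R) (j.+1%:R) (j`!%:R) a0 f0 => P x y z y0 z0.
by field; apply/andP.
Qed.

Lemma binz_pascal m j : binz (m + 1) j.+1 = binz m j.+1 + binz m j :> K.
Proof.
elim: j m => [|j IH] m.
  have H k : binz k 1 = k%:~R :> K.
    by have := binzS k 0; rewrite mul1r binz0 mulr1 subr0.
  by rewrite !H binz0 intrD.
have nz : (j.+2)%:R != 0 :> K by rewrite pnatr_eq0.
apply: (mulfI nz); rewrite mulrDr !binzS IH.
have -> : m + 1 - j.+1%:Z = m - j%:Z by lia.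
have -> : m - j.+1%:Z = (m - j%:Z) - 1 by lia.
rewrite mulrDr -(binzS m j) (intrB _ (m - j%:Z)) -[j.+2%:R]natr1.
by ring.
Qed.

Lemma binz_down m j : m%:~R * binz (m - 1) j = (m - j%:Z)%:~R * binz m j :> K.
Proof.
elim: j => [|j IH]; first by rewrite !binz0 subr0.
have nz : (j.+1)%:R != 0 :> K by rewrite pnatr_eq0.
apply: (mulfI nz); rewrite mulrCA binzS mulrCA IH [RHS]mulrCA binzS.
have -> : m - 1 - j%:Z = m - j.+1%:Z by lia.
by [].
Qed.

Lemma binz_nat n j : binz n%:Z j = 'C(n, j)%:R :> K.
Proof.
elim: n j => [|n IH] [|j]; rewrite ?binz0 ?bin0 //.
  rewrite bin0n /=; elim: j => [|j IH].
    by have := binzS 0 0; rewrite mul1r binz0 mulr1.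
  have nz : (j.+2)%:R != 0 :> K by rewrite pnatr_eq0.
  by apply: (mulfI nz); rewrite binzS IH !mulr0.
by rewrite binS natrD -!IH -binz_pascal -PoszD addn1.
Qed.

Lemma binz0S j : binz 0 j.+1 = 0 :> K.
Proof. by rewrite (binz_nat 0) bin0n. Qed.

Lemma binzN1 j : binz (-1) j = (-1) ^+ j :> K.
Proof.
elim: j => [|j IH]; first by rewrite binz0.
have := binz_pascal (-1) j; rewrite binz0S IH => /esym/eqP.
by rewrite addr_eq0 exprS mulN1r => /eqP.
Qed.

(** These are the coefficients in [zhu_mul], which are thus those of a binomial expansion with
    exponent [- d - 1]. *)
Lemma binzN_nat d l : binz (- (d.+1)%:Z) l = (-1) ^+ l * 'C(l + d, d)%:R :> K.
Proof.
elim: l d => [|l IHl] d; first by rewrite binz0 mul1r add0n binn.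
elim: d => [|d IHd].
  by rewrite binzN1 bin0 mulr1.
have := binz_pascal (- d.+2%:Z) l.
have -> : - d.+2%:Z + 1 = - d.+1%:Z by lia.
rewrite IHd IHl => H; apply/eqP; rewrite -subr_eq0.
rewrite -[X in X - _](addrK ((-1) ^+ l * 'C(l + d.+1, d.+1)%:R)) -H.
rewrite [(l.+1 + d.+1)%N]addSn binS addnS addSn natrD !exprS; apply/eqP.
by ring.
Qed.

(** In [bsum_triangle] this splits off [binz r s] and leaves an alternating row of Pascal's
    triangle. *)
Lemma binz_mul_sub r l s : (l <= s)%N ->
  binz r l * binz (r - l%:Z) (s - l) = binz r s * 'C(s, l)%:R :> K.
Proof.
elim: s => [|s IH] in l *; first by rewrite leqn0 => /eqP->; rewrite !binz0 mulr1.
rewrite leq_eqVlt => /orP[/eqP->|ltl]; first by rewrite subnn binz0 binn.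
rewrite ltnS in ltl; have nz : ((s - l).+1)%:R != 0 :> K by rewrite pnatr_eq0.
apply: (mulfI nz); rewrite subSn // mulrCA binzS.
have -> : r - l%:Z - (s - l)%N%:Z = r - s%:Z by lia.
rewrite mulrCA IH // mulrA -binzS.
have H := congr1 (fun n => n%:R : K) (mul_bin_down s.+1 l).
rewrite /= subSn // !natrM in H.
by rewrite mulrAC H; ring.
Qed.

End Binz.

(** * Binomial sums of eventually zero sequences *)

Section EvSum.
Context {K : numFieldType} {E : lmodType K}.
Implicit Types u v : nat -> E.

Definition ev0 u := exists N, forall i, (N <= i)%N -> u i = 0.

(* Junk value [0] unless the sequence is eventually zero. *)
Definition evsum u : E :=
  if pselect (ev0 u) is left h then \sum_(i < sval (cid h)) u i else 0.

Lemma evsumE u N : (forall i, (N <= i)%N -> u i = 0) -> evsum u = \sum_(i < N) u i.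
Proof.
move=> uN; rewrite /evsum; case: pselect => [h|[]]; last by exists N.
case: (cid h) => n1 un1 /=; have [le1|/ltnW le1] := leqP n1 N.
  by rewrite (sum_widen le1 un1).
by rewrite (sum_widen le1 uN).
Qed.

Lemma evsum_single u p :
  (forall i, i != p -> u i = 0) -> evsum u = u p.
Proof.
move=> u0; rewrite (@evsumE _ p.+1); last by move=> i lti; rewrite u0 // gtn_eqF.
by rewrite big_ord_recr /= big1 ?add0r // => i _; rewrite u0 // ltn_eqF.
Qed.
Lemma ev0Z (c : nat -> K) u : ev0 u -> ev0 (fun i => c i *: u i).
Proof. by move=> [N uN]; exists N => i /uN ->; rewrite scaler0. Qed.

Lemma ev0S u : ev0 u -> ev0 (fun i => u i.+1).
Proof. by move=> [N uN]; exists N => i le; rewrite uN // ltnW. Qed.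

Lemma evsumD u v : ev0 u -> ev0 v ->
  evsum (fun i => u i + v i) = evsum u + evsum v.
Proof.
move=> [N uN] [M vM].
rewrite (@evsumE u (maxn N M)); last by move=> i; rewrite geq_max => /andP[/uN].
rewrite (@evsumE v (maxn N M)); last by move=> i; rewrite geq_max => /andP[_ /vM].
rewrite (@evsumE _ (maxn N M)) ?big_split // => i.
by rewrite geq_max => /andP[/uN-> /vM->]; rewrite addr0.
Qed.

Lemma evsumZ (c : K) u : evsum (fun i => c *: u i) = c *: evsum u.
Proof.
have [->|c0] := eqVneq c 0.
  by rewrite scale0r (@evsumE _ 0) ?big_ord0 // => i _; rewrite scale0r.
have [[N uN]|nu] := pselect (ev0 u).
  rewrite (evsumE uN) (@evsumE _ N) ?scaler_sumr // => i /uN ->.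
  by rewrite scaler0.
rewrite /evsum; case: pselect => [h|_]; last by case: pselect => // _; rewrite scaler0.
case: nu; case: h => N uN; exists N => i /uN /eqP.
by rewrite scaler_eq0 (negPf c0) /= => /eqP.
Qed.

Lemma evsum_recl u : ev0 u -> evsum u = u 0%N + evsum (fun i => u i.+1).
Proof.
move=> [N uN]; rewrite (@evsumE u N.+1); last by move=> i /ltnW /uN.
by rewrite big_ord_recl (@evsumE _ N) // => i le; rewrite uN // ltnW.
Qed.

(** The operator [(1 + c s)^k], with [s] the shift of sequences, applied to [u] and read at index 0;
    [k] may be negative. The value [c = 1] serves re-expansion around another point, [c = -1] powers
    of a difference. *)
Definition bsum (c : K) (k : int) u := evsum (fun i => (c ^+ i * binz k i) *: u i).

Lemma bsumE c k u N : (forall i, (N <= i)%N -> u i = 0) ->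
  bsum c k u = \sum_(i < N) (c ^+ i * binz k i) *: u i.
Proof. by move=> uN; apply: evsumE => i /uN ->; rewrite scaler0. Qed.

Lemma bsumS c k u : ev0 u ->
  bsum c (k + 1) u = bsum c k u + c *: bsum c k (fun i => u i.+1).
Proof.
move=> u0; rewrite /bsum evsum_recl; last exact: ev0Z.
rewrite [in RHS]evsum_recl; last exact: ev0Z.
rewrite !binz0 -evsumZ -addrA; congr (_ + _).
rewrite -evsumD; first last.
  by apply: ev0Z; apply: ev0Z; apply: ev0S.
  exact: (ev0S (ev0Z (fun i => c ^+ i * binz k i) u0)).
congr evsum; apply/funext => i.
by rewrite binz_pascal mulrDr scalerDl scalerA mulrA -exprS.
Qed.

Lemma bsum0 c u : bsum c 0 u = u 0%N.
Proof.
rewrite /bsum (@evsumE _ 1) ?big_ord1 ?binz0 ?mul1r ?scale1r // => -[//|i] _.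
by rewrite binz0S mulr0 scale0r.
Qed.

Lemma bsum_zero c k u : (forall i, u i = 0) -> bsum c k u = 0.
Proof. by move=> u0; rewrite (@bsumE _ _ _ 0) ?big_ord0. Qed.

Lemma bsumD c k u v : ev0 u -> ev0 v ->
  bsum c k (fun i => u i + v i) = bsum c k u + bsum c k v.
Proof.
move=> u0 v0; rewrite /bsum -evsumD; try exact: ev0Z.
by congr evsum; apply/funext => i; rewrite scalerDr.
Qed.

Lemma bsumZ c k (x : K) u : bsum c k (fun i => x *: u i) = x *: bsum c k u.
Proof.
by rewrite -evsumZ; congr evsum; apply/funext => i; rewrite !scalerA mulrC.
Qed.

Lemma bsum_nat c (n : nat) u :
  bsum c n%:Z u = \sum_(i < n.+1) (c ^+ i * 'C(n, i)%:R) *: u i.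
Proof.
rewrite /bsum (@evsumE _ n.+1); last first.
  by move=> i ltni; rewrite binz_nat bin_small // mulr0 scale0r.
by apply: eq_bigr => i _; rewrite binz_nat.
Qed.

End EvSum.

(** * Residues of rational functions *)

Section PascalSystems.
Context {K : numFieldType} {E : lmodType K}.
Implicit Types (u : int -> E) (X : int -> int -> E).

Definition tr0 u := exists N : int, forall j : int, N <= j -> u j = 0.

Lemma tr0_ev0 u (r : int) : tr0 u -> ev0 (fun i : nat => u (r + i%:Z)).
Proof. by move=> [N uN]; exists `|N - r|%N => i le; apply: uN; lia. Qed.

(* [X n r] behaves like the residue of [x ^ n (x - 1) ^ r f(x)]. *)
Definition pascal X := forall n r : int, X (n + 1) r = X n (r + 1) + X n r.

(* Residues at [x = 1] and at [x = 0], from the expansion coefficients [u] of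
   [f] in powers of [x - 1] and of [x] respectively. *)
Definition X1 u (n r : int) : E := bsum 1 n (fun i => u (r + i%:Z)).
Definition X0 u (n r : int) : E := sgn r *: bsum (-1) r (fun i => u (n + i%:Z)).

Lemma X1_pascal u : tr0 u -> pascal (X1 u).
Proof.
move=> u0 n r; rewrite /X1 bsumS; last exact: tr0_ev0.
rewrite scale1r addrC; congr (bsum _ _ _ + _); apply/funext => i.
by congr u; lia.
Qed.

Lemma X0_pascal u : tr0 u -> pascal (X0 u).
Proof.
move=> u0 n r; rewrite /X0 bsumS; last exact: tr0_ev0.
rewrite sgnS scaleN1r scaleNr scalerBr opprB subrK.
by congr (_ *: bsum _ _ _); apply/funext => i; congr u; lia.
Qed.

Lemma X1_0 u (r : int) : X1 u 0 r = u r.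
Proof. by rewrite /X1 bsum0 addr0. Qed.

Lemma X0_0 u (n : int) : X0 u n 0 = u n.
Proof. by rewrite /X0 bsum0 addr0 scale1r. Qed.

Lemma X1_vanish u (R r n : int) :
  (forall j : int, R <= j -> u j = 0) -> R <= r -> X1 u n r = 0.
Proof. by move=> u0 le; apply: bsum_zero => i; apply: u0; lia. Qed.

Lemma X0_vanish u (N n r : int) :
  (forall j : int, N <= j -> u j = 0) -> N <= n -> X0 u n r = 0.
Proof.
by move=> u0 le; rewrite /X0 bsum_zero ?scaler0 // => i; apply: u0; lia.
Qed.

Lemma tr0D u v : tr0 u -> tr0 v -> tr0 (fun i => u i + v i).
Proof.
move=> [N uN] [M vM]; exists (Num.max N M) => i; rewrite ge_max => /andP[le1 le2].
by rewrite uN // vM // addr0.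
Qed.

Lemma tr0Z (c : K) u : tr0 u -> tr0 (fun i => c *: u i).
Proof. by move=> [N uN]; exists N => i /uN ->; rewrite scaler0. Qed.

Lemma X1D u v (n r : int) : tr0 u -> tr0 v ->
  X1 (fun i => u i + v i) n r = X1 u n r + X1 v n r.
Proof. by move=> u0 v0; rewrite /X1 -bsumD //; apply: tr0_ev0. Qed.

Lemma X0D u v (n r : int) : tr0 u -> tr0 v ->
  X0 (fun i => u i + v i) n r = X0 u n r + X0 v n r.
Proof.
by move=> u0 v0; rewrite /X0 -scalerDr -bsumD //; apply: tr0_ev0.
Qed.

Lemma X1Z (c : K) u (n r : int) : X1 (fun i => c *: u i) n r = c *: X1 u n r.
Proof. by rewrite /X1 bsumZ. Qed.

Lemma X0Z (c : K) u (n r : int) : X0 (fun i => c *: u i) n r = c *: X0 u n r.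
Proof. by rewrite /X0 bsumZ !scalerA mulrC. Qed.

Lemma pascalN X : pascal X -> pascal (fun n r => - X n r).
Proof. by move=> PX n r; rewrite PX opprD. Qed.

Lemma pascalD X Y : pascal X -> pascal Y -> pascal (fun n r => X n r + Y n r).
Proof. by move=> PX PY n r; rewrite PX PY addrACA. Qed.

(** Uniqueness for expansions at 0. If row [n + 1] vanishes, the recurrence makes row [n] alternate
    in sign, so that one zero kills it; the rows are treated downwards from [N]. *)
Lemma pascal0_eq0 X (N : int) : pascal X -> (forall n r : int, N <= n -> X n r = 0) ->
  (forall n : int, exists r, X n r = 0) -> forall n r : int, X n r = 0.
Proof.
move=> PX XN X0 n; elim/(int_down_ind (N := N)): n => [n le r|n IH]; first exact: XN.
have step (r : int) : X n (r + 1) = - X n r.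
  by apply/eqP; rewrite -addr_eq0 -PX IH.
have [r0 X00] := X0 n.
have up (j : int) : X n (r0 + j) = 0.
  elim/int_ind2: j => [|j _ IHj|j _ IHj]; first by rewrite addr0.
    by rewrite addrA step IHj oppr0.
  by apply/eqP; rewrite -oppr_eq0 -step -addrA subrK IHj.
by move=> r; rewrite -(subrK r0 r) addrC up.
Qed.

(** Uniqueness for expansions at 1. The recurrence gives the row above [n0] directly, and the row
    below by descending from large [r]. *)
Lemma pascal1_eq0 X (R n0 : int) : pascal X -> (forall n r : int, R <= r -> X n r = 0) ->
  (forall r : int, X n0 r = 0) -> forall n r : int, X n r = 0.
Proof.
move=> PX XR X0 n; rewrite -(subrK n0 n) addrC.
elim/int_ind2: (n - n0) => [|j _ IH|j _ IH] r; first by rewrite addr0.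
  by rewrite addrA PX !IH addr0.
rewrite addrA; elim/(int_down_ind (N := R)): r => [r le|r IHr]; first exact: XR.
by have := PX (n0 + j - 1) r; rewrite subrK IH IHr add0r.
Qed.

(** Solving the recurrence for the exponent [r + 1] computes the columns to the right of [r] from
    column [r] alone. *)
Lemma pascal_expand X (n r : int) (T : nat) : pascal X -> tr0 (fun n => X n r) ->
  X n (r + T%:Z) = X0 (fun n => X n r) n T%:Z.
Proof.
move=> PX tX; elim: T n => [|T IH] n; first by rewrite X0_0 addr0.
have -> : r + T.+1%:Z = r + T%:Z + 1 by lia.
have -> : T.+1%:Z = T%:Z + 1 by lia.
have step X' n' r' : pascal X' -> X' n' (r' + 1) = X' (n' + 1) r' - X' n' r'.
  by move=> PX'; rewrite PX' addrK.
by rewrite !step //; [rewrite !IH | exact: X0_pascal].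
Qed.

(* The coefficients at [0] of a function whose residues against the test
   functions [x ^ n (x - 1) ^ r] with [n + r <= c], for which there is no
   residue at infinity, are [- X n r]; [N] bounds the order of its pole at
   [0], and [T] is large enough. *)
Definition ext X (N : int) (T : nat) (n : int) : E :=
  - X0 (fun j => if j < N then X j (- T%:Z) else 0) n T%:Z.

Lemma ext_vanish X (N : int) T (n : int) : N <= n -> ext X N T n = 0.
Proof.
move=> le; rewrite /ext (X0_vanish (N := N)) ?oppr0 // => j lej.
by rewrite ltNge lej.
Qed.

Lemma ext_tr0 X (N : int) T : tr0 (ext X N T).
Proof. by exists N => j; apply: ext_vanish. Qed.

(** The bound on [T] puts all entries [j < N] of column [- T] in the region without residue at
    infinity. That column therefore gives the residues at 0, and the other columns follow from it
    row by row. *)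
Lemma ext_X0 X (N : int) T (c : int) : pascal X ->
  (forall n r : int, N <= n -> n + r <= c -> X n r = 0) -> N - 1 - T%:Z <= c ->
  forall n r : int, n + r <= c -> X0 (ext X N T) n r = - X n r.
Proof.
move=> PX XN le; set u := ext X N T.
have tu : tr0 u := ext_tr0 X (N : int) T.
pose Y j := if j < N then X j (- T%:Z) else 0.
have tY : tr0 Y by exists N => j lej; rewrite /Y ltNge lej.
have tU r : tr0 (fun j => X0 u j r).
  by exists N => j lej; rewrite (X0_vanish (N := N)) // => i; apply: ext_vanish.
(* It is enough to check this after multiplication by [(x - 1)^T], where it reads [- u + u = 0]. *)
have Z0 j : Y j + X0 u j (- T%:Z) = 0.
  pose Z j := Y j + X0 u j (- T%:Z).
  have tZ : tr0 Z by exact: tr0D.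
  rewrite -[LHS]/(Z j) -X0_0; have [N1 ZN1] := tZ.
  apply: (pascal0_eq0 (N := N1) (X0_pascal tZ)).
    by move=> n r len; rewrite (X0_vanish (N := N1)).
  move=> n; exists T%:Z; rewrite X0D // -(@pascal_expand (X0 u) n _ T) //.
    rewrite addNr X0_0 /u /ext -/Y. exact: subrr.
  exact: X0_pascal.
suff H (n r : int) : n + r <= c -> X0 u n r + X n r = 0.
  by move=> n r /H /eqP; rewrite addr_eq0 => /eqP.
elim/(int_down_ind (N := N)): n r => [n len r|n IH r] lec.
  by rewrite (X0_vanish (N := N)) ?XN ?addr0 // => j; apply: ext_vanish.
have [lt|len] := ltP n N; last first.
  by rewrite (X0_vanish (N := N)) ?XN ?addr0 // => j; apply: ext_vanish.
pose D n r := X0 u n r + X n r.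
have PD : pascal D by apply: pascalD => //; exact: X0_pascal.
have step (r' : int) : n + (r' + 1) <= c -> D n (r' + 1) = - D n r'.
  by move=> le'; apply/eqP; rewrite -addr_eq0 -PD /D IH //; lia.
have D0 : D n (- T%:Z) = 0 by rewrite /D addrC; have := Z0 n; rewrite /Y lt.
(* Below row [N], the zero in column [- T] spreads in both directions by [step], as long as
   [n + r <= c]. *)
suff H : forall j : int, n + (- T%:Z + j) <= c -> D n (- T%:Z + j) = 0.
  have er : - T%:Z + (r + T%:Z) = r by lia.
  by have := H (r + T%:Z); rewrite er; apply.
elim/int_ind2 => [|j _ IHj|j hj IHj] lej; first by rewrite addr0.
  have e : - T%:Z + (j + 1) = - T%:Z + j + 1 by lia.
  rewrite e step ?IHj ?oppr0 //; lia.
have e : - T%:Z + (j - 1) + 1 = - T%:Z + j by lia.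
apply/eqP; rewrite -oppr_eq0 -step ?e ?IHj //; lia.
Qed.

(** Every row meets the region [n + r <= c], and [pascal0_eq0] needs only one zero in each row. *)
Lemma X0_inj u v (c : int) : tr0 u -> tr0 v ->
  (forall n r : int, n + r <= c -> X0 u n r = X0 v n r) -> forall n : int, u n = v n.
Proof.
move=> tu tv uv n; rewrite -(X0_0 u) -(X0_0 v); apply/eqP; rewrite -subr_eq0.
apply/eqP; have [N1 uN] := tu; have [N2 vN] := tv.
apply: (@pascal0_eq0 (fun n r => X0 u n r - X0 v n r) (Num.max N1 N2)).
- by apply: pascalD; [|apply: pascalN]; apply: X0_pascal.
- move=> n' r; rewrite ge_max => /andP[le1 le2].
  by rewrite (X0_vanish (N := N1)) // (X0_vanish (N := N2)) // subr0.
- by move=> n'; exists (c - n'); rewrite uv ?subrr //; lia.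
Qed.

End PascalSystems.

(** * Residue systems in two variables *)

Section TwoVariables.
Context {K : numFieldType} {E : lmodType K}.
Implicit Types (u : int -> E) (W : int -> int -> int -> int -> E).

Lemma bsum_exchange (c c' : K) (k k' : int) (u : nat -> nat -> E) N M :
  (forall i j, (N <= i)%N || (M <= j)%N -> u i j = 0) ->
  bsum c k (fun i => bsum c' k' (u i)) = bsum c' k' (fun j => bsum c k (u^~ j)).
Proof.
move=> u0; rewrite (@bsumE _ _ _ _ _ N); last first.
  by move=> i lei; apply: bsum_zero => j; rewrite u0 ?lei.
rewrite (@bsumE _ _ _ _ _ M); last first.
  by move=> j lej; apply: bsum_zero => i; rewrite u0 ?lej ?orbT.
under eq_bigr => i _.
  rewrite (@bsumE _ _ _ _ _ M); last by move=> j lej; rewrite u0 ?lej ?orbT.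
  rewrite scaler_sumr; over.
rewrite exchange_big /=; apply: eq_bigr => j _.
rewrite (@bsumE _ _ _ _ _ N); last by move=> i lei; rewrite u0 ?lei.
by rewrite scaler_sumr; apply: eq_bigr => i _; rewrite !scalerA mulrC.
Qed.

Lemma X01_exchange (w : int -> int -> E) (I J : int) m r n t :
  (forall i j : int, (I <= i) || (J <= j) -> w i j = 0) ->
  X0 (fun j => X1 (fun i => w i j) m r) n t =
  X1 (fun i => X0 (w i) n t) m r.
Proof.
move=> w0; rewrite /X0 /X1 bsumZ; congr (_ *: _).
apply: (@bsum_exchange _ _ _ _ _ `|J - n|%N `|I - r|%N) => i j /orP le.
by apply: w0; lia.
Qed.

(** What an iterated residue needs from its inner and outer operations, so that all choices of
    expansion points share [comp_pascal]. *)
Definition op_ok (Op : (int -> E) -> int -> int -> E) :=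
  [/\ forall u, tr0 u -> pascal (Op u),
      forall u v n r, tr0 u -> tr0 v -> Op (fun i => u i + v i) n r = Op u n r + Op v n r
    & forall u n r, (forall j, u j = 0) -> Op u n r = 0].

Lemma X1_ok : op_ok X1.
Proof.
split; [exact: X1_pascal|exact: X1D|] => u n r u0.
by apply: bsum_zero => i; apply: u0.
Qed.

Lemma X0_ok : op_ok X0.
Proof.
split; [exact: X0_pascal|exact: X0D|] => u n r u0.
by rewrite /X0 bsum_zero ?scaler0 // => i; apply: u0.
Qed.

Lemma comp_pascal Oo Oi (w : int -> int -> E) (I : int) : op_ok Oo -> op_ok Oi ->
  (forall i j : int, I <= i -> w i j = 0) -> (forall i, tr0 (w i)) ->
  (forall n t, pascal (fun m r => Oo (fun i => Oi (w i) n t) m r)) /\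
  (forall m r, pascal (fun n t => Oo (fun i => Oi (w i) n t) m r)).
Proof.
move=> [Po Ao Zo] [Pi Ai Zi] w0 tw.
have tin n t : tr0 (fun i => Oi (w i) n t).
  by exists I => i lei; apply: Zi => j; apply: w0.
split=> [n t|m r n t]; first exact: Po.
rewrite -Ao //; congr (Oo _ m r); apply/funext => i; exact: Pi.
Qed.

Definition pascal2 W := (forall n t, pascal (fun m r => W m r n t)) /\
  (forall m r, pascal (fun n t => W m r n t)).

Lemma pascal2N W : pascal2 W -> pascal2 (fun m r n t => - W m r n t).
Proof. by move=> [PW QW]; split=> ? ?; apply: pascalN. Qed.

Lemma pascal2D W W' : pascal2 W -> pascal2 W' ->
  pascal2 (fun m r n t => W m r n t + W' m r n t).
Proof. by move=> [PW QW] [PW' QW']; split=> ? ?; apply: pascalD. Qed.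

Lemma pascal2Z (c : K) W : pascal2 W -> pascal2 (fun m r n t => c *: W m r n t).
Proof. by move=> [PW QW]; split=> ? ? ? ?; rewrite -scalerDr ?PW ?QW. Qed.

Lemma pascal2_swap W : pascal2 W -> pascal2 (fun m r n t => W n t m r).
Proof. by case. Qed.

(* [(x - y) ^ k] expanded in powers of [y / x] near [0] and in powers of
   [(x - 1) / (y - 1)] near [1], applied to a two-variable system [W]. *)
Definition xy0 W (k m r n t : int) : E :=
  bsum (-1) k (fun l => W (m + k - l%:Z) r (n + l%:Z) t).
Definition xy1 W (k m r n t : int) : E :=
  sgn k *: bsum (-1) k (fun l => W m (r + l%:Z) n (t + k - l%:Z)).

Lemma xy0_0 W m r n t : xy0 W 0 m r n t = W m r n t.
Proof. by rewrite /xy0 bsum0 subr0 !addr0. Qed.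

Lemma xy1_0 W m r n t : xy1 W 0 m r n t = W m r n t.
Proof. by rewrite /xy1 bsum0 subr0 !addr0 scale1r. Qed.

Section Xy0.
Variables (W : int -> int -> int -> int -> E) (n0 : int).
Hypothesis PW : pascal2 W.
Hypothesis W0 : forall m r n t : int, n0 <= n -> W m r n t = 0.

Let ev m r n t k : ev0 (fun l : nat => W (m + k - l%:Z) r (n + l%:Z) t).
Proof. by exists `|n0 - n|%N => i le; apply: W0; lia. Qed.

Lemma xy0_vanish k m r n t : n0 <= n -> xy0 W k m r n t = 0.
Proof. by move=> le; apply: bsum_zero => l; apply: W0; lia. Qed.

Lemma xy0S k m r n t :
  xy0 W (k + 1) m r n t = xy0 W k (m + 1) r n t - xy0 W k m r (n + 1) t.
Proof.
rewrite /xy0 bsumS ?scaleN1r; last exact: ev.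
congr (bsum _ _ _ - bsum _ _ _); apply/funext => l; congr W; lia.
Qed.

Lemma xy0_pascal k : pascal2 (xy0 W k).
Proof.
split=> [n t m r|m r n t]; rewrite /xy0 -bsumD; try exact: ev.
  congr bsum; apply/funext => l; rewrite -PW.1; congr W; lia.
congr bsum; apply/funext => l; rewrite -PW.2; congr W; lia.
Qed.
End Xy0.

Section Xy1.
Variables (W : int -> int -> int -> int -> E) (R : int).
Hypothesis PW : pascal2 W.
Hypothesis W0 : forall m r n t : int, R <= r -> W m r n t = 0.

Let ev m r n t k : ev0 (fun l : nat => W m (r + l%:Z) n (t + k - l%:Z)).
Proof. by exists `|R - r|%N => i le; apply: W0; lia. Qed.

Lemma xy1_vanish k m r n t : R <= r -> xy1 W k m r n t = 0.
Proof.
by move=> le; rewrite /xy1 bsum_zero ?scaler0 // => l; apply: W0; lia.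
Qed.

Lemma xy1_pascal k : pascal2 (xy1 W k).
Proof.
split=> [n t m r|m r n t]; rewrite /xy1 -scalerDr -bsumD; try exact: ev.
  congr (_ *: bsum _ _ _); apply/funext => l.
  have -> : r + 1 + l%:Z = r + l%:Z + 1 by lia.
  exact: PW.1.
congr (_ *: bsum _ _ _); apply/funext => l.
have -> : t + 1 + k - l%:Z = t + k - l%:Z + 1 by lia.
exact: PW.2.
Qed.

Lemma xy1S' k m r n t :
  xy1 W (k + 1) m r n t = xy1 W k m (r + 1) n t - xy1 W k m r n (t + 1).
Proof.
rewrite /xy1 bsumS ?scaleN1r; last exact: ev.
rewrite sgnS scaleNr scalerBr opprB.
congr (_ *: bsum _ _ _ - _ *: bsum _ _ _); apply/funext => l; congr W; lia.
Qed.

Lemma xy1S k m r n t :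
  xy1 W (k + 1) m r n t = xy1 W k (m + 1) r n t - xy1 W k m r (n + 1) t.
Proof.
have [P1 P2] := xy1_pascal k.
by rewrite xy1S' P1 P2 opprD addrACA subrr addr0.
Qed.
End Xy1.

(* Both expansions agree where there is no residue at infinity in [y]. *)
Lemma xy01 W W' (n0 R c : int) : pascal2 W -> pascal2 W' ->
  (forall m r n t : int, n0 <= n -> W m r n t = 0) ->
  (forall m r n t : int, R <= r -> W' m r n t = 0) ->
  (forall m r n t : int, n + t <= c -> W m r n t = W' m r n t) ->
  forall k m r n t : int, n + t + k <= c -> xy0 W k m r n t = xy1 W' k m r n t.
Proof.
move=> PW PW' W0 W'0 eqW k.
elim/int_ind2: k => [|k _ IH|k _ IH] m r n t le.
- by rewrite xy0_0 xy1_0 eqW //; lia.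
- by rewrite (xy0S W0) (xy1S PW' W'0) !IH //; lia.
set D := fun m r n t => xy0 W (k - 1) m r n t - xy1 W' (k - 1) m r n t.
have [P1 P2] : pascal2 D.
  by apply: pascal2D (xy0_pascal PW W0 _) (pascal2N (xy1_pascal PW' W'0 _)).
(* By the case [k], the difference [D] is annihilated by [x - y], so a factor [x] may be traded for
   [y]. In [DS'] the same is done for [x - 1] and [y - 1]. *)
have DS m' r' n' t' : n' + t' + k <= c -> D (m' + 1) r' n' t' = D m' r' (n' + 1) t'.
  move=> le'; have := IH m' r' n' t' le'.
  rewrite -{1 2}(subrK 1 k) (xy0S W0) (xy1S PW' W'0) /D => /eqP.
  by rewrite subr_eq => /eqP ->; rewrite addrAC [X in X + _]addrAC subrr add0r addrC.
have DS' m' r' n' t' : n' + t' + k <= c -> D m' (r' + 1) n' t' = D m' r' n' (t' + 1).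
  move=> le'; have := DS m' r' n' t' le'; rewrite P1 P2.
  by move=> /(addIr _).
have mv m' r' n' t' : n' + t' + (k - 1) <= c ->
    D m' r' n' t' = D (m' - 1) (r' + 1) (n' + 1) (t' - 1).
  move=> le'; rewrite -{1}[t'](subrK 1) -DS'; last by lia.
  by rewrite -{1}[m'](subrK 1) DS //; lia.
(* The move keeps [n + t] fixed and raises [n] and [r] together, until both expansions vanish by
   truncation. *)
have mvs (j : nat) : D m r n t = D (m - j%:Z) (r + j%:Z) (n + j%:Z) (t - j%:Z).
  elim: j => [|j IHj]; first by congr D; lia.
  rewrite IHj mv; last by lia.
  by congr D; lia.
apply/eqP; rewrite -subr_eq0 -/(D m r n t) (mvs (`|n0 - n| + `|R - r|)%N) /D.
by rewrite (xy0_vanish W0) ?(xy1_vanish W'0) ?subr0 //; lia.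
Qed.

(* The expansion near [x = y], where [th k] are the coefficients of
   [(x - y) ^ (- k - 1)]. *)
Definition iter_sys (th : int -> int -> int -> E) (k m r n t : int) : E :=
  bsum 1 m (fun i => bsum 1 r (fun j =>
    th (k + i%:Z + j%:Z) (m + n - i%:Z) (r + t - j%:Z))).

Section Iter.
Variables (th : int -> int -> int -> E) (K0 : int).
Hypothesis Pth : forall k, pascal (th k).
Hypothesis th0 : forall k n t : int, K0 <= k -> th k n t = 0.

Let evi k n t r : ev0 (fun j : nat => th (k + j%:Z) n (r + t - j%:Z)).
Proof. by exists `|K0 - k|%N => j le; apply: th0; lia. Qed.

Let evo (f : nat -> nat -> E) (k r : int) :
  (forall i j : nat, K0 <= k + i%:Z + j%:Z -> f i j = 0) ->
  ev0 (fun i => bsum 1 r (f i)).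
Proof.
move=> f0; exists `|K0 - k|%N => i le; apply: bsum_zero => j; apply: f0; lia.
Qed.

(** [S1] and [S2] come from [x = y + (x - y)] and [x - 1 = (y - 1) + (x - y)], the second summand
    raising [k]. Together with [Q], the recurrence in [y], they give the one in [x]. *)
Lemma iter_sys_pascal k : pascal2 (iter_sys th k).
Proof.
have Q m r : pascal (fun n t => iter_sys th k m r n t).
  move=> n t; rewrite /iter_sys -bsumD; first last.
  - by apply: (evo (k := k)) => i j le; apply: th0.
  - by apply: (evo (k := k)) => i j le; apply: th0.
  congr bsum; apply/funext => i; rewrite -bsumD; try exact: evi.
  congr bsum; apply/funext => j.
  have -> : m + (n + 1) - i%:Z = m + n - i%:Z + 1 by lia.
  have -> : r + (t + 1) - j%:Z = r + t - j%:Z + 1 by lia.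
  exact: Pth.
have S1 m r n t : iter_sys th k (m + 1) r n t =
    iter_sys th k m r (n + 1) t + iter_sys th (k + 1) m r n t.
  rewrite /iter_sys bsumS; last by apply: (evo (k := k)) => i j le; apply: th0.
  rewrite scale1r; congr (bsum _ _ _ + bsum _ _ _); apply/funext => i;
    congr bsum; apply/funext => j; congr th; lia.
have S2 m r n t : iter_sys th k m (r + 1) n t =
    iter_sys th k m r n (t + 1) + iter_sys th (k + 1) m r n t.
  rewrite /iter_sys -bsumD; first last.
  - by apply: (evo (k := k + 1)) => i j le; apply: th0; lia.
  - by apply: (evo (k := k)) => i j le; apply: th0; lia.
  congr bsum; apply/funext => i; rewrite bsumS; last exact: evi.
  rewrite scale1r; congr (bsum _ _ _ + bsum _ _ _); apply/funext => j;
    congr th; lia.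
by split=> // n t m r; rewrite S1 S2 Q addrAC.
Qed.

Lemma iter_sys_0 k m n t : iter_sys th k m 0 n t =
  bsum 1 m (fun i => th (k + i%:Z) (m + n - i%:Z) t).
Proof.
congr bsum; apply/funext => i; rewrite bsum0; congr th; lia.
Qed.

Lemma iter_sys_1 k r n t : iter_sys th k 0 r n t =
  bsum 1 r (fun j => th (k + j%:Z) n (r + t - j%:Z)).
Proof.
rewrite /iter_sys bsum0; congr bsum; apply/funext => j; congr th; lia.
Qed.
End Iter.

(** [pascal1_eq0] in each variable in turn: the bound on [r + t] truncates either exponent once the
    other is fixed. *)
Lemma pascal2_eq0_1 W (N : int) : pascal2 W ->
  (forall m r n t : int, N <= r + t -> W m r n t = 0) ->
  (forall r t, W 0 r 0 t = 0) -> forall m r n t, W m r n t = 0.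
Proof.
move=> [P1 P2] WN W0 m r n t.
have H m' r' t' : W m' r' 0 t' = 0.
  apply: (@pascal1_eq0 _ _ (fun m r => W m r 0 t') (N - t') 0) => // n' r'' le.
  by apply: WN; lia.
apply: (@pascal1_eq0 _ _ (fun n t => W m r n t) (N - r) 0) => // n' t' le.
by apply: WN; lia.
Qed.

(** Downward induction on [m + n]: when the next antidiagonal vanishes, raising [r] or [t] only
    changes a sign, so the values at very negative [r] and [t] decide. Those are the values without
    residue at infinity. *)
Lemma pascal2_eq0_0 W (N : int) : pascal2 W ->
  (forall m r n t : int, N <= m + n -> W m r n t = 0) ->
  (forall m n, exists rho : int, forall r t : int, r <= rho -> t <= rho ->
     W m r n t = 0) ->
  forall m r n t, W m r n t = 0.
Proof.
move=> [P1 P2] WN Wr.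
suff H (s m n : int) : m + n = s -> forall r t, W m r n t = 0.
  by move=> m r n t; apply: (H (m + n)).
elim/(int_down_ind (N := N)): s m n => [s le m n es r t|s IH m n es].
  by apply: WN; lia.
have Sr r t : W m (r + 1) n t = - W m r n t.
  by apply/eqP; rewrite -addr_eq0 -P1 IH //; lia.
have St r t : W m r n (t + 1) = - W m r n t.
  by apply/eqP; rewrite -addr_eq0 -P2 IH //; lia.
have [rho Wrho] := Wr m n.
have Ur (j : nat) r t : W m (r + j%:Z) n t = (-1) ^+ j *: W m r n t.
  elim: j => [|j IHj]; first by rewrite addr0 scale1r.
  have -> : r + j.+1%:Z = r + j%:Z + 1 by lia.
  by rewrite Sr IHj exprS mulN1r scaleNr.
have Ut (j : nat) r t : W m r n (t + j%:Z) = (-1) ^+ j *: W m r n t.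
  elim: j => [|j IHj]; first by rewrite addr0 scale1r.
  have -> : t + j.+1%:Z = t + j%:Z + 1 by lia.
  by rewrite St IHj exprS mulN1r scaleNr.
move=> r t.
have -> : r = (r - `|r - rho|%N%:Z) + `|r - rho|%N%:Z by lia.
have -> : t = (t - `|t - rho|%N%:Z) + `|t - rho|%N%:Z by lia.
by rewrite Ur Ut Wrho ?scaler0 //; lia.
Qed.

End TwoVariables.

(** * Graded vector spaces and the Borcherds identity *)

Section LinearMaps.
Context {K : fieldType} {U W : lmodType K} (f : U -> W) (lf : linear f).

Let g : {linear U -> W} := HB.pack f (GRing.isLinear.Build _ _ _ _ f lf).

Lemma lin0 : f 0 = 0. Proof. exact: (linear0 g). Qed.
Lemma linD u v : f (u + v) = f u + f v. Proof. exact: (linearD g). Qed.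
Lemma linN u : f (- u) = - f u. Proof. exact: (linearN g). Qed.
Lemma linB u v : f (u - v) = f u - f v. Proof. exact: (linearB g). Qed.
Lemma linZ c u : f (c *: u) = c *: f u. Proof. by rewrite -[c *: u]addr0 lf lin0 addr0. Qed.
Lemma lin_sum I (r : seq I) (P : pred I) (F : I -> U) :
  f (\sum_(i <- r | P i) F i) = \sum_(i <- r | P i) f (F i).
Proof. exact: (linear_sum g). Qed.
End LinearMaps.

Section Subspace.
Context {K : fieldType} {W : lmodType K} (A : set W) (sA : subspace A).

Lemma sub0 : A 0. Proof. exact: sA.1. Qed.
Lemma subZ c u : A u -> A (c *: u).
Proof. by move=> Au; rewrite -[_ *: _]addr0; apply: sA.2 => //; exact: sub0. Qed.
Lemma subD u v : A u -> A v -> A (u + v).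
Proof. by move=> Au Av; rewrite -[u]scale1r; apply: sA.2. Qed.
Lemma subB u v : A u -> A v -> A (u - v).
Proof. by move=> Au Av; rewrite addrC -scaleN1r; apply: sA.2. Qed.
Lemma sub_sum I (r : seq I) (P : pred I) (F : I -> W) :
  (forall i, P i -> A (F i)) -> A (\sum_(i <- r | P i) F i).
Proof. by move=> AF; elim/big_ind: _ => //; [exact: sub0|exact: subD]. Qed.
End Subspace.

Lemma lin_bsum {K : numFieldType} {U W : lmodType K} (f : U -> W) (c : K) k (u : nat -> U) :
  linear f -> ev0 u -> f (bsum c k u) = bsum c k (fun i => f (u i)).
Proof.
move=> lf [N uN]; rewrite (bsumE _ _ uN) (@bsumE _ _ _ _ _ N) ?(lin_sum lf); last first.
  by move=> i /uN ->; exact: lin0.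
by apply: eq_bigr => i _; rewrite (linZ lf).
Qed.

Section Components.
Context {K : fieldType} {W : lmodType K} (G : nat -> set W).
Hypothesis hG : is_direct_sum G setT.

Let sG n : subspace (G n). Proof. by have [/(_ n)[]] := hG. Qed.

Lemma gr_repr w : exists (x : nat -> W) N,
  [/\ forall i, G i (x i), forall i, (N <= i)%N -> x i = 0 & w = \sum_(i < N) x i].
Proof.
have [_ /(_ w I)[s [x [us Gx ->]]] _] := hG.
pose N := (\max_(i <- s) i).+1.
have ltN i : i \in s -> (i < N)%N by move=> si; rewrite ltnS leq_bigmax_seq.
exists (fun i => if i \in s then x i else 0), N; split=> [i|i leN|].
- by case: ifP => _; [exact: Gx | exact: sub0].
- by case: ifP => // /ltN; rewrite ltnNge leN.
rewrite -(big_mkord xpredT (fun i => if i \in s then x i else 0)) -big_mkcond.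
rewrite -big_filter; apply: perm_big; apply: uniq_perm => //.
  by rewrite filter_uniq // iota_uniq.
move=> i; rewrite mem_filter mem_index_iota /=.
by case si: (i \in s); first by rewrite ltN.
Qed.

Lemma gr_indep N (x : nat -> W) : (forall i, G i (x i)) ->
  \sum_(i < N) x i = 0 -> forall i, (i < N)%N -> x i = 0.
Proof.
move=> Gx x0 i lti; have [_ _ /(_ (iota 0 N) x)] := hG; apply=> //.
- exact: iota_uniq.
- by rewrite -[X in iota _ X]subn0 -/(index_iota 0 N) big_mkord.
- by rewrite mem_iota.
Qed.

Definition comp (n : nat) (w : W) : W := sval (cid (gr_repr w)) n.

Lemma comp_in n w : G n (comp n w).
Proof. by rewrite /comp; case: cid => x h /=; have [N []] := h. Qed.

Lemma comp_sum w : exists N, (forall i, (N <= i)%N -> comp i w = 0) /\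
  w = \sum_(i < N) comp i w.
Proof.
by rewrite /comp; case: cid => x h /=; have [N [_ xN ew]] := h; exists N.
Qed.

Lemma comp_uniq w N (x : nat -> W) : (forall i, G i (x i)) ->
  (forall i, (N <= i)%N -> x i = 0) -> w = \sum_(i < N) x i ->
  forall n, comp n w = x n.
Proof.
move=> Gx xN ew n; have [M [cM ecM]] := comp_sum w.
apply/eqP; rewrite -subr_eq0; apply/eqP.
apply: (@gr_indep (maxn (maxn N M) n.+1) (fun n => comp n w - x n)).
- by move=> i; apply: subB => //; exact: comp_in.
- rewrite sumrB; apply/eqP; rewrite subr_eq0; apply/eqP.
  by rewrite (@sum_widen _ (comp^~ w) M) ?(@sum_widen _ x N) -?ew -?ecM //; lia.
- by lia.
Qed.

Lemma comp_linear n : linear (comp n).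
Proof.
move=> c u v; have [N [uN eu]] := comp_sum u; have [M [vM ev]] := comp_sum v.
apply: (@comp_uniq _ (maxn N M) (fun n => c *: comp n u + comp n v)).
- by move=> i; apply: (sG i).2; exact: comp_in.
- by move=> i; rewrite geq_max => /andP[/uN-> /vM->]; rewrite scaler0 addr0.
rewrite big_split -scaler_sumr /= (@sum_widen _ (comp^~ u) N) ?leq_maxl // -eu.
by rewrite (@sum_widen _ (comp^~ v) M) ?leq_maxr // -ev.
Qed.

Lemma comp_hom n w m : G n w -> comp m w = if m == n then w else 0.
Proof.
move=> Gw; apply: (@comp_uniq _ n.+1 (fun m => if m == n then w else 0)).
- by move=> i; case: eqP => [->|_] //; exact: sub0.
- by move=> i lti; rewrite gtn_eqF.
by rewrite big_ord_recr /= eqxx big1 ?add0r // => i _; rewrite ltn_eqF.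
Qed.

Lemma comp_id n w : G n w -> comp n w = w.
Proof. by move=> Gw; rewrite (comp_hom _ Gw) eqxx. Qed.

Lemma comp_eq u v : (forall n, comp n u = comp n v) -> u = v.
Proof.
move=> uv; apply/eqP; rewrite -subr_eq0; apply/eqP.
have [N [_ ->]] := comp_sum (u - v); apply: big1 => i _.
by rewrite (linB (comp_linear i)) uv subrr.
Qed.

Lemma gr_ind (A : set W) : subspace A -> (forall n w, G n w -> A w) -> forall w, A w.
Proof.
move=> sA GA w; have [N [_ ->]] := comp_sum w.
by apply: sub_sum => // i _; apply: GA; exact: comp_in.
Qed.

Lemma homogeneous_direct_sum (A : set W) : subspace A ->
  (forall n w, A w -> A (comp n w)) -> is_direct_sum (fun n => A `&` G n)%classic A.
Proof.
move=> sA Ac; split=> [i|w Aw|s x us Ax].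
- split; last by move=> w [].
  split; first by split; exact: sub0.
  by move=> c u v [Au Gu] [Av Gv]; split; [apply: sA.2 | apply: (sG i).2].
- have [N [_ ew]] := comp_sum w; exists (iota 0 N), (comp^~ w).
  split; [exact: iota_uniq| by move=> i; split; [exact: Ac|exact: comp_in]|].
  by rewrite -[X in iota _ X]subn0 -/(index_iota 0 N) big_mkord.
- by have [_ _] := hG; apply=> // i; have [] := Ax i.
Qed.

End Components.

Section Borcherds.
Context {K : numFieldType} {V W : lmodType K}.
Variables (md : V -> int -> V -> V) (act : V -> int -> W -> W).
Hypotheses (bmd : bilinear_modes md) (tmd : truncated md).
Hypotheses (bact : bilinear_modes act) (tact : truncated act).

Let ev1 a b w (m n k : int) :
  ev0 (fun j : nat => act (md a (k + j%:Z) b) (m + n - j%:Z) w).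
Proof.
have [N aN] := tmd a b; exists `|N - k|%N => i le.
by rewrite aN ?(lin0 (bact.1 _ _)) //; lia.
Qed.

Let ev2 a b w (k m n : int) :
  ev0 (fun j : nat => act a (m + k - j%:Z) (act b (n + j%:Z) w)).
Proof.
have [N bN] := tact b w; exists `|N - n|%N => i le.
by rewrite bN ?(lin0 (bact.2 _ _)) //; lia.
Qed.

(** Free of the common cutoff in [borcherds_identity], so that it can be reduced by linearity to
    homogeneous vectors. *)
Definition borcherds_sum a b w (m n k : int) :=
  bsum 1 m (fun j => act (md a (k + j%:Z) b) (m + n - j%:Z) w) =
  bsum (-1) k (fun j => act a (m + k - j%:Z) (act b (n + j%:Z) w))
  - sgn k *: bsum (-1) k (fun j => act b (n + k - j%:Z) (act a (m + j%:Z) w)).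

Lemma borcherds_bsum :
  borcherds_identity md act <-> forall a b w m n k, borcherds_sum a b w m n k.
Proof.
have eqN a b w m n k : exists N0 : nat, forall N : nat, (N0 <= N)%N ->
   bsum 1 m (fun j => act (md a (k + j%:Z) b) (m + n - j%:Z) w) =
    \sum_(j < N) binz m j *: act (md a (k + j%:Z) b) (m + n - j%:Z) w /\
   bsum (-1) k (fun j => act a (m + k - j%:Z) (act b (n + j%:Z) w))
  - sgn k *: bsum (-1) k (fun j => act b (n + k - j%:Z) (act a (m + j%:Z) w)) =
    \sum_(j < N) ((-1) ^+ j * binz k j) *:
       (act a (m + k - j%:Z) (act b (n + j%:Z) w)
        - (-1) ^+ `|k|%N *: act b (n + k - j%:Z) (act a (m + j%:Z) w)).
  have [N1 H1] := ev1 a b w m n k.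
  have [N2 H2] := ev2 a b w k m n; have [N3 H3] := ev2 b a w k n m.
  exists (maxn N1 (maxn N2 N3)) => N; rewrite !geq_max => /and3P[le1 le2 le3].
  split.
    rewrite (@bsumE _ _ _ _ _ N); last by move=> i lei; apply: H1; lia.
    by apply: eq_bigr => i _; rewrite expr1n mul1r.
  rewrite (@bsumE _ _ _ _ _ N); last by move=> i lei; apply: H2; lia.
  rewrite (@bsumE _ _ _ _ _ N); last by move=> i lei; apply: H3; lia.
  rewrite scaler_sumr -sumrB; apply: eq_bigr => i _.
  by rewrite scalerBr !scalerA [sgn k * _]mulrC.
split=> H a b w m n k.
  have [N0 HN] := eqN a b w m n k; have [N1 HN1] := H a b w m n k.
  rewrite /borcherds_sum; have [-> ->] := HN (maxn N0 N1) (leq_maxl _ _).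
  exact: HN1 (leq_maxr _ _).
have [N0 HN] := eqN a b w m n k; exists N0 => N /HN [<- <-]; exact: H.
Qed.

Let bsum_lin (c c' : K) (k : int) (u v w : nat -> W) : ev0 u -> ev0 v ->
  (forall j, w j = c' *: u j + v j) -> bsum c k w = c' *: bsum c k u + bsum c k v.
Proof.
move=> u0 v0 wE; rewrite -bsumZ -bsumD //; last exact: (ev0Z (fun=> c')).
by congr bsum; apply/funext.
Qed.

Let comb (c s : K) (x1 y1 z1 x2 y2 z2 x y z : W) : x1 = y1 - s *: z1 ->
  x2 = y2 - s *: z2 -> x = c *: x1 + x2 -> y = c *: y1 + y2 -> z = c *: z1 + z2 ->
  x = y - s *: z.
Proof.
move=> -> -> -> -> ->; rewrite scalerBr scalerDr opprD !scalerA [s * c]mulrC.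
by rewrite addrACA.
Qed.

Lemma borcherds_sum_linl b w m n k : subspace (fun a => borcherds_sum a b w m n k).
Proof.
split=> [|c a1 a2 H1 H2].
  rewrite /borcherds_sum !bsum_zero ?scaler0 ?subr0 // => i.
  - by rewrite (lin0 (bact.1 _ _)) (lin0 (bact.2 _ _)).
  - by rewrite (lin0 (bact.1 _ _)).
  - by rewrite (lin0 (bmd.1 _ _)) (lin0 (bact.1 _ _)).
apply: (comb (c := c) H1 H2); apply: bsum_lin => //.
- by move=> j; rewrite bmd.1 bact.1.
- by move=> j; rewrite bact.1.
- by move=> j; rewrite bact.1 bact.2.
Qed.

Lemma borcherds_sum_linr a w m n k : subspace (fun b => borcherds_sum a b w m n k).
Proof.
split=> [|c b1 b2 H1 H2].
  rewrite /borcherds_sum !bsum_zero ?scaler0 ?subr0 // => i.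
  - by rewrite (lin0 (bact.1 _ _)).
  - by rewrite (lin0 (bact.1 _ _)) (lin0 (bact.2 _ _)).
  - by rewrite (lin0 (bmd.2 _ _)) (lin0 (bact.1 _ _)).
apply: (comb (c := c) H1 H2); apply: bsum_lin => //.
- by move=> j; rewrite bmd.2 bact.1.
- by move=> j; rewrite bact.1 bact.2.
- by move=> j; rewrite bact.1.
Qed.

End Borcherds.

(** * Functionals as modules *)

Section Functionals.
Context {R : realType} {V : voa R} (d : nat) {E : lmodType R[i]}.
Local Notation K := (R[i]).
Implicit Types (al : V -> E) (a b v : V) (kap p q : int).

Lemma mode_lin a n : linear (@mode R V a n).
Proof. exact: (mode_bilinear V).2. Qed.
Lemma mode_linl n v : linear (fun a => @mode R V a n v).
Proof. exact: (mode_bilinear V).1. Qed.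

Lemma gr_int0 p : gr_int (vgr V) p 0.
Proof. by case: p => [n|n] //=; have [/(_ n)[] []] := vgr_direct_sum V. Qed.

Lemma gr_int_neg p a : p < 0 -> gr_int (vgr V) p a -> a = 0.
Proof. by case: p. Qed.

Lemma mode_gr p q n a b : gr_int (vgr V) p a -> gr_int (vgr V) q b ->
  gr_int (vgr V) (p + q - n - 1) (mode a n b).
Proof.
case: p => [p|p] /=; last by move=> -> _; rewrite (lin0 (mode_linl _ _)); apply: gr_int0.
case: q => [q|q] /=; last by move=> _ ->; rewrite (lin0 (mode_lin _ _)); apply: gr_int0.
exact: mode_deg.
Qed.

Lemma tr0_mode al a v : linear al -> tr0 (fun j => al (mode a j v)).
Proof.
move=> la; have [N vN] := mode_truncated a v; exists N => j /vN ->.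
exact: lin0.
Qed.

(* With [al v] thought of as the matrix coefficient of [Y(v, 1) w] in degree
   [d], where [w] has degree [kap], the function [x |-> al (Y(a, x - 1) v)]
   is that of [Y(a, x) Y(v, 1) w]: it is rational with poles at [0], [1] and
   [oo], of order at most [p + kap] at [0] and [d - p] at [oo].  Expanding it
   at [0] defines the action of the modes of [a] on [w]. *)
Definition functionals kap : set (V -> E) := fun al =>
  linear al /\ forall p a v (n r : int), gr_int (vgr V) p a -> p + kap <= n ->
    n + r <= p - d%:Z - 2 -> X1 (fun j => al (mode a j v)) n r = 0.

(** [kap + d + 1] is the least [T] allowed by [ext_X0] with [N = p + kap] and [c = p - d - 2]; the
    absolute value is also large enough when that number is negative. *)
Definition fmode1 kap p (n : int) (a : V) al : V -> E := fun v =>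
  ext (X1 (fun j => al (mode a j v))) (p + kap) (absz (kap + d%:Z + 1)%R) n.

Lemma fmode1_vanish kap p n a al v : p + kap <= n -> fmode1 kap p n a al v = 0.
Proof. by move=> le; rewrite /fmode1 ext_vanish. Qed.

Lemma tr0_fmode1 kap p a al v : tr0 (fun n => fmode1 kap p n a al v).
Proof. exact: ext_tr0. Qed.

Lemma fmode1E kap p a al v n r : functionals kap al -> gr_int (vgr V) p a ->
  n + r <= p - d%:Z - 2 ->
  X0 (fun n => fmode1 kap p n a al v) n r = - X1 (fun j => al (mode a j v)) n r.
Proof.
move=> [la Fa] Va; apply: (@ext_X0 _ _ (X1 (fun j => al (mode a j v))));
  last by lia.
- exact/X1_pascal/tr0_mode.
- by move=> n' r'; exact: Fa.
Qed.

Lemma ext_lin (X Y : int -> int -> E) (c : K) N T n :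
  ext (fun n r => c *: X n r + Y n r) N T n = c *: ext X N T n + ext Y N T n.
Proof.
have tr (Z : int -> int -> E) : tr0 (fun j => if j < N then Z j (- T%:Z) else 0).
  by exists N => j lej; rewrite ltNge lej.
rewrite /ext scalerN -opprD; congr (- _); rewrite -X0Z -X0D ?tr //.
  by congr X0; apply/funext => j; case: ifP; rewrite ?scaler0 ?addr0.
exact: tr0Z.
Qed.

Lemma fmode1_lin kap p n a al : linear al -> linear (fmode1 kap p n a al).
Proof.
move=> la c u v; rewrite /fmode1 -ext_lin; congr ext.
apply/funext => m; apply/funext => r.
rewrite -X1Z -X1D; [|exact/tr0Z/tr0_mode|exact: tr0_mode].
by congr X1; apply/funext => j; rewrite (mode_lin _ _) la.
Qed.

Lemma fmode1_linl kap p n al v : linear al -> linear (fun a => fmode1 kap p n a al v).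
Proof.
move=> la c a b; rewrite /fmode1 -ext_lin; congr ext.
apply/funext => m; apply/funext => r.
rewrite -X1Z -X1D; [|exact/tr0Z/tr0_mode|exact: tr0_mode].
by congr X1; apply/funext => j; rewrite (mode_linl _ _) la.
Qed.

Lemma fmode1_linr kap p n a v (c : K) al be : linear al -> linear be ->
  fmode1 kap p n a (c *: al + be) v = c *: fmode1 kap p n a al v + fmode1 kap p n a be v.
Proof.
move=> la lb; rewrite /fmode1 -ext_lin; congr ext.
apply/funext => m; apply/funext => r.
rewrite -X1Z -X1D; [|exact/tr0Z/tr0_mode|exact: tr0_mode].
by congr X1; apply/funext => j.
Qed.

Lemma functionals_lin kap al : functionals kap al -> linear al.
Proof. by case. Qed.

Lemma fmode1_0r kap p n a v : fmode1 kap p n a (fun=> 0) v = 0.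
Proof.
have [_ _ Z0] := @X0_ok (K : numFieldType) E; have [_ _ Z1] := @X1_ok (K : numFieldType) E.
by rewrite /fmode1 /ext Z0 ?oppr0 // => j; case: ifP => // _; rewrite Z1.
Qed.

Lemma functionals_sub kap : subspace (functionals kap : set (V -> E)).
Proof.
have [_ _ Z1] := @X1_ok (K : numFieldType) E.
split.
  split; first by move=> c u v; rewrite scaler0 addr0.
  by move=> p a v n r _ _ _; rewrite Z1.
move=> c al be [la Fa] [lb Fb]; split.
  move=> c' u v; rewrite !fctE la lb !scalerDr !scalerA [c' * c]mulrC.
  by rewrite addrACA.
move=> p a v n r Va le1 le2.
rewrite (X1D (u := fun j => c *: al (mode a j v))); [|exact/tr0Z/tr0_mode|exact: tr0_mode].
by rewrite X1Z (Fa p) // (Fb p) // scaler0 addr0.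
Qed.

(** The function of the vacuum is the constant [al v]. For [kap <= -1] it may be tested against
    [x^(-1) (x-1)^(-d-1)], whose residue at 1 is [(-1)^d]. This is why the module has no negative
    degrees. *)
Lemma functionals_neg kap al : functionals kap al -> kap < 0 -> al = (fun=> 0).
Proof.
move=> [la Fa] neg; apply/funext => v.
have /= V0 := @vac_deg R V.
have := Fa 0%:Z vac v (-1) (- d%:Z - 1) V0; rewrite /X1 => /(_ _ _)/wrap[]; try lia.
rewrite (@bsumE _ _ _ _ _ d.+1); last first.
  by move=> i lei; rewrite vac_mode; case: eqP => [|_]; [lia|exact: lin0].
rewrite big_ord_recr /= big1 ?add0r; last first.
  move=> i _; rewrite vac_mode; have lti := ltn_ord i.
  by case: eqP => [|_]; [lia|rewrite (lin0 la) scaler0].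
rewrite vac_mode; have -> : (- d%:Z - 1 + d%:Z == -1) by lia.
rewrite binzN1 expr1n mul1r => /eqP; rewrite scaler_eq0 signr_eq0 /=.
by move/eqP.
Qed.

Lemma fmode1_unique kap p a al v u : functionals kap al -> gr_int (vgr V) p a ->
  tr0 u ->
  (forall n r, n + r <= p - d%:Z - 2 -> X0 u n r = - X1 (fun j => al (mode a j v)) n r) ->
  forall n, fmode1 kap p n a al v = u n.
Proof.
move=> Fa Va tu Hu; apply: (X0_inj (c := p - d%:Z - 2)) => //.
  exact: tr0_fmode1.
by move=> n r le; rewrite (fmode1E v Fa Va le) Hu.
Qed.

End Functionals.

Section FunctionalBorcherds.
Context {R : realType} {V : voa R} (d : nat) {E : lmodType R[i]}.
Local Notation K := (R[i]).
Local Notation functionals := (@functionals R V d E).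
Local Notation fmode1 := (@fmode1 R V d E).

Section TwoModes.
Variables (kap p q : int) (al : V -> E) (a b v : V).
Hypotheses (la : linear al) (Fal : functionals kap al) (Vb : gr_int (vgr V) q b).

Let ok0 : op_ok (@X0 (K : numFieldType) E) := X0_ok.
Let ok1 : op_ok (@X1 (K : numFieldType) E) := X1_ok.

(* The systems of residues with [Y(a, x)] and then [Y(b, y)] both applied near
   [1], and with [Y(a, x)] applied near [1] and [Y(b, y)] near [0]. *)
Definition sys11 (m r n t : int) : E :=
  X1 (fun i => X1 (fun j => al (mode b j (mode a i v))) n t) m r.
Definition sys10 (m r n t : int) : E :=
  X1 (fun i => X0 (fun j => fmode1 kap q j b al (mode a i v)) n t) m r.

Let tr_a : exists N : int, forall i, N <= i -> mode a i v = 0.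
Proof. exact: mode_truncated. Qed.

Lemma sys11_pascal : pascal2 sys11.
Proof.
have [N vN] := tr_a; apply: (comp_pascal (I := N)) => // [i j le|i].
  by rewrite vN // (lin0 (mode_lin _ _)) (lin0 la).
exact: tr0_mode.
Qed.

Lemma sys11_vanish : exists Rr : int, forall m r n t : int, Rr <= r -> sys11 m r n t = 0.
Proof.
have [N vN] := tr_a; exists N => m r n t le.
apply: (X1_vanish (R := N)) => // i lei; apply: bsum_zero => j.
by rewrite vN // (lin0 (mode_lin _ _)) (lin0 la).
Qed.

Lemma sys10_pascal : pascal2 sys10.
Proof.
have [N vN] := tr_a; apply: (comp_pascal (I := N)) => // [i j le|i].
  by rewrite vN // (lin0 (fmode1_lin _ _ _ _ _ la)).
exact: tr0_fmode1.
Qed.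

Lemma sys10_vanish (m r n t : int) : q + kap <= n -> sys10 m r n t = 0.
Proof.
move=> le; have [_ _ Z1] := ok1; apply: Z1 => i.
by apply: (X0_vanish (N := q + kap)) => // j lej; exact: fmode1_vanish.
Qed.

Lemma sys10_11 (m r n t : int) : n + t <= q - d%:Z - 2 ->
  sys10 m r n t = - sys11 m r n t.
Proof.
move=> le; rewrite /sys10 /sys11 -scaleN1r -X1Z; congr X1.
by apply/funext => i; rewrite (fmode1E _ Fal Vb le) scaleN1r.
Qed.

Lemma xy_sys10 (k m r n t : int) : n + t + k <= q - d%:Z - 2 ->
  xy0 sys10 k m r n t = - xy1 sys11 k m r n t.
Proof.
have [Rr sR] := sys11_vanish.
move=> le; rewrite (@xy01 _ _ sys10 (fun m r n t => - sys11 m r n t)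
   (q + kap) Rr (q - d%:Z - 2)) //.
- rewrite /xy1 -scalerN; congr (_ *: _).
  by rewrite -scaleN1r -bsumZ; congr bsum; apply/funext => l; rewrite scaleN1r.
- exact: sys10_pascal.
- exact: pascal2N sys11_pascal.
- exact: sys10_vanish.
- by move=> ? ? ? ? /sR ->; rewrite oppr0.
- exact: sys10_11.
Qed.

Definition th1 (k n t : int) : E := X1 (fun j => al (mode (mode a k b) j v)) n t.

Lemma th1_pascal k : pascal (th1 k).
Proof. exact/X1_pascal/tr0_mode. Qed.

Lemma th1_vanish : exists K0 : int, forall k n t : int, K0 <= k -> th1 k n t = 0.
Proof.
have [N bN] := mode_truncated a b; exists N => k n t le.
have [_ _ Z1] := ok1; apply: Z1 => j.
by rewrite bN // (lin0 (mode_linl _ _)) (lin0 la).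
Qed.

End TwoModes.

(** Truncation bounds one mode at a time; a bound on the sum of both indices comes from [V] having
    no negative degrees. [pascal2_eq0_1] requires a bound of this kind. *)
Lemma mode_mode_vanish (a b v : V) : exists N : int, forall i j : int,
  N <= i + j -> mode a i (mode b j v) = 0 /\ mode (mode a i b) j v = 0.
Proof.
pose P (a b v : V) := exists N : int, forall i j : int,
  N <= i + j -> mode a i (mode b j v) = 0 /\ mode (mode a i b) j v = 0.
have l0 i v' : mode (0 : V) i v' = 0 by rewrite (lin0 (mode_linl _ _)).
have r0 a' i : mode a' i (0 : V) = 0 by rewrite (lin0 (mode_lin _ _)).
have sP1 b' v' : subspace (fun a => P a b' v').
  split; first by exists 0 => i j _; rewrite !l0.
  move=> c a1 a2 [N1 H1] [N2 H2]; exists (Num.max N1 N2) => i j.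
  rewrite ge_max => /andP[/H1[e1 e1'] /H2[e2 e2']].
  by rewrite !(mode_linl _ _) e1 e2 e1' e2' scaler0 addr0.
have sP2 a' v' : subspace (fun b => P a' b v').
  split; first by exists 0 => i j _; rewrite l0 !r0 l0.
  move=> c a1 a2 [N1 H1] [N2 H2]; exists (Num.max N1 N2) => i j.
  rewrite ge_max => /andP[/H1[e1 e1'] /H2[e2 e2']].
  by rewrite (mode_linl _ _) !(mode_lin _ _) (mode_linl _ _) e1 e2 e1' e2' scaler0 addr0.
have sP3 a' b' : subspace (fun v => P a' b' v).
  split; first by exists 0 => i j _; rewrite !r0.
  move=> c a1 a2 [N1 H1] [N2 H2]; exists (Num.max N1 N2) => i j.
  rewrite ge_max => /andP[/H1[e1 e1'] /H2[e2 e2']].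
  by rewrite !(mode_lin _ _) e1 e2 e1' e2' scaler0 addr0.
rewrite -/(P a b v); move: v; apply: (gr_ind (vgr_direct_sum V)) => // s v Vs.
move: b; apply: (gr_ind (vgr_direct_sum V)) => // q b Vb.
move: a; apply: (gr_ind (vgr_direct_sum V)) => // p a Va.
exists (p%:Z + q%:Z + s%:Z) => i j le; split.
  have Vj : gr_int (vgr V) (q%:Z + s%:Z - j - 1) (mode b j v) by exact: mode_gr.
  have := @mode_gr _ V p%:Z _ i a _ Va Vj.
  apply: gr_int_neg; lia.
have Vj : gr_int (vgr V) (p%:Z + q%:Z - i - 1) (mode a i b) by exact: mode_gr.
have := @mode_gr _ V _ s%:Z j _ v Vj Vs.
apply: gr_int_neg; lia.
Qed.

Lemma voa_borcherds (f : V -> E) a b v (m n k : int) : linear f ->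
  bsum 1 m (fun j => f (mode (mode a (k + j%:Z) b) (m + n - j%:Z) v)) =
  bsum (-1) k (fun j => f (mode a (m + k - j%:Z) (mode b (n + j%:Z) v)))
  - sgn k *: bsum (-1) k (fun j => f (mode b (n + k - j%:Z) (mode a (m + j%:Z) v))).
Proof.
move=> lf; have := (borcherds_bsum (@mode_truncated _ V)
  (mode_bilinear V) (@mode_truncated _ V)).1 (@mode_borcherds _ V) a b v m n k.
rewrite /borcherds_sum => /(congr1 f).
have E1 : ev0 (fun j : nat => mode (mode a (k + j%:Z) b) (m + n - j%:Z) v).
  have [N aN] := mode_truncated a b; exists (absz (N - k)) => i le.
  by rewrite aN ?(lin0 (mode_linl _ _)) //; lia.
have E2 a' b' (m' n' : int) :
    ev0 (fun j : nat => mode a' (m' + k - j%:Z) (mode b' (n' + j%:Z) v)).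
  have [N bN] := mode_truncated b' v; exists (absz (N - n')) => i le.
  by rewrite bN ?(lin0 (mode_lin _ _)) //; lia.
by rewrite (linB lf) (linZ lf) !(lin_bsum _ _ lf).
Qed.

Section BorcherdsAtOne.
Variables (kap : int) (al : V -> E) (a b v : V).
Hypotheses (la : linear al).

Let sysba := sys11 al a b v.
Let sysab := sys11 al b a v.
Let th := th1 al a b v.

Definition defect1 (k m r n t : int) : E :=
  iter_sys th k m r n t - sgn k *: xy1 sysab k n t m r + xy1 sysba k m r n t.

(* For [m = n = 0] this is the Borcherds identity of [V]. *)
Lemma defect1_eq0 k m r n t : defect1 k m r n t = 0.
Proof.
have [Rab sRab] := sys11_vanish b a v la; have [Rba sRba] := sys11_vanish a b v la.
have [K0 thK0] := th1_vanish a b v la.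
have Pth : pascal2 (iter_sys th k).
  by apply: (iter_sys_pascal (K0 := K0)) => //; exact: th1_pascal.
have Pab : pascal2 (xy1 sysab k).
  by apply: (xy1_pascal (R := Rab)) => //; exact: sys11_pascal.
have Pba : pascal2 (xy1 sysba k).
  by apply: (xy1_pascal (R := Rba)) => //; exact: sys11_pascal.
have PD : pascal2 (defect1 k).
  rewrite /defect1; apply: pascal2D => //; apply: pascal2D => //.
  exact/pascal2N/pascal2Z/pascal2_swap.
have [Nab vab] := mode_mode_vanish a b v.
have [Nba vba] := mode_mode_vanish b a v.
have [_ _ Z1] := @X1_ok (K : numFieldType) E.
apply: (@pascal2_eq0_1 (K : numFieldType) E (defect1 k) (Num.max Nab Nba - k)) => //.
- move=> m' r' n' t' le; rewrite /defect1.
  have -> : iter_sys th k m' r' n' t' = 0.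
    apply: bsum_zero => i; apply: bsum_zero => j.
    rewrite /th /th1 /X1; apply: bsum_zero => l.
    have [|_ ->] := vab (k + i%:Z + j%:Z) (r' + t' - j%:Z + l%:Z); first by lia.
    exact: lin0.
  have -> : xy1 sysab k n' t' m' r' = 0.
    rewrite /xy1 bsum_zero ?scaler0 // => i; rewrite /sysab /sys11.
    rewrite /X1; apply: bsum_zero => j; apply: bsum_zero => l.
    have [|-> _] := vab (r' + k - i%:Z + l%:Z) (t' + i%:Z + j%:Z); first by lia.
    exact: lin0.
  have -> : xy1 sysba k m' r' n' t' = 0.
    rewrite /xy1 bsum_zero ?scaler0 // => i; rewrite /sysba /sys11.
    rewrite /X1; apply: bsum_zero => j; apply: bsum_zero => l.
    have [|-> _] := vba (t' + k - i%:Z + l%:Z) (r' + i%:Z + j%:Z); first by lia.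
    exact: lin0.
  by rewrite scaler0 subr0 addr0.
move=> r' t'; rewrite /defect1 iter_sys_1.
have eth : bsum 1 r' (fun j => th (k + j%:Z) 0 (r' + t' - j%:Z)) =
    bsum 1 r' (fun j => al (mode (mode a (k + j%:Z) b) (r' + t' - j%:Z) v)).
  by congr bsum; apply/funext => j; rewrite /th /th1 X1_0.
have eab : xy1 sysab k 0 t' 0 r' =
    sgn k *: bsum (-1) k (fun j => al (mode a (r' + k - j%:Z) (mode b (t' + j%:Z) v))).
  by congr (_ *: bsum _ _ _); apply/funext => j; rewrite /sysab /sys11 !X1_0.
have eba : xy1 sysba k 0 r' 0 t' =
    sgn k *: bsum (-1) k (fun j => al (mode b (t' + k - j%:Z) (mode a (r' + j%:Z) v))).
  by congr (_ *: bsum _ _ _); apply/funext => j; rewrite /sysba /sys11 !X1_0.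
rewrite eth eab eba (voa_borcherds a b v _ _ _ la) scalerA sgnK scale1r.
by rewrite addrAC subrK subrr.
Qed.

End BorcherdsAtOne.

(** Modes preserve functionals. The residues of [Y(a, x)] on [b_(n) al] are moved to a region where
    they can all be taken at 1; there the Borcherds identity reduces them to residues of [al]
    itself, which vanish by hypothesis. *)
Lemma fmode1_functionals kap (q n : int) al b : functionals kap al ->
  gr_int (vgr V) q b -> functionals (kap + q - n - 1) (fmode1 kap q n b al).
Proof.
move=> Fal Vb; have la := functionals_lin Fal.
split=> [|p a v m r Va]; first exact: fmode1_lin.
pose P := sys10 kap q al a b v.
have PP : pascal2 P by exact: sys10_pascal.
have P0 m' r' n' t' : q + kap <= n' -> P m' r' n' t' = 0 by exact: sys10_vanish.
have -> : X1 (fun j => fmode1 kap q n b al (mode a j v)) m r = P m r n 0.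
  by rewrite /P /sys10; congr X1; apply/funext => i; rewrite X0_0.
(* The extra factor [(x - y)^k] makes room for the induction: since higher powers of [y] already
   give zero, [x - y] acts as [x] ([red1]) and [y - 1] as [-1] ([red2]). *)
suff C n' k m' r' t' : p + q - 1 + kap <= m' + n' + k ->
    m' + r' + k <= p - d%:Z - 2 -> xy0 P k m' r' n' t' = 0.
  by move=> le1 le2; rewrite -xy0_0; apply: C; lia.
elim/(int_down_ind (N := q + kap)): n' k m' r' t' => [n' len|n' IH] k m' r' t' le1 le2.
  by apply: (xy0_vanish (n0 := q + kap)).
have PS k' : pascal2 (xy0 P k') by exact: (xy0_pascal PP P0).
(* By [ley] the residues may be taken at 1. Of the two terms left by the Borcherds identity, the
   modes of [a_(k) b] vanish by [ge1] and [lexy], and the other ordering by [ge2] and [lex]. *)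
have far k' m'' r'' t'' : p + q - 1 + kap <= m'' + n' + k' ->
    m'' + r'' + k' <= p - d%:Z - 2 -> p + kap <= m'' ->
    n' + t'' + k' <= q - d%:Z - 2 -> m'' + r'' + n' + t'' + k' <= p + q - d%:Z - 3 ->
    xy0 P k' m'' r'' n' t'' = 0.
  move=> ge1 lex ge2 ley lexy.
  rewrite (xy_sys10 a v la Fal Vb) //.
  have /eqP := defect1_eq0 a b v la k' m'' r'' n' t''.
  rewrite /defect1 addrC addr_eq0 => /eqP ->; rewrite opprK.
  have -> : iter_sys (th1 al a b v) k' m'' r'' n' t'' = 0.
    apply: bsum_zero => i; apply: bsum_zero => j; rewrite /th1.
    have Vab := mode_gr (k' + i%:Z + j%:Z) Va Vb.
    by apply: (Fal.2 _ _ _ _ _ Vab); lia.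
  rewrite /xy1 bsum_zero ?scaler0 ?subr0 // => l.
  rewrite /sys11; have [_ _ Z1] := @X1_ok (K : numFieldType) E.
  by apply: Z1 => i; apply: (Fal.2 _ _ _ _ _ Va); lia.
have red1 (s : nat) : xy0 P k m' r' n' t' = xy0 P (k - s%:Z) (m' + s%:Z) r' n' t'.
  elim: s => [|s ->]; first by rewrite subr0 addr0.
  have -> : k - s%:Z = k - s.+1%:Z + 1 by lia.
  have -> : m' + s.+1%:Z = m' + s%:Z + 1 by lia.
  by rewrite (xy0S P0) [X in _ - X]IH ?subr0 //; lia.
have red2 (s : nat) k' m'' r'' t'' : p + q - 1 + kap <= m'' + n' + k' ->
    m'' + r'' + k' <= p - d%:Z - 2 ->
    xy0 P k' m'' r'' n' t'' = (-1) ^+ s *: xy0 P k' m'' r'' n' (t'' - s%:Z).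
  move=> ge1 lex; elim: s => [|s ->]; first by rewrite scale1r subr0.
  have := (PS k').2 m'' r'' n' (t'' - s.+1%:Z).
  rewrite IH; [|lia|lia] => /esym/eqP; rewrite addr_eq0.
  have -> : t'' - s.+1%:Z + 1 = t'' - s%:Z by lia.
  by move/eqP => ->; rewrite exprS mulN1r scaleNr scalerN.
(* [s1] raises [m] to at least [p + kap], and [s2] lowers [t] until the two remaining bounds of
   [far] hold. *)
pose s1 := absz (p + kap - m')%R.
rewrite (red1 s1).
pose k1 := k - s1%:Z; pose m1 := m' + s1%:Z.
pose s2 := (absz (n' + t' + k1 - (q - d%:Z - 2))%R +
            absz (m1 + r' + n' + t' + k1 - (p + q - d%:Z - 3))%R)%N.
rewrite (red2 s2); [|lia|lia].
rewrite far ?scaler0 //; lia.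
Qed.

End FunctionalBorcherds.

Section BorcherdsAtZero.
Context {R : realType} {V : voa R} (d : nat) {E : lmodType R[i]}.
Local Notation K := (R[i]).
Local Notation functionals := (@functionals R V d E).
Local Notation fmode1 := (@fmode1 R V d E).

Definition fmode2 (kap p q j i : int) (a b : V) (al : V -> E) (v : V) : E :=
  fmode1 (kap + q - j - 1) p i a (fmode1 kap q j b al) v.

Definition sys00 kap p q (al : V -> E) (a b v : V) (m r n t : int) : E :=
  X0 (fun j => X0 (fun i => fmode2 kap p q j i a b al v) m r) n t.

Section TwoModes.
Variables (kap p q : int) (al : V -> E) (a b v : V).
Hypotheses (Fal : functionals kap al) (Va : gr_int (vgr V) p a)
  (Vb : gr_int (vgr V) q b).

Let la := functionals_lin Fal.

Lemma fmode2_vanish (i j : int) : q + kap <= j \/ p + q + kap - 1 <= i + j ->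
  fmode2 kap p q j i a b al v = 0.
Proof.
case=> le; last by apply: fmode1_vanish; lia.
rewrite /fmode2; have -> : fmode1 kap q j b al = (fun=> 0); last exact: fmode1_0r.
by apply/funext => u; exact: fmode1_vanish.
Qed.

Lemma sys00_pascal : pascal2 (sys00 kap p q al a b v).
Proof.
apply: (@pascal2_swap (K : numFieldType) E (fun n t m r => sys00 kap p q al a b v m r n t)).
apply: (comp_pascal (I := q + kap)); [exact: X0_ok|exact: X0_ok|move=> j i le|move=> j].
  by apply: fmode2_vanish; left.
by exists (p + q + kap - 1 - j) => i le; apply: fmode2_vanish; right; lia.
Qed.

Lemma sys00_vanish (m r n t : int) : q + kap <= n \/ p + q + kap - 1 <= m + n ->
  sys00 kap p q al a b v m r n t = 0.
Proof.
have [_ _ Z0] := @X0_ok (K : numFieldType) E.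
move=> le; rewrite /sys00 /X0 bsum_zero ?scaler0 // => j.
rewrite bsum_zero ?scaler0 // => i; apply: fmode2_vanish.
by case: le => le; [left|right]; lia.
Qed.

Lemma sys00_10 (m r n t : int) : m + r <= p - d%:Z - 2 ->
  sys00 kap p q al a b v m r n t = - sys10 d kap q al a b v m r n t.
Proof.
move=> le; have [N vN] := mode_truncated a v.
rewrite /sys10 -(@X01_exchange (K : numFieldType) E _ N (q + kap)); last first.
  move=> i j /orP[/vN ->|lej]; last exact: fmode1_vanish.
  exact/(lin0 (fmode1_lin _ _ _ _ _ la)).
rewrite -scaleN1r -X0Z; congr X0; apply/funext => j.
by rewrite /fmode2 (fmode1E _ (fmode1_functionals j Fal Vb) Va le) scaleN1r.
Qed.

Lemma xy_sys00 (k m r n t : int) : m + r + k <= p - d%:Z - 2 ->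
  n + t + k <= q - d%:Z - 2 ->
  xy0 (sys00 kap p q al a b v) k m r n t = xy1 (sys11 al a b v) k m r n t.
Proof.
move=> lex ley; rewrite -[RHS]opprK -(xy_sys10 a v la Fal Vb _ _ ley).
rewrite /xy0 -[RHS]scaleN1r -bsumZ; congr bsum; apply/funext => l.
by rewrite sys00_10 ?scaleN1r //; lia.
Qed.

Definition th0 (k n t : int) : E :=
  X0 (fun j => fmode1 kap (p + q - k - 1) j (mode a k b) al v) n t.

Lemma th0_1 (k n t : int) : n + t <= p + q - k - 1 - d%:Z - 2 ->
  th0 k n t = - th1 al a b v k n t.
Proof. by move=> le; rewrite /th0 (fmode1E _ Fal (mode_gr k Va Vb) le). Qed.

End TwoModes.

(** Transport of [defect1_eq0] from 1 to 0. The passage costs one sign on [th] and two on each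
    ordering; it also exchanges the orderings, since a mode acts on functionals through their
    argument. In total [D] becomes the negative of [defect1]. *)
Lemma fmode1_borcherds kap p q al a b v (m n k : int) : functionals kap al ->
  gr_int (vgr V) p a -> gr_int (vgr V) q b ->
  bsum 1 m (fun j => fmode1 kap (p + q - (k + j%:Z) - 1) (m + n - j%:Z)
                       (mode a (k + j%:Z) b) al v) =
  bsum (-1) k (fun j => fmode2 kap p q (n + j%:Z) (m + k - j%:Z) a b al v)
  - sgn k *: bsum (-1) k (fun j =>
       fmode2 kap q p (m + j%:Z) (n + k - j%:Z) b a al v).
Proof.
move=> Fal Va Vb; have la := functionals_lin Fal.
pose th := th0 kap p q al a b v.
pose Sab := sys00 kap p q al a b v; pose Sba := sys00 kap q p al b a v.
pose D m r n t := iter_sys th k m r n t - xy0 Sab k m r n t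
                  + sgn k *: xy0 Sba k n t m r.
suff D0 : D m 0 n 0 = 0.
  have eth : iter_sys th k m 0 n 0 = bsum 1 m (fun j =>
      fmode1 kap (p + q - (k + j%:Z) - 1) (m + n - j%:Z) (mode a (k + j%:Z) b) al v).
    rewrite iter_sys_0; congr bsum; apply/funext => j.
    by rewrite /th /th0 X0_0.
  have eab : xy0 Sab k m 0 n 0 =
      bsum (-1) k (fun j => fmode2 kap p q (n + j%:Z) (m + k - j%:Z) a b al v).
    by congr bsum; apply/funext => j; rewrite /Sab /sys00 !X0_0.
  have eba : xy0 Sba k n 0 m 0 =
      bsum (-1) k (fun j => fmode2 kap q p (m + j%:Z) (n + k - j%:Z) b a al v).
    by congr bsum; apply/funext => j; rewrite /Sba /sys00 !X0_0.
  have H (x y z : E) : x - y + z = 0 -> x = y - z.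
    by move=> /eqP; rewrite addr_eq0 subr_eq => /eqP ->; rewrite addrC.
  by rewrite -eth -eab -eba; exact: H D0.
have [K0 bK0] := mode_truncated a b.
have [_ _ Z0] := @X0_ok (K : numFieldType) E.
have thK0 (k' n' t' : int) : K0 <= k' -> th k' n' t' = 0.
  move=> le; rewrite /th /th0 bK0 //; apply: Z0 => j.
  exact/(lin0 (fmode1_linl _ _ _ _ _ la)).
have Pth : pascal2 (iter_sys th k).
  by apply: (iter_sys_pascal (K0 := K0)) => // k'; exact/X0_pascal/tr0_fmode1.
have Pab : pascal2 (xy0 Sab k).
  apply: (xy0_pascal (n0 := q + kap)); first exact: sys00_pascal.
  by move=> *; apply: sys00_vanish; left.
have Pba : pascal2 (xy0 Sba k).
  apply: (xy0_pascal (n0 := p + kap)); first exact: sys00_pascal.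
  by move=> *; apply: sys00_vanish; left.
have PD : pascal2 D.
  rewrite /D; apply: pascal2D => //; first by apply: pascal2D => //; exact: pascal2N.
  exact/pascal2Z/pascal2_swap.
apply: (@pascal2_eq0_0 (K : numFieldType) E D (p + q + kap - 1 - k)) => //.
- move=> m' r' n' t' le.
  have H (c : K) (x y z : E) : x = 0 -> y = 0 -> z = 0 -> x - y + c *: z = 0.
    by move=> -> -> ->; rewrite scaler0 subr0 addr0.
  apply: H.
  + apply: bsum_zero => i; apply: bsum_zero => j; rewrite /th /th0.
    by rewrite /X0 bsum_zero ?scaler0 // => l; apply: fmode1_vanish; lia.
  + by apply: bsum_zero => l; apply: sys00_vanish; right; lia.
  + by apply: bsum_zero => l; apply: sys00_vanish; right; lia.
move=> m' n'.
(* Low enough for [lex], [ley] and [lexy] together, the bounds excluding residues at infinity for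
   [a], for [b] and for [a_(k) b]. *)
exists (- (absz (m' + k - (p - d%:Z - 2))%R)%:Z - (absz (n' + k - (q - d%:Z - 2))%R)%:Z
  - (absz (m' + n' + k - (p + q - d%:Z - 3))%R)%:Z) => r' t' ler let_.
have lex : m' + r' + k <= p - d%:Z - 2 by clear -ler; lia.
have ley : n' + t' + k <= q - d%:Z - 2 by clear -let_; lia.
have lexy : m' + n' + r' + t' + k <= p + q - d%:Z - 3 by clear -ler let_; lia.
have eth : iter_sys th k m' r' n' t' = - iter_sys (th1 al a b v) k m' r' n' t'.
  rewrite /iter_sys -scaleN1r -bsumZ; congr bsum; apply/funext => i.
  rewrite -bsumZ; congr bsum; apply/funext => j.
  by rewrite scaleN1r; apply: th0_1 => //; clear -lexy; lia.
have eab : xy0 Sab k m' r' n' t' = xy1 (sys11 al a b v) k m' r' n' t'.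
  exact: (xy_sys00 v Fal Va Vb lex ley).
have eba : xy0 Sba k n' t' m' r' = xy1 (sys11 al b a v) k n' t' m' r'.
  exact: (xy_sys00 v Fal Vb Va ley lex).
have H (c : K) (x y z x' y' z' : E) : x = - x' -> y = z' -> z = y' ->
    x' - c *: y' + z' = 0 -> x - y + c *: z = 0.
  move=> -> -> -> /eqP; rewrite addr_eq0 subr_eq => /eqP ->.
  by rewrite opprD opprK addrAC subrK subrr.
by apply: (H _ _ _ _ _ _ _ eth eab eba); exact: defect1_eq0.
Qed.

End BorcherdsAtZero.

(** * Subspaces as vector spaces *)

Section SubLmodule.
Context {K : fieldType} {W : lmodType K} (U : set W).

(** The closure proof is an argument of the predicate, so that instance inference recovers it for an
    arbitrary set [U]. *)
Definition sub_pred (hU : subspace U) : {pred W} := fun w => `[< U w >].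

Lemma sub_pred_closed hU : submod_closed (sub_pred hU).
Proof.
split; first exact/asboolP/(sub0 hU).
by move=> c u v /asboolP Uu /asboolP Uv; apply/asboolP/hU.2.
Qed.

HB.instance Definition _ hU :=
  GRing.isSubmodClosed.Build K W (sub_pred hU) (sub_pred_closed hU).

Record sub_lmod (hU : subspace U) :=
  SubLmod { sub_val :> W; sub_valP : sub_val \in sub_pred hU }.
HB.instance Definition _ hU := [isSub for @sub_val hU].
HB.instance Definition _ hU := [Choice of sub_lmod hU by <:].
HB.instance Definition _ hU := [SubChoice_isSubLmodule of sub_lmod hU by <:].

Variable hU : subspace U.

Definition to_sub (w : W) (Uw : U w) : sub_lmod hU := SubLmod (asboolT Uw).

Lemma sub_valU (x : sub_lmod hU) : U (sub_val x).
Proof. exact/asboolP/(sub_valP x). Qed.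

Lemma sub_val_lin : linear (@sub_val hU).
Proof. by move=> c x y; exact: (linearP (val : sub_lmod hU -> W)). Qed.

Lemma sub_val_inj : injective (@sub_val hU).
Proof. exact: val_inj. Qed.

End SubLmodule.

Section DeltaSystem.
Context {K : numFieldType} {E : lmodType K}.
Variables (e : int) (x : E).

(* The residues of [x ^ (- e - 1)]. *)
Definition delta1 (n r : int) : E :=
  if r < 0 then binz (n - e - 1) (absz (r + 1)%R) *: x else 0.

Lemma delta1_pascal : pascal delta1.
Proof.
move=> n r; rewrite /delta1; have [r0|r0] := ltP r 0; last first.
  by rewrite ltNge ler_wpDr //= ?addr0 //; have -> : r + 1 < 0 = false by lia.
have [r1|r1] := ltP (r + 1) 0; last first.
  have -> : r = -1 by lia.
  by rewrite !binz0 add0r.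
pose j := absz (r + 1 + 1)%R.
have -> : absz (r + 1)%R = j.+1 by rewrite /j; lia.
have -> : n + 1 - e - 1 = n - e - 1 + 1 by lia.
by rewrite -/j binz_pascal scalerDl addrC.
Qed.

Lemma delta_tr0 : tr0 (fun n => if n == e then x else 0).
Proof. by exists (e + 1) => j le; case: eqP => // ej; lia. Qed.

(** In this range [x^(n-e-1) (x-1)^r] decays at least like [x^(-2)], so the residues at 0 and 1
    cancel. *)
Lemma delta_X0 n r : n + r <= e - 1 ->
  X0 (fun n => if n == e then x else 0) n r = - delta1 n r.
Proof.
set u := fun n => _.
have tu : tr0 u := delta_tr0.
pose D n r := X0 u n r + delta1 n r.
have PD : pascal D by apply: pascalD; [exact: X0_pascal|exact: delta1_pascal].
suff H n' r' : n' + r' <= e - 1 -> D n' r' = 0.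
  by move=> /H /eqP; rewrite addr_eq0 => /eqP.
have base (n'' r'' : int) : e + 1 <= n'' -> n'' + r'' <= e - 1 -> D n'' r'' = 0.
  move=> len le; rewrite /D (X0_vanish (N := e + 1)) // ?add0r; last first.
    by move=> j lej; rewrite /u; case: eqP => // ej; lia.
  rewrite /delta1; have -> : r'' < 0 by lia.
  pose s := absz (n'' - e - 1)%R.
  have -> : n'' - e - 1 = s%:Z by rewrite /s; lia.
  by rewrite binz_nat bin_small ?scale0r // /s; lia.
elim/(int_down_ind (N := e + 1)): n' r' => [n' len r'|n' IH r' le]; first exact: base.
have [len|len] := leP (e + 1) n'; first exact: base.
have step (r'' : int) : n' + (r'' + 1) <= e - 1 -> D n' (r'' + 1) = - D n' r''.
  by move=> le'; apply/eqP; rewrite -addr_eq0 -PD IH //; lia.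
(* Column 0 has a zero in each row below [e]; in row [e] it lies outside the region, and column [-1]
   replaces it. *)
have [r0 le0 D0] : exists2 r0 : int, n' + r0 <= e - 1 & D n' r0 = 0.
  have [en|en] := eqVneq n' e; [exists (-1)|exists 0]; [lia| |lia|].
    rewrite /D /delta1 /X0 en subrr sub0r binz0 scale1r.
    rewrite (@bsumE _ _ _ _ _ 1) ?big_ord1 /=; last first.
      by move=> i lei; rewrite /u; case: eqP => // ?; lia.
    rewrite /u addr0 eqxx binz0 mul1r scale1r.
    by rewrite /sgn scaleN1r addNr.
  by rewrite /D X0_0 /u (negPf en) /delta1 ltxx addr0.
have -> : r' = r0 + (r' - r0) by lia.
have : n' + (r0 + (r' - r0)) <= e - 1 by lia.
elim/int_ind2: (r' - r0) => [|j _ IHj|j hj IHj] lej; first by rewrite addr0.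
  have ej : r0 + (j + 1) = r0 + j + 1 by lia.
  by rewrite ej step ?IHj ?oppr0 //; lia.
have ej : r0 + (j - 1) + 1 = r0 + j by lia.
by apply/eqP; rewrite -oppr_eq0 -step ?ej ?IHj //; lia.
Qed.

End DeltaSystem.

(** * The admissible module of families of functionals *)

Section ModuleOfFunctionals.
Context {R : realType} {V : voa R} (d : nat) {E : lmodType R[i]}.
Local Notation K := (R[i]).
Local Notation functionals := (@functionals R V d E).
Local Notation fmode1 := (@fmode1 R V d E).

(* Both the vacuum acting on any functional and any vector acting on a
   functional evaluated at the vacuum are given by a power of [x]. *)
Lemma fmode1_delta kap (p e : int) a al v x : functionals kap al ->
  gr_int (vgr V) p a -> p - d%:Z - 2 <= e - 1 ->
  (forall r : int, 0 <= r -> mode a r v = 0) ->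
  (forall r : int, r < 0 -> al (mode a r v) = binz (- e - 1) (absz (r + 1)%R) *: x) ->
  forall n, fmode1 kap p n a al v = if n == e then x else 0.
Proof.
move=> Fal Va le a0 aE; have la := functionals_lin Fal.
apply: (fmode1_unique Fal Va (delta_tr0 e x)) => n r lenr.
rewrite delta_X0; last by lia.
congr (- _); apply/eqP; rewrite eq_sym -subr_eq0; apply/eqP.
have t0 := tr0_mode a v la.
apply: (@pascal1_eq0 _ _ (fun n r => X1 (fun j => al (mode a j v)) n r - delta1 e x n r) 0 0).
- by apply: pascalD; [exact: X1_pascal|apply: pascalN; exact: delta1_pascal].
- move=> n' r' le0; rewrite (X1_vanish (R := 0)) // => [|j lej].
    by rewrite /delta1 ltNge le0 subr0.
  by rewrite a0 // (lin0 la).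
move=> r'; rewrite X1_0 /delta1; case: ltP => [lt0|le0].
  by rewrite aE // sub0r subrr.
by rewrite a0 // (lin0 la) subr0.
Qed.

Lemma fmode1_vac kap n al v : functionals kap al ->
  fmode1 kap 0 n vac al v = if n == -1 then al v else 0.
Proof.
move=> Fal; have la := functionals_lin Fal.
apply: (fmode1_delta Fal) => [||r le0|r lt0].
- exact: vac_deg.
- by lia.
- by rewrite vac_mode; case: eqP => // er; lia.
rewrite vac_mode opprK subrr; case: eqP => [->|ne].
  by rewrite binz0 scale1r.
have -> : absz (r + 1)%R = (absz (r + 2)%R).+1 by lia.
by rewrite binz0S scale0r (lin0 la).
Qed.

(** [Y(a, x - 1) 1 = exp((x - 1) L_(-1)) a], and under [al] each [L_(-1)] becomes minus the degree,
    so the function is [x^(-p) al a]. Evaluation at the vacuum thus recovers [al] from the zero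
    modes. *)
Lemma fmode1_at_vac kap (p : nat) a al : functionals kap al -> vgr V p a ->
  (forall x, al (mode conf 0 x + mode conf 1 x) = 0) ->
  fmode1 kap p (p%:Z - 1) a al vac = al a.
Proof.
move=> Fal Va al0; have la := functionals_lin Fal.
rewrite (@fmode1_delta kap p (p%:Z - 1) a al vac (al a) Fal Va) ?eqxx //; first by lia.
  by move=> r le; exact: mode_vac_ge0.
(* The coefficients of [x^(-q)] around 1. The degree changes with every [L_(-1)], hence the
   induction for all [b]. *)
suff H (j : nat) (q : nat) b : vgr V q b ->
    al (mode b (- 1 - j%:Z) vac) = binz (- q%:Z) j *: al b.
  move=> r lt0; have -> : - (p%:Z - 1) - 1 = - p%:Z by lia.
  by rewrite -H //; congr (al (mode a _ vac)); lia.
elim: j q b => [|j IH] q b Vb; first by rewrite subr0 mode_vac_N1 binz0 scale1r.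
have VLb : vgr V q.+1 (mode conf 0 b).
  have := mode_deg 0 (conf_deg V) Vb.
  by have -> : 2%:Z + q%:Z - 0 - 1 = q.+1%:Z by lia.
have := IH _ _ VLb; rewrite translation (linZ la).
have -> : al (mode conf 0 b) = - (q%:R *: al b).
  by have /eqP := al0 b; rewrite (linD la) addr_eq0 (vgr_L0 Vb) (linZ la) => /eqP.
have -> : -1 - j%:Z - 1 = -1 - j.+1%:Z by lia.
have nz : (j.+1)%:R != 0 :> K by rewrite pnatr_eq0.
move=> H; apply: (scalerI nz); rewrite scalerA binzS.
have <- : - (-1 - j%:Z)%:~R = j.+1%:R :> K.
  by rewrite -mulrNz; have -> : - (-1 - j%:Z) = j.+1%:Z by lia.
rewrite H scalerN scalerA -scaleNr; congr (_ *: _).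
rewrite -binz_down mulrC -mulNr; congr (_ * binz _ _); last by lia.
by rewrite mulrNz.
Qed.

(* The action of the modes on finitely supported families of functionals,
   graded by the parameter [kap]. *)
Definition fam (F : nat -> V -> E) : Prop :=
  (forall k : nat, functionals k (F k)) /\
  exists N, forall k, (N <= k)%N -> F k = (fun=> 0).

Definition famz (F : nat -> V -> E) (kap : int) : V -> E :=
  if kap is Posz k then F k else (fun=> 0).

(** [k - p + n + 1] is the degree that a mode of index [n] and a vector of degree [p] send to degree
    [k]; it may be negative, hence [famz]. *)
Definition fam_act (a : V) (n : int) (F : nat -> V -> E) : nat -> V -> E :=
  fun k v => evsum (fun p : nat =>
    fmode1 (k%:Z - p%:Z + n + 1) p n (comp (vgr_direct_sum V) p a)
         (famz F (k%:Z - p%:Z + n + 1)) v).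

Lemma functionals0 kap : functionals kap (fun=> 0).
Proof. exact: (sub0 (@functionals_sub R V d E kap)). Qed.

Lemma famzP F kap : fam F -> functionals kap (famz F kap).
Proof. by case: kap => [k|k] [FF _] //=; exact: functionals0. Qed.

Lemma famz_lin F kap : fam F -> linear (famz F kap).
Proof. by move=> /famzP FF; exact: functionals_lin. Qed.

Lemma fmode1_0l kap p n al v : linear al -> fmode1 kap p n 0 al v = 0.
Proof. by move=> la; exact: (lin0 (fmode1_linl _ _ _ _ _ la)). Qed.

Lemma fam_act_hom p a n F k v : fam F -> vgr V p a ->
  fam_act a n F k v =
  fmode1 (k%:Z - p%:Z + n + 1) p n a (famz F (k%:Z - p%:Z + n + 1)) v.
Proof.
move=> FF Va; rewrite /fam_act (evsum_single (p := p)) ?(comp_id _ Va) // => i ne.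
by rewrite (comp_hom _ _ Va) (negPf ne) fmode1_0l //; exact: famz_lin.
Qed.

Lemma fam_act_ev0 a n F k v : fam F -> ev0 (fun p : nat =>
    fmode1 (k%:Z - p%:Z + n + 1) p n (comp (vgr_direct_sum V) p a)
         (famz F (k%:Z - p%:Z + n + 1)) v).
Proof.
move=> FF; have [N [aN _]] := comp_sum (vgr_direct_sum V) a.
by exists N => i /aN ->; rewrite fmode1_0l //; exact: famz_lin.
Qed.

Lemma fam_sub : subspace fam.
Proof.
split.
  split; first by move=> k; exact: functionals0.
  by exists 0%N.
move=> c F G [F1 [N FN]] [G1 [M GM]]; split.
  by move=> k; apply: (@functionals_sub R V d E k).2.
exists (maxn N M) => k; rewrite geq_max => /andP[/FN eF /GM eG].
by apply/funext => v; rewrite !fctE eF eG scaler0 addr0.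
Qed.

Lemma fam_act_fam a n F : fam F -> fam (fam_act a n F).
Proof.
move=> FF; have [N [aN _]] := comp_sum (vgr_direct_sum V) a.
pose x (k p : nat) := fmode1 (k%:Z - p%:Z + n + 1) p n (comp (vgr_direct_sum V) p a)
         (famz F (k%:Z - p%:Z + n + 1)).
have xN k p : (N <= p)%N -> x k p = (fun=> 0).
  by move=> /aN e; apply/funext => v; rewrite /x e fmode1_0l //; exact: famz_lin.
have actE k : fam_act a n F k = \sum_(p < N) x k p.
  apply/funext => v; rewrite fct_sumE /fam_act.
  by rewrite (@evsumE _ _ _ N) // => p /(xN k) /(congr1 (@^~ v)).
split=> [k|].
  rewrite actE; apply: sub_sum => [|p _]; first exact: functionals_sub.
  have := fmode1_functionals n (famzP (k%:Z - p%:Z + n + 1) FF)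
    (comp_in (vgr_direct_sum V) p a : gr_int (vgr V) p _).
  by have -> : k%:Z - p%:Z + n + 1 + p%:Z - n - 1 = k%:Z by lia.
have [_ [M FM]] := FF; exists (N + M + absz n)%N => k le.
rewrite actE big1 // => p _; apply/funext => v; rewrite /x.
have -> : famz F (k%:Z - p%:Z + n + 1) = (fun=> 0).
  have lt := ltn_ord p.
  have -> : k%:Z - p%:Z + n + 1 = (absz (k%:Z - p%:Z + n + 1)%R)%:Z by lia.
  by apply: FM; lia.
exact: fmode1_0r.
Qed.

Definition fam_lmod : lmodType K := sub_lmod fam_sub.

Definition fmode (a : V) (n : int) (F : fam_lmod) : fam_lmod :=
  to_sub fam_sub (fam_act_fam a n (sub_valU F)).

Definition fgr (q : nat) : set fam_lmod :=
  fun F => forall k, k != q -> sub_val F k = (fun=> 0).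

Lemma fam_lmod_eq (F G : fam_lmod) :
  (forall k v, sub_val F k v = sub_val G k v) -> F = G.
Proof.
by move=> FG; apply: sub_val_inj; apply/funext => k; apply/funext => v.
Qed.

Lemma sub_valZD (c : K) (F G : fam_lmod) k v :
  sub_val (c *: F + G) k v = c *: sub_val F k v + sub_val G k v.
Proof. by rewrite sub_val_lin !fctE. Qed.

Lemma famzZD (c : K) (F G : fam_lmod) kap :
  famz (sub_val (c *: F + G)) kap = c *: famz (sub_val F) kap + famz (sub_val G) kap.
Proof.
apply/funext => v; case: kap => [k|k] /=; first exact: sub_valZD.
by rewrite !fctE scaler0 addr0.
Qed.

Lemma fmode_bilinear : bilinear_modes fmode.
Proof.
split=> [n F c a b|a n c F G]; apply: fam_lmod_eq => k v; rewrite sub_valZD /=.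
  rewrite /fam_act -evsumZ -evsumD; first last.
  - by apply: fam_act_ev0; exact: sub_valU.
  - by apply: (ev0Z (fun=> c)); apply: fam_act_ev0; exact: sub_valU.
  congr evsum; apply/funext => p.
  by rewrite (comp_linear _ p) (fmode1_linl _ _ _ _ _ (famz_lin _ (sub_valU F))).
rewrite /fam_act -evsumZ -evsumD; first last.
- by apply: fam_act_ev0; exact: sub_valU.
- by apply: (ev0Z (fun=> c)); apply: fam_act_ev0; exact: sub_valU.
congr evsum; apply/funext => p.
by rewrite famzZD fmode1_linr //; apply: famz_lin; exact: sub_valU.
Qed.

Lemma fmode_truncated : truncated fmode.
Proof.
move=> a F; have [FF [M FM]] := sub_valU F.
have [N [aN _]] := comp_sum (vgr_direct_sum V) a.
exists (N + M)%N%:Z => n le; apply: fam_lmod_eq => k v /=.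
rewrite /fam_act (@evsumE _ _ _ 0) ?big_ord0 // => p _.
have [leN|ltN] := leqP N p.
  by rewrite aN // fmode1_0l //; apply: famz_lin; exact: sub_valU.
have -> : famz (sub_val F) (k%:Z - p%:Z + n + 1) = (fun=> 0); last exact: fmode1_0r.
have -> : k%:Z - p%:Z + n + 1 = (absz (k%:Z - p%:Z + n + 1)%R)%:Z by lia.
by apply: FM; lia.
Qed.

Lemma fmode_vac n F : fmode vac n F = if n == -1 then F else 0.
Proof.
have FF := sub_valU F; apply: fam_lmod_eq => k v.
rewrite /= (fam_act_hom _ _ _ FF (vac_deg V)) fmode1_vac; last exact: famzP.
case: eqP => [->|_]; last by rewrite (lin0 (@sub_val_lin _ _ _ fam_sub)).
by have -> : k%:Z - 0%N%:Z + (-1) + 1 = k%:Z by lia.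
Qed.

(** When the intermediate degree is negative, the family is cut off there; by [functionals_neg]
    nothing is lost. *)
Lemma fmode_hom2 (p q : nat) a b i j (F : fam_lmod) (k0 : nat) v : vgr V p a -> vgr V q b ->
  sub_val (fmode a i (fmode b j F)) k0 v =
  fmode2 d (k0%:Z - p%:Z - q%:Z + i + j + 2) p q j i a b
    (famz (sub_val F) (k0%:Z - p%:Z - q%:Z + i + j + 2)) v.
Proof.
move=> Va Vb; have FF := sub_valU F.
rewrite /= (fam_act_hom _ _ _ (fam_act_fam _ _ FF) Va) /fmode2.
set kap := k0%:Z - p%:Z - q%:Z + i + j + 2.
have -> : kap + q%:Z - j - 1 = k0%:Z - p%:Z + i + 1 by rewrite /kap; lia.
suff -> : famz (fam_act b j (sub_val F)) (k0%:Z - p%:Z + i + 1) =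
    fmode1 kap q j b (famz (sub_val F) kap) by [].
have : kap + q%:Z - j - 1 = k0%:Z - p%:Z + i + 1 by rewrite /kap; lia.
case: (k0%:Z - p%:Z + i + 1) => [k1|k1] e.
  apply/funext => u; rewrite /= (fam_act_hom _ _ _ FF Vb).
  by have -> : k1%:Z - q%:Z + j + 1 = kap by lia.
rewrite (functionals_neg (fmode1_functionals j (famzP kap FF) (Vb : gr_int (vgr V) q b))) //.
by lia.
Qed.

Lemma fmode_borcherds : borcherds_identity (@mode R V) fmode.
Proof.
apply/(borcherds_bsum (@mode_truncated R V) fmode_bilinear fmode_truncated).
move=> a b F m n k; have FF := sub_valU F.
move: a; apply: (gr_ind (vgr_direct_sum V)) => [|p a Va].
  exact: (borcherds_sum_linl (mode_bilinear V) (@mode_truncated R V)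
    fmode_bilinear fmode_truncated).
move: b; apply: (gr_ind (vgr_direct_sum V)) => [|q b Vb].
  exact: (borcherds_sum_linr (mode_bilinear V) (@mode_truncated R V)
    fmode_bilinear fmode_truncated).
apply: fam_lmod_eq => k0 v.
pose f (G : fam_lmod) := sub_val G k0 v.
have lf : linear f by move=> c G H; exact: sub_valZD.
pose kap := k0%:Z - p%:Z - q%:Z + (m + n + k) + 2.
pose al := famz (sub_val F) kap.
have Fal : functionals kap al by exact: famzP.
rewrite -!/(f _) (linB lf) (linZ lf).
have E1 : ev0 (fun j : nat => fmode (mode a (k + j%:Z) b) (m + n - j%:Z) F).
  have [N aN] := mode_truncated a b; exists (absz (N - k)) => i le.
  by rewrite aN ?(lin0 (fmode_bilinear.1 _ _)) //; lia.
have E2 a' b' (m' n' : int) :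
    ev0 (fun j : nat => fmode a' (m' + k - j%:Z) (fmode b' (n' + j%:Z) F)).
  have [N bN] := fmode_truncated b' F; exists (absz (N - n')) => i le.
  by rewrite bN ?(lin0 (fmode_bilinear.2 _ _)) //; lia.
rewrite !(lin_bsum _ _ lf) //.
have e1 : (fun j : nat => f (fmode (mode a (k + j%:Z) b) (m + n - j%:Z) F)) =
    (fun j : nat => fmode1 kap (p%:Z + q%:Z - (k + j%:Z) - 1) (m + n - j%:Z)
                       (mode a (k + j%:Z) b) al v).
  apply/funext => j.
  have := mode_gr (k + j%:Z) (Va : gr_int (vgr V) p a) (Vb : gr_int (vgr V) q b).
  case es : (p%:Z + q%:Z - (k + j%:Z) - 1) => [s|s] Vab.
    rewrite /f /= (fam_act_hom _ _ _ FF Vab).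
    by have -> : k0%:Z - s%:Z + (m + n - j%:Z) + 1 = kap by rewrite /kap; lia.
  have V0 : mode a (k + j%:Z) b = 0 := Vab.
  rewrite V0 (lin0 (fmode_bilinear.1 _ _)) (lin0 lf) fmode1_0l //.
  exact: functionals_lin Fal.
have e2 (p' q' : nat) (a' b' : V) (m' n' : int) : vgr V p' a' -> vgr V q' b' ->
    p'%:Z + q'%:Z = p%:Z + q%:Z -> m' + n' = m + n ->
    (fun j : nat => f (fmode a' (m' + k - j%:Z) (fmode b' (n' + j%:Z) F))) =
    (fun j : nat => fmode2 d kap p' q' (n' + j%:Z) (m' + k - j%:Z) a' b' al v).
  move=> Va' Vb' epq emn; apply/funext => j; rewrite /f (fmode_hom2 _ _ _ _ _ Va' Vb').
  rewrite /al; have -> // : k0%:Z - p'%:Z - q'%:Z + (m' + k - j%:Z) + (n' + j%:Z) + 2 = kap.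
  by rewrite /kap; lia.
rewrite e1 (e2 p q a b m n) // (e2 q p b a n m) //; [|by lia|by lia].
exact: fmode1_borcherds.
Qed.

Lemma fgr_deg (p q : nat) n a F : vgr V p a -> fgr q F ->
  gr_int fgr (p%:Z + q%:Z - n - 1) (fmode a n F).
Proof.
move=> Va Fq; have FF := sub_valU F.
have H (k : nat) : k%:Z != p%:Z + q%:Z - n - 1 -> sub_val (fmode a n F) k = (fun=> 0).
  move=> ne; apply/funext => v; rewrite /= (fam_act_hom _ _ _ FF Va).
  have -> : famz (sub_val F) (k%:Z - p%:Z + n + 1) = (fun=> 0); last exact: fmode1_0r.
  case e : (k%:Z - p%:Z + n + 1) => [k'|k'] //=.
  by rewrite Fq //; apply/eqP => ek; move/eqP: ne; apply; lia.
case e : (p%:Z + q%:Z - n - 1) => [s|s] /=.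
  by move=> k ne; apply: H; rewrite e; apply/eqP => -[] /eqP; rewrite (negPf ne).
apply: fam_lmod_eq => k v; rewrite H ?(lin0 (@sub_val_lin _ _ _ fam_sub)) // e.
by [].
Qed.

Lemma fam_single_fam q al : functionals q%:Z al ->
  fam (fun k => if k == q then al else (fun=> 0)).
Proof.
move=> Fal; split=> [k|]; first by case: eqP => [->|_] //; exact: functionals0.
by exists q.+1 => k lt; rewrite gtn_eqF.
Qed.

Definition fam_single q al (Fal : functionals q%:Z al) : fam_lmod :=
  to_sub fam_sub (fam_single_fam Fal).

Lemma fgr_direct_sum : is_direct_sum fgr setT.
Proof.
split=> [q|F _|s x us xq x0 q qs].
- split=> //; split; first by [].
  move=> c F G Fq Gq k ne; apply/funext => v.
  by rewrite sub_valZD Fq // Gq // scaler0 addr0.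
- have [FF [N FN]] := sub_valU F.
  exists (iota 0 N), (fun q => fam_single (FF q)); split; first exact: iota_uniq.
    by move=> q k ne; rewrite /= (negPf ne).
  apply: fam_lmod_eq => k v.
  rewrite (lin_sum (@sub_val_lin _ _ _ fam_sub)) !fct_sumE /=.
  have [ltk|lek] := ltnP k N.
    rewrite (bigD1_seq k) ?iota_uniq ?mem_iota //= eqxx big1 ?addr0 //.
    by move=> q ne; rewrite eq_sym (negPf ne).
  rewrite FN // big1_seq // => q /andP[_]; rewrite mem_iota add0n => /andP[_ ltq].
  by rewrite gtn_eqF // (leq_trans ltq).
apply: fam_lmod_eq => k v; rewrite (lin0 (@sub_val_lin _ _ _ fam_sub)).
have [ek|ne] := eqVneq k q; last by rewrite xq.
have := congr1 (fun F => sub_val F k v) x0.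
rewrite /= (lin_sum (@sub_val_lin _ _ _ fam_sub)) !fct_sumE.
rewrite (bigD1_seq q) //= big1 ?addr0 => [->|q' ne].
  by [].
by rewrite xq // ek eq_sym.
Qed.

Definition fam_module : adm_module V :=
  AdmModule fmode_bilinear fmode_truncated fmode_vac fmode_borcherds
    fgr_direct_sum fgr_deg.

End ModuleOfFunctionals.

(** * Zero modes *)

Section ZeroModes.
Context {R : realType} {V : voa R}.
Local Notation K := (R[i]).
Local Notation Vcomp := (comp (vgr_direct_sum V)).
Implicit Types W : adm_module V.

Lemma act_linl W n (w : W) : linear (fun a => act a n w).
Proof. exact: (act_bilinear W).1. Qed.
Lemma act_lin W a n : linear (@act R V W a n).
Proof. exact: (act_bilinear W).2. Qed.

Lemma mgr_sub W n : subspace (mgr W n).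
Proof. by have [/(_ n)[]] := mgr_direct_sum W. Qed.

Lemma gr_int_sub W k : subspace (gr_int (mgr W) k).
Proof.
case: k => [k|k]; first exact: mgr_sub.
by split=> // c u v -> ->; rewrite scaler0 addr0.
Qed.

(* [zmode e a] is the sum of the modes of degree [e] of the homogeneous
   components of [a]; [zmode 0] is the zero mode. *)
Definition zmode {W} (e : int) (a : V) (w : W) : W :=
  evsum (fun p : nat => act (Vcomp p a) (p%:Z - 1 - e) w).

Lemma zmode_ev0 W e a (w : W) :
  ev0 (fun p : nat => act (Vcomp p a) (p%:Z - 1 - e) w).
Proof.
have [N [aN _]] := comp_sum (vgr_direct_sum V) a.
by exists N => i /aN ->; exact: (lin0 (act_linl _ _)).
Qed.

Lemma zmode_hom W e p a (w : W) : vgr V p a -> zmode e a w = act a (p%:Z - 1 - e) w.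
Proof.
move=> Va; rewrite /zmode (evsum_single (p := p)) ?(comp_id _ Va) // => i ne.
by rewrite (comp_hom _ _ Va) (negPf ne) (lin0 (act_linl _ _)).
Qed.

Lemma act_zmode W p a n (w : W) : vgr V p a -> act a n w = zmode (p%:Z - 1 - n) a w.
Proof. by move=> Va; rewrite (zmode_hom _ _ Va); congr act; lia. Qed.

Lemma zmode_linl W e (w : W) : linear (fun a => zmode e a w).
Proof.
move=> c a b; rewrite /zmode -evsumZ -evsumD; first last.
- exact: zmode_ev0.
- exact/(ev0Z (fun=> c))/zmode_ev0.
by congr evsum; apply/funext => p; rewrite (comp_linear _ p) (act_linl _ _).
Qed.

Lemma zmode_lin W e a : linear (@zmode W e a).
Proof.
move=> c u v; rewrite /zmode -evsumZ -evsumD; first last.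
- exact: zmode_ev0.
- exact/(ev0Z (fun=> c))/zmode_ev0.
by congr evsum; apply/funext => p; rewrite (act_lin _ _).
Qed.

Lemma zmode_vac W (w : W) : zmode 0 vac w = w.
Proof. by rewrite (zmode_hom _ _ (vac_deg V)) vac_act. Qed.

Lemma zmode_deg W e a k (w : W) : mgr W k w -> gr_int (mgr W) (k%:Z + e) (zmode e a w).
Proof.
move=> Ww; move: a; apply: (gr_ind (vgr_direct_sum V)) => [|p a Va].
  split=> [|c a b Wa Wb].
    by rewrite (lin0 (zmode_linl _ _)); exact: (sub0 (gr_int_sub _ _)).
  by rewrite (zmode_linl _ _); exact: (gr_int_sub _ _).2.
rewrite (zmode_hom _ _ Va); have := act_deg (p%:Z - 1 - e) Va Ww.
by have -> : p%:Z + k%:Z - (p%:Z - 1 - e) - 1 = k%:Z + e by lia.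
Qed.

Lemma zmode_deg0 W a k (w : W) : mgr W k w -> mgr W k (zmode 0 a w).
Proof. by move=> Ww; have := zmode_deg 0 a Ww; rewrite addr0. Qed.

Lemma act_gr0 W p a n k (w : W) : vgr V p a -> mgr W k w -> p%:Z + k%:Z <= n ->
  act a n w = 0.
Proof.
move=> Va Ww le; have := act_deg n Va Ww.
by case e : (p%:Z + k%:Z - n - 1) => [s|s] //; lia.
Qed.

Lemma act_borcherds_sum W a b (w : W) m n k :
  borcherds_sum (@mode R V) (@act R V W) a b w m n k.
Proof.
exact: (borcherds_bsum (@mode_truncated R V) (act_bilinear W) (@act_truncated R V W)).1
  (@act_borcherds R V W) a b w m n k.
Qed.

(* The product formula behind both [zhu_circ] and [zhu_mul]: below degree [d],
   [a_(m)] vanishes for [m >= p + d]. *)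
Lemma act_assoc W (d p q k : nat) a b (w : W) (r n : int) :
  vgr V p a -> vgr V q b -> mgr W k w -> (k <= d)%N ->
  zmode (q%:Z - d%:Z - r - n - 2)
    (\sum_(j < (p + d).+1) 'C(p + d, j)%:R *: mode a (r + j%:Z) b) w =
  bsum (-1) r (fun j => act a ((p + d)%N%:Z + r - j%:Z) (act b (n + j%:Z) w)).
Proof.
move=> Va Vb Ww le; have := act_borcherds_sum a b w (p + d)%N%:Z n r.
rewrite /borcherds_sum [X in _ - _ *: X]bsum_zero; last first.
  move=> j; rewrite (act_gr0 Va Ww) ?(lin0 (act_lin _ _)) //; lia.
rewrite scaler0 subr0 => <-; rewrite bsum_nat (lin_sum (zmode_linl _ _)).
apply: eq_bigr => j _; rewrite expr1n mul1r (linZ (zmode_linl _ _)); congr (_ *: _).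
have := mode_gr (r + j%:Z) (Va : gr_int (vgr V) p a) (Vb : gr_int (vgr V) q b).
case e : (p%:Z + q%:Z - (r + j%:Z) - 1) => [s|s] Vab.
  by rewrite (zmode_hom _ _ Vab); congr act; lia.
have -> : mode a (r + j%:Z) b = 0 by exact: Vab.
by rewrite (lin0 (zmode_linl _ _)) (lin0 (act_linl _ _)).
Qed.

(** One vector [c] serves all modules at once, which is what allows annihilators in different
    modules to be compared. By [act_assoc], [b_(m) a_(n)] is a single mode plus products with larger
    [n], and these end at zero on degrees up to [d]. *)
Lemma zmode_mul (d : nat) (e1 e2 : int) a b : exists c, forall W k (w : W),
  (k <= d)%N -> mgr W k w -> zmode e1 b (zmode e2 a w) = zmode (e1 + e2) c w.
Proof.
have sP1 b' : subspace (fun a' => exists c, forall W k (w : W), (k <= d)%N ->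
    mgr W k w -> zmode e1 b' (zmode e2 a' w) = zmode (e1 + e2) c w).
  split=> [|c a1 a2 [c1 H1] [c2 H2]].
    exists 0 => W k w _ _.
    by rewrite !(lin0 (zmode_linl _ _)) (lin0 (zmode_lin _ _)).
  exists (c *: c1 + c2) => W k w le Ww.
  by rewrite (zmode_linl _ w) (zmode_lin _ _) (H1 _ k) // (H2 _ k) // (zmode_linl _ w).
have sP2 a' : subspace (fun b' => exists c, forall W k (w : W), (k <= d)%N ->
    mgr W k w -> zmode e1 b' (zmode e2 a' w) = zmode (e1 + e2) c w).
  split=> [|c a1 a2 [c1 H1] [c2 H2]].
    by exists 0 => W k w _ _; rewrite !(lin0 (zmode_linl _ _)).
  exists (c *: c1 + c2) => W k w le Ww.
  by rewrite (zmode_linl _ _) (H1 _ k) // (H2 _ k) // (zmode_linl _ w).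
move: a; apply: (gr_ind (vgr_direct_sum V)) => // q a Va.
move: b; apply: (gr_ind (vgr_direct_sum V)) => // p b Vb.
suff H (n : int) : forall m : int, exists c, forall W k (w : W), (k <= d)%N ->
    mgr W k w -> act b m (act a n w) = zmode (p%:Z + q%:Z - m - n - 2) c w.
  have [c Hc] := H (q%:Z - 1 - e2) (p%:Z - 1 - e1); exists c => W k w le Ww.
  rewrite (zmode_hom _ _ Va) (zmode_hom _ _ Vb) (Hc _ k) //.
  by congr zmode; lia.
suff {n} H (n : int) : forall n' m : int, n <= n' ->
    exists c, forall W k (w : W), (k <= d)%N -> mgr W k w ->
    act b m (act a n' w) = zmode (p%:Z + q%:Z - m - n' - 2) c w.
  by move=> m; exact: (H n n m (lexx _)).
elim/(int_down_ind (N := q%:Z + d%:Z)): n => [n le n' m le'|n IH n' m].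
  exists 0 => W k w lek Ww.
  by rewrite (lin0 (zmode_linl _ _)) (act_gr0 Va Ww) ?(lin0 (act_lin _ _)) //; lia.
rewrite le_eqVlt => /orP[/eqP <-{n'}|lt]; last by apply: IH; lia.
have E (j : nat) : exists c, forall W k (w : W), (k <= d)%N -> mgr W k w ->
    act b (m - j.+1%:Z) (act a (n + j.+1%:Z) w) = zmode (p%:Z + q%:Z - m - n - 2) c w.
  have [|c cP] := IH (n + j.+1%:Z) (m - j.+1%:Z); first by lia.
  by exists c => W k w le Ww; rewrite (cP _ k) //; congr zmode; lia.
have [c cP] := choice E.
(* Chosen so that the leading product in [act_assoc] is [b_(m) a_(n)]. *)
pose r := m - (p + d)%N%:Z.
pose J := absz (q%:Z + d%:Z - n)%R.
exists ((\sum_(j < (p + d).+1) 'C(p + d, j)%:R *: mode b (r + j%:Z) a)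
        - \sum_(j < J) ((-1) ^+ j.+1 * binz r j.+1) *: c j) => W k w le Ww.
rewrite (linB (zmode_linl _ _)) (lin_sum (zmode_linl _ _) (index_enum 'I_J)).
have := act_assoc r n Vb Va Ww le.
have -> : q%:Z - d%:Z - r - n - 2 = p%:Z + q%:Z - m - n - 2 by rewrite /r; lia.
move=> ->; rewrite (@bsumE _ _ _ _ _ J.+1); last first.
  move=> i lei; rewrite (act_gr0 (n := n + i%:Z) Va Ww) ?(lin0 (act_lin _ _)) //.
  by move: lei; rewrite /J; lia.
rewrite big_ord_recl /= binz0 mul1r scale1r.
have -> : (p + d)%N%:Z + r - 0%N%:Z = m by rewrite /r; lia.
rewrite addr0 [X in _ = _ + X - _](_ : _ = \sum_(i < J) zmode (p%:Z + q%:Z - m - n - 2)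
   (((-1) ^+ i.+1 * binz r i.+1) *: c i) w) ?addrK //.
apply: eq_bigr => i _; rewrite (linZ (zmode_linl _ _)) -(cP _ _ k) //.
congr (_ *: act _ _ _); rewrite /r /bump /=; lia.
Qed.

(** With [n = q + d] in [act_assoc], every [b_(n+j)] kills degree [k <= d]; the pole order [2d + 2]
    is what makes the resulting mode have degree zero. *)
Lemma zhu_circ_zmode W (d p k : nat) a b (w : W) : vgr V p a -> mgr W k w -> (k <= d)%N ->
  zmode 0 (zhu_circ d p a b) w = 0.
Proof.
move=> Va Ww le; move: b; apply: (gr_ind (vgr_direct_sum V)) => [|q b Vb].
  have l : linear (fun b : V => zhu_circ d p a b).
    move=> c b1 b2; rewrite /zhu_circ scaler_sumr -big_split; apply: eq_bigr => j _.
    by rewrite (mode_lin _ _) scalerDr !scalerA mulrC.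
  split=> [|c b1 b2 e1 e2]; first by rewrite (lin0 l) (lin0 (zmode_linl _ _)).
  by rewrite l (zmode_linl _ _) e1 e2 scaler0 addr0.
have := act_assoc (- (d.*2 + 2)%N%:Z) (q%:Z + d%:Z) Va Vb Ww le.
have -> : q%:Z - d%:Z - (- (d.*2 + 2)%N%:Z) - (q%:Z + d%:Z) - 2 = 0 by lia.
rewrite bsum_zero => [<-|j]; last first.
  by rewrite (act_gr0 Vb Ww) ?(lin0 (act_lin _ _)) //; lia.
by congr zmode; apply: eq_bigr => j _; congr (_ *: mode _ _ _); lia.
Qed.

Lemma act_L0L1 W (k : nat) a (w : W) : mgr W k w ->
  zmode 0 (mode conf 0 a + mode conf 1 a) w = 0.
Proof.
move=> Ww; move: a; apply: (gr_ind (vgr_direct_sum V)) => [|p a Va].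
  have l : linear (fun a : V => mode conf 0 a + mode conf 1 a).
    by move=> c b1 b2; rewrite !(mode_lin _ _) scalerDr addrACA.
  split=> [|c b1 b2 e1 e2]; first by rewrite (lin0 l) (lin0 (zmode_linl _ _)).
  by rewrite l (zmode_linl _ _) e1 e2 scaler0 addr0.
have VLa : vgr V p.+1 (mode conf 0 a).
  have := mode_deg 0 (conf_deg V) Va.
  by have -> : 2%:Z + p%:Z - 0 - 1 = p.+1%:Z by lia.
rewrite (linD (zmode_linl _ _)) (zmode_hom _ _ VLa) (vgr_L0 Va) (linZ (zmode_linl _ _)).
rewrite (zmode_hom _ _ Va) !subr0; have -> : p.+1%:Z - 1 = p by lia.
(* [L_(-1) a = a_(-2) 1], and the Borcherds identity gives the derivative. *)
have -> : mode conf 0 a = mode a (-2) vac.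
  rewrite -[LHS]mode_vac_N1 translation; have -> : -1 - 1 = -2 :> int by [].
  by rewrite mulrN1z opprK scale1r.
have := act_borcherds_sum a vac w 0 p%:Z (-2).
rewrite /borcherds_sum bsum0 !addr0 add0r => ->.
rewrite [X in _ - _ *: X](@bsumE _ _ _ _ _ p); last first.
  move=> i lei; rewrite vac_act; case: eqP => [e|//].
  by move: lei; clear -e; lia.
rewrite [X in X - _]bsum_zero ?sub0r; last first.
  move=> i; rewrite vac_act; case: eqP => [e|_]; last exact: (lin0 (act_lin _ _)).
  by clear -e; lia.
have -> : sgn (-2) = 1 :> K by rewrite /sgn sqrrN expr1n.
rewrite scale1r; case: p => [|p] in Va VLa *.
  by rewrite big_ord0 oppr0 add0r scale0r.
rewrite big_ord_recr /= big1 ?add0r => [|i _]; last first.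
  rewrite vac_act; case: eqP => [e|_]; last by rewrite scaler0.
  by have := ltn_ord i; clear -e; lia.
have -> : p.+1%:Z - 2 - p%:Z = -1 by lia.
have -> : p.+1%:Z - 1 = p%:Z by lia.
rewrite vac_act eqxx (binzN_nat 1) mulrA -exprMn mulrNN mul1r expr1n mul1r bin1 addn1.
by rewrite addNr.
Qed.

Lemma zhu_O_zmode W (d k : nat) a (w : W) : zhu_O d a -> mgr W k w -> (k <= d)%N ->
  zmode 0 a w = 0.
Proof.
move=> Oa Ww le; apply: (Oa (fun a => zmode 0 a w = 0)); split.
  split=> [|c b1 b2 e1 e2]; first by rewrite (lin0 (zmode_linl _ _)).
  by rewrite (zmode_linl _ _) e1 e2 scaler0 addr0.
move=> x [[p [b [c [Vb ->]]]]|[b ->]]; last exact: act_L0L1 Ww.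
exact: zhu_circ_zmode Vb Ww le.
Qed.

(* Coefficientwise this is [((1 - u) + u) ^ r = 1]; the coefficients in
   [zhu_mul] are [binz (- d - 1) l]. *)
Lemma bsum_triangle {W0 : lmodType K} (T : nat -> W0) (N : nat) (r : int) :
  (0 < N)%N -> (forall s, (N <= s)%N -> T s = 0) ->
  \sum_(l < N) binz r l *: bsum (-1) (r - l%:Z) (fun j => T (l + j)%N) = T 0%N.
Proof.
move=> N0 TN.
have E (l : 'I_N) : bsum (-1) (r - l%:Z) (fun j => T (l + j)%N) =
    \sum_(s < N) (if (l <= s)%N then (-1) ^+ (s - l) * binz (r - l%:Z) (s - l) else 0) *: T s.
  rewrite (@bsumE _ _ _ _ _ (N - l)%N); last by move=> j le; apply: TN; lia.
  rewrite -(big_mkord xpredT (fun j => ((-1) ^+ j * binz (r - l%:Z) j) *: T (l + j)%N)).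
  rewrite -(big_mkord xpredT (fun s => (if (l <= s)%N then (-1) ^+ (s - l) *
      binz (r - l%:Z) (s - l) else 0) *: T s)).
  rewrite [RHS](big_cat_nat (n := l)) //= ?(ltnW (ltn_ord l)) //.
  rewrite [X in _ = X + _]big_nat_cond [X in _ = X + _]big1 ?add0r; last first.
    by move=> i /andP[/andP[_ lti] _]; rewrite ifN ?scale0r // -ltnNge.
  rewrite [RHS](big_addn 0 N l xpredT); apply: eq_bigr => j _.
  by rewrite leq_addl addnK addnC.
under eq_bigr => l _ do rewrite E scaler_sumr.
rewrite exchange_big /= (bigD1 (Ordinal N0)) //= [X in _ + X]big1 ?addr0.
  rewrite (bigD1 (Ordinal N0)) //= [X in _ + X]big1 ?addr0.
    by rewrite !binz0 mul1r !scale1r.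
  by move=> l ne; rewrite leqn0 ifN ?scale0r ?scaler0 //.
move=> s ne.
have -> : \sum_(l < N) binz r l *: ((if (l <= s)%N then (-1) ^+ (s - l) *
      binz (r - l%:Z) (s - l) else 0) *: T s) =
    (\sum_(l < N) (if (l <= s)%N then (-1) ^+ (s - l) * 'C(s, l)%:R else 0) * binz r s) *: T s.
  rewrite scaler_suml; apply: eq_bigr => l _; rewrite scalerA.
  case: ifP => [le|_]; last by rewrite mulr0 mul0r.
  by rewrite mulrCA binz_mul_sub // mulrA mulrAC.
rewrite -mulr_suml -big_mkcond /=.
have -> : \sum_(l < N | (l <= s)%N) (-1) ^+ (s - l) * 'C(s, l)%:R = (1 - 1) ^+ s :> K.
  transitivity (\sum_(l < s.+1) (-1) ^+ (s - l) * 'C(s, l)%:R : K).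
    rewrite (big_ord_widen N (fun l => (-1) ^+ (s - l) * 'C(s, l)%:R)) //.
  rewrite [1 - 1]addrC exprDn.
  by apply: eq_bigr => l _; rewrite expr1n mulr1 mulr_natr.
rewrite subrr expr0n; case: eqP => [e|_]; last by rewrite mul0r scale0r.
by case/eqP: ne; apply: val_inj.
Qed.

Lemma zhu_mul_zmode W (d p k : nat) a b (w : W) : vgr V p a -> mgr W k w -> (k <= d)%N ->
  zmode 0 (zhu_mul d p a b) w = zmode 0 a (zmode 0 b w).
Proof.
move=> Va Ww le; move: b; apply: (gr_ind (vgr_direct_sum V)) => [|q b Vb].
  have l : linear (fun b : V => zhu_mul d p a b).
    move=> c b1 b2; rewrite /zhu_mul scaler_sumr -big_split; apply: eq_bigr => i _.
    rewrite [c *: (_ *: _)]scalerA [c * _]mulrC -[X in _ = X + _]scalerA -scalerDr.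
    congr (_ *: _).
    rewrite scaler_sumr -big_split; apply: eq_bigr => j _.
    by rewrite (mode_lin _ _) scalerDr !scalerA mulrC.
  split=> [|c b1 b2 e1 e2].
    by rewrite (lin0 l) !(lin0 (zmode_linl _ _)) (lin0 (zmode_lin _ _)).
  by rewrite l !(zmode_linl _ _) (zmode_lin _ _) e1 e2.
(* Modes of degrees [s] and [- s]; the second is zero for [s > d], and [bsum_triangle] isolates
   [T 0]. *)
pose T s := act a (p%:Z - 1 - s%:Z) (act b (q%:Z - 1 + s%:Z) w).
rewrite (zmode_hom _ _ Va) (zmode_hom _ _ Vb) !subr0.
have -> : act a (p%:Z - 1) (act b (q%:Z - 1) w) = T 0%N by rewrite /T subr0 addr0.
rewrite -(@bsum_triangle _ T d.+1 (- d.+1%:Z)) //; last first.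
  move=> s les; rewrite /T (act_gr0 (n := q%:Z - 1 + s%:Z) Vb Ww) ?(lin0 (act_lin _ _)) //.
  lia.
rewrite /zhu_mul (lin_sum (zmode_linl _ _)); apply: eq_bigr => l _.
rewrite (linZ (zmode_linl _ _)) binzN_nat; congr (_ *: _).
have := act_assoc (- d.+1%:Z - l%:Z) (q%:Z + l%:Z - 1) Va Vb Ww le.
have -> : q%:Z - d%:Z - (- d.+1%:Z - l%:Z) - (q%:Z + l%:Z - 1) - 2 = 0 by lia.
have -> : (fun j : nat => act a ((p + d)%N%:Z + (- d.+1%:Z - l%:Z) - j%:Z)
     (act b (q%:Z + l%:Z - 1 + j%:Z) w)) = (fun j : nat => T (l + j)%N).
  by apply/funext => j; rewrite /T; congr (act a _ (act b _ w)); lia.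
move=> <-; congr zmode; apply: eq_bigr => j _; congr (_ *: mode _ _ _); lia.
Qed.

End ZeroModes.

(** * Simple modules *)

Section SimpleModules.
Context {R : realType} {V : voa R}.
Local Notation K := (R[i]).
Local Notation Vcomp := (comp (vgr_direct_sum V)).
Implicit Types W : adm_module V.

Lemma zmode_comp W e a k l (w : W) : mgr W k w ->
  comp (mgr_direct_sum W) l (zmode e a w) = if l%:Z == k%:Z + e then zmode e a w else 0.
Proof.
move=> Ww; have := zmode_deg e a Ww; case: (k%:Z + e) => [m|m] We.
  by rewrite (comp_hom _ _ We).
have -> : zmode e a w = 0 by exact: We.
by rewrite (lin0 (comp_linear _ _)).
Qed.

(** The vectors whose components are all obtained from [w] by a single mode form a submodule,
    because [zmode_mul] composes two modes into one. *)
Lemma simple_gen W k l (w u : W) : simple_module W -> mgr W k w -> w <> 0 ->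
  mgr W l u -> exists a, zmode (l%:Z - k%:Z) a w = u.
Proof.
move=> [_ _ simpW] Ww w0 Wu.
pose U : set W := fun x => forall l, exists a,
  comp (mgr_direct_sum W) l x = zmode (l%:Z - k%:Z) a w.
have Uz e a : U (zmode e a w).
  move=> m; rewrite (zmode_comp _ _ _ Ww); case: eqP => [em|_].
    by exists a; congr zmode; lia.
  by exists 0; rewrite (lin0 (zmode_linl _ _)).
have sU : subspace U.
  split=> [|c x y Ux Uy] m.
    by exists 0; rewrite (lin0 (comp_linear _ _)) (lin0 (zmode_linl _ _)).
  have [a ea] := Ux m; have [b eb] := Uy m; exists (c *: a + b).
  by rewrite (comp_linear _ m) ea eb (zmode_linl _ _).
have gU : graded_submodule U.
  split=> //; last first.
    apply: (homogeneous_direct_sum (hG := mgr_direct_sum W)) => // n x Ux.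
    by have [a ->] := Ux n; exact: Uz.
  move=> a n x Ux; move: a; apply: (gr_ind (vgr_direct_sum V)) => [|p a Va].
    split=> [|c a b Ua Ub]; first by rewrite (lin0 (act_linl _ _)); exact: (sub0 sU).
    by rewrite (act_linl _ _); exact: sU.2.
  have [N [_ ->]] := comp_sum (mgr_direct_sum W) x.
  rewrite (lin_sum (act_lin _ _)); apply: sub_sum => // i _.
  have [b ->] := Ux i; rewrite (act_zmode _ _ Va).
  have [c Hc] := zmode_mul k (p%:Z - 1 - n) (i%:Z - k%:Z) b a.
  by rewrite (Hc _ k).
have [U0|UT] := simpW U gU (fun _ _ => I).
  have : U w by rewrite -[w]zmode_vac; exact: Uz.
  by rewrite U0 => /w0.
have /(_ l)[a] : U u by rewrite UT.
by rewrite (comp_id _ Wu) => ea; exists a.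
Qed.

(** If a mode kills [w] but not [w'], simplicity leads back to [w']; the composite is a zero mode
    that kills [w] and fixes [w']. *)
Lemma local_transfer W W' k k' (w : W) (w' : W') : simple_module W' ->
  mgr W k w -> mgr W' k' w' -> w' <> 0 ->
  (forall a, zmode 0 a w = 0 -> zmode 0 a w' = 0) ->
  forall e a, zmode e a w = 0 -> zmode e a w' = 0.
Proof.
move=> sW' Ww Ww' w'0 loc e a ea; apply: contrapT => ne.
have := zmode_deg e a Ww'; case el : (k'%:Z + e) => [l|l] Wl; last by case: ne.
have [b eb] := simple_gen sW' Wl ne Ww'.
have [c Hc] := zmode_mul (maxn k k') (k'%:Z - l%:Z) e a b.
have e0 : k'%:Z - l%:Z + e = 0 by lia.
apply: w'0; rewrite -eb (Hc _ k') ?leq_maxr // e0; apply: loc.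
by rewrite -e0 -(Hc _ k) ?leq_maxl // ea (lin0 (zmode_lin _ _)).
Qed.

(** If [a w] is nonzero, some [b] brings it back to [w]; then [b a - 1] kills [w], hence also [w'],
    which excludes [a w' = 0]. *)
Lemma local_sym W W' k k' (w : W) (w' : W') : simple_module W ->
  mgr W k w -> w <> 0 -> mgr W' k' w' -> w' <> 0 ->
  (forall a, zmode 0 a w = 0 -> zmode 0 a w' = 0) ->
  forall a, zmode 0 a w' = 0 -> zmode 0 a w = 0.
Proof.
move=> sW Ww w0 Ww' w'0 loc a ea; apply: contrapT => ne.
have [b] := simple_gen sW (zmode_deg0 a Ww) ne Ww; rewrite subrr => eb.
have [c Hc] := zmode_mul (maxn k k') 0 0 a b; rewrite addr0 in Hc.
apply: w'0; have : zmode 0 (c - vac) w' = 0.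
  apply: loc; rewrite (linB (zmode_linl _ _)) zmode_vac -(Hc _ k) ?leq_maxl //.
  by rewrite eb subrr.
rewrite (linB (zmode_linl _ _)) zmode_vac -(Hc _ k') ?leq_maxr // ea.
by rewrite (lin0 (zmode_lin _ _)) sub0r => /eqP; rewrite oppr_eq0 => /eqP.
Qed.

(** A mode of degree [- k] takes [w] to a nonzero vector of degree 0, while on [w'] it would reach a
    negative degree if [k' < k]. *)
Lemma local_normalized W W' k k' (w : W) (w' : W') : simple_module W ->
  normalized W -> mgr W k w -> w <> 0 -> mgr W' k' w' ->
  (forall e a, zmode e a w' = 0 -> zmode e a w = 0) -> (k <= k')%N.
Proof.
move=> sW [x Wx x0] Ww w0 Ww' loc.
have [a ea] := simple_gen sW Ww w0 Wx; rewrite leqNgt; apply/negP => lt.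
apply: x0; rewrite -ea; apply: loc.
have := zmode_deg (0%N%:Z - k%:Z) a Ww'.
by case el : (k'%:Z + (0%N%:Z - k%:Z)) => [l|l] // ; lia.
Qed.

(** The map is [a w |-> a w'] for modes [a]; the inclusion of annihilators makes it independent of
    the chosen [a]. *)
Lemma extend_local W W' k (w : W) (w' : W') : simple_module W ->
  mgr W k w -> w <> 0 -> mgr W' k w' ->
  (forall e a, zmode e a w = 0 -> zmode e a w' = 0) ->
  exists f : W -> W', linear f /\ forall e a, f (zmode e a w) = zmode e a w'.
Proof.
move=> sW Ww w0 Ww' loc.
have genE (x : W) l : exists a, zmode (l%:Z - k%:Z) a w = comp (mgr_direct_sum W) l x.
  by apply: (simple_gen sW Ww w0); exact: comp_in.
pose A x l := sval (cid (genE x l)).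
have AE x l : zmode (l%:Z - k%:Z) (A x l) w = comp (mgr_direct_sum W) l x.
  by rewrite /A; case: cid.
have ev x : ev0 (fun l : nat => zmode (l%:Z - k%:Z) (A x l) w').
  have [N [xN _]] := comp_sum (mgr_direct_sum W) x.
  by exists N => l /xN e; apply: loc; rewrite AE.
exists (fun x => evsum (fun l : nat => zmode (l%:Z - k%:Z) (A x l) w')); split.
  move=> c x y; rewrite -evsumZ -evsumD; [|exact: (ev0Z (fun=> c))|exact: ev].
  congr evsum; apply/funext => l; apply/eqP; rewrite -subr_eq0 -(zmode_linl _ w').
  rewrite -(linB (zmode_linl _ _)); apply/eqP; apply: loc.
  by rewrite (linB (zmode_linl _ _)) (zmode_linl _ w) !AE (comp_linear _ l) subrr.
move=> e a; case el : (k%:Z + e) => [m|m]; last first.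
  have z0 : zmode e a w = 0 by have := zmode_deg e a Ww; rewrite el.
  rewrite (loc _ _ z0) (@evsumE _ _ _ 0) ?big_ord0 // => l _.
  by apply: loc; rewrite AE z0 (lin0 (comp_linear _ _)).
rewrite (evsum_single (p := m)) => [|l ne].
  have -> : e = m%:Z - k%:Z by lia.
  apply/eqP; rewrite -subr_eq0 -(linB (zmode_linl _ _)); apply/eqP; apply: loc.
  rewrite (linB (zmode_linl _ _)) AE (zmode_comp _ _ _ Ww) ifT ?subrr //; lia.
apply: loc; rewrite AE (zmode_comp _ _ _ Ww) ifF // el.
by apply/negbTE/eqP => -[] /eqP; rewrite (negPf ne).
Qed.

Lemma local_iso W W' k (w : W) (w' : W') : simple_module W -> simple_module W' ->
  mgr W k w -> w <> 0 -> mgr W' k w' -> w' <> 0 ->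
  (forall a, zmode 0 a w = 0 -> zmode 0 a w' = 0) ->
  exists f : {linear W -> W'}, [/\ bijective f,
    forall a n x, f (act a n x) = act a n (f x),
    forall n x, mgr W n x -> mgr W' n (f x) & f w = w'].
Proof.
move=> sW sW' Ww w0 Ww' w'0 loc.
have loc1 := local_transfer sW' Ww Ww' w'0 loc.
have loc2 := local_transfer sW Ww' Ww w0 (local_sym sW Ww w0 Ww' w'0 loc).
have [f [lf fE]] := extend_local sW Ww w0 Ww' loc1.
have [g [lg gE]] := extend_local sW' Ww' w'0 Ww loc2.
pose F : {linear W -> W'} := HB.pack f (GRing.isLinear.Build _ _ _ _ f lf).
have hom_ind (W1 : adm_module V) (w1 : W1) (P : set W1) : simple_module W1 ->
    mgr W1 k w1 -> w1 <> 0 -> subspace P ->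
    (forall n a, P (zmode (n%:Z - k%:Z) a w1)) -> forall x, P x.
  move=> sW1 Ww1 w10 sP Pz; apply: (gr_ind (mgr_direct_sum W1)) => // n x Wx.
  by have [a <-] := simple_gen sW1 Ww1 w10 Wx.
exists F; split.
- exists g.
    apply: (hom_ind _ w (fun x => g (f x) = x)) => // [|n a]; last by rewrite fE gE.
    split=> [|c x y ex ey]; first by rewrite (lin0 lf) (lin0 lg).
    by rewrite lf lg ex ey.
  apply: (hom_ind _ w' (fun x => f (g x) = x)) => // [|n a]; last by rewrite gE fE.
  split=> [|c x y ex ey]; first by rewrite (lin0 lg) (lin0 lf).
  by rewrite lg lf ex ey.
- move=> a n; apply: (hom_ind _ w (fun x => f (act a n x) = act a n (f x))) => //.
    split=> [|c x y ex ey]; first by rewrite !(lin0 lf, lin0 (act_lin _ _)).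
    by rewrite !(act_lin _ _) !lf !(act_lin _ _) ex ey.
  move=> m b; move: a; apply: (gr_ind (vgr_direct_sum V)) => [|p a Va].
    split=> [|c x y ex ey].
      by rewrite !(lin0 (act_linl _ _)) (lin0 lf).
    by rewrite !(act_linl _ _) lf ex ey.
  rewrite !(act_zmode _ _ Va) fE.
  have [c Hc] := zmode_mul k (p%:Z - 1 - n) (m%:Z - k%:Z) b a.
  by rewrite (Hc _ k) // fE (Hc _ k).
- move=> n x Wx; have [a <-] := simple_gen sW Ww w0 Wx.
  rewrite /= fE; have := zmode_deg (n%:Z - k%:Z) a Ww'.
  by have -> : k%:Z + (n%:Z - k%:Z) = n by lia.
- by rewrite -[w]zmode_vac /= fE zmode_vac.
Qed.

End SimpleModules.

(** * Uncountability of the complex numbers *)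

Section Uncountable.
Context {R : realType}.

Lemma real_uncountable (g : nat -> R) : exists x, forall n, g n <> x.
Proof.
(* The outer third on the other side of the midpoint from [g n], so that the next closed interval
   misses [g n]. *)
pose next n (I : R * R) : R * R := let h := (I.2 - I.1) / 3%:R in
  if g n <= (I.1 + I.2) / 2%:R then (I.2 - h, I.2) else (I.1, I.1 + h).
pose I := fix I n := if n is n'.+1 then next n' (I n') else (0, 1).
have lt n : (I n).1 < (I n).2.
  elim: n => [|n IH] /=; first exact: ltr01.
  by rewrite /next; case: ifP => _ /=; lra.
have nest n : (I n).1 <= (I n.+1).1 /\ (I n.+1).2 <= (I n).2.
  by have := lt n; rewrite /= /next; case: ifP => _ /=; split; lra.
have nested m n : (m <= n)%N -> (I m).1 <= (I n).1 /\ (I n).2 <= (I m).2.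
  move=> /subnK <-; elim: (n - m)%N => [//|j [IH1 IH2]]; rewrite addSn.
  by have [h1 h2] := nest (j + m)%N; split; [exact: le_trans IH1 h1|exact: le_trans h2 IH2].
pose A : set R := fun x => exists n, x = (I n).1.
have ubA n : ubound A (I n).2.
  move=> _ [m ->]; have [h1 _] := nested m (maxn m n) (leq_maxl _ _).
  have [_ h2] := nested n (maxn m n) (leq_maxr _ _).
  exact: le_trans h1 (le_trans (ltW (lt _)) h2).
have sA : has_sup A by split; [exists (I 0).1; exists 0%N | exists (I 0).2; exact: ubA].
exists (sup A) => n gn.
have le1 : (I n.+1).1 <= sup A by apply: sup_upper_bound => //; exists n.+1.
have le2 : sup A <= (I n.+1).2 by apply: sup_le_ub => //; case: sA.
have := lt n; move: le1 le2; rewrite -gn /= /next.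
case: ifPn => [cmp|]; last rewrite -ltNge => cmp; move=> /= ? ? ?; lra.
Qed.

(** Otherwise each fibre is contained in a finite list, and the lists together enumerate the
    reals. *)
Lemma infinite_fiber (f : R[i] -> nat) : exists n, forall N, exists s : seq R[i],
  [/\ uniq s, size s = N & forall x, x \in s -> f x = n].
Proof.
apply: contrapT => nex.
have fin n : exists s : seq R[i], forall x, f x = n -> x \in s.
  apply: contrapT => nfin; apply: nex; exists n; elim=> [|N [s [us ss fs]]].
    by exists nil.
  apply: contrapT => nN; apply: nfin; exists s => x fx.
  apply: contrapT => /negP xs; apply: nN; exists (x :: s); split=> //=.
  - by rewrite xs.
  - by rewrite ss.
  - by move=> y; rewrite inE => /orP[/eqP -> //|/fs].
have [s sP] := choice fin.
pose g (m : nat) : R := if unpickle m is Some (n, i) then complex.Re (nth 0 (s n) i) else 0.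
have [x xg] := real_uncountable g.
pose c : R[i] := Complex x 0.
apply: (xg (pickle (f c, index c (s (f c))))).
by rewrite /g pickleK nth_index //; exact: sP.
Qed.
End Uncountable.

(** * Polynomials in an operator and Schur's lemma *)

Section PolyOperator.
Context {K : fieldType} {W : lmodType K} (phi : W -> W) (lphi : linear phi).

Definition pev (p : {poly K}) (u : W) : W := \sum_(i < size p) p`_i *: iter i phi u.

Lemma pevE (p : {poly K}) u N : (size p <= N)%N -> pev p u = \sum_(i < N) p`_i *: iter i phi u.
Proof.
move=> le; rewrite /pev -(subnKC le) big_split_ord /= [X in _ + X]big1 ?addr0 //.
by move=> i _; rewrite nth_default ?scale0r // leq_addr.
Qed.

Lemma iter_lin i : linear (iter i phi).
Proof. by elim: i => // i IH c u v; rewrite !iterS IH lphi. Qed.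

Lemma pev_lin p : linear (pev p).
Proof.
move=> c u v; rewrite /pev scaler_sumr -big_split; apply: eq_bigr => i _.
by rewrite (iter_lin i) scalerDr !scalerA mulrC.
Qed.

Lemma pev_linl u : linear (pev^~ u).
Proof.
move=> c p q; pose N := maxn (size p) (maxn (size q) (size (c *: p + q))).
rewrite !(@pevE _ _ N) /N ?leq_max ?leqnn ?orbT //.
rewrite scaler_sumr -big_split; apply: eq_bigr => i _.
by rewrite coefD coefZ scalerDl scalerA.
Qed.

Lemma pev1 u : pev 1 u = u.
Proof. by rewrite /pev size_poly1 big_ord1 coef1 scale1r. Qed.

Lemma pev_mulX (p : {poly K}) u : pev (p * 'X) u = pev p (phi u).
Proof.
rewrite (@pevE _ _ (size p).+1); last first.
  by apply: leq_trans (size_polyMleq _ _) _; rewrite size_polyX addn2.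
rewrite big_ord_recl coefMX scale0r add0r; apply: eq_bigr => i _.
by rewrite coefMX -iterSr.
Qed.

Lemma pev_root (p : {poly K}) z u : pev (p * ('X - z%:P)) u = pev p (phi u - z *: u).
Proof.
rewrite mulrBr -[_ * z%:P]mulrC mul_polyC -scaleNr addrC (pev_linl u) pev_mulX.
by rewrite (linB (pev_lin p)) (linZ (pev_lin p)) scaleNr addrC.
Qed.
End PolyOperator.

Section Dixmier.
Context {R : realType} {V : voa R}.
Local Notation K := (R[i]).
Local Notation Vcomp := (comp (vgr_direct_sum V)).
Implicit Types W : adm_module V.

Lemma fin_dim_below n : exists D (e : 'I_D -> V), forall a,
  (forall p, (n <= p)%N -> Vcomp p a = 0) ->
  exists c : 'rV[K]_D, a = \sum_(i < D) c 0 i *: e i.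
Proof.
elim: n => [|n [D [e eP]]].
  exists 0%N, (fun=> 0) => a a0; exists 0; rewrite big_ord0.
  by apply: (comp_eq (hG := vgr_direct_sum V)) => p; rewrite a0 // (lin0 (comp_linear _ _)).
have [N [b [Vb bP]]] := vgr_fin V n.
exists (D + N)%N,
  (fun i => match fintype.split i with inl j => e j | inr j => b j end) => a an.
have [|c ec] := eP (a - Vcomp n a).
  move=> p; rewrite leq_eqVlt => /orP[/eqP <-|lt].
    by rewrite (linB (comp_linear _ n)) (comp_id _ (comp_in _ _ _)) subrr.
  rewrite (linB (comp_linear _ p)) an // (comp_hom _ _ (comp_in _ _ _)) gtn_eqF //.
  by rewrite subr0.
have [c' [ec' _]] := bP _ (comp_in (vgr_direct_sum V) n a).
exists (row_mx c c'); rewrite -[LHS](subrK (Vcomp n a)) ec ec' big_split_ord /=.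
congr (_ + _); apply: eq_bigr => i _.
  by rewrite row_mxEl (unsplitK (inl i)).
by rewrite row_mxEr (unsplitK (inr i)).
Qed.

(* Schur's lemma.  If [phi] is not a scalar, then [phi - c] is invertible for
   every [c]; the vectors [(phi - c)^-1 w] would be uncountably many linearly
   independent ones in a space of countable dimension. *)
Lemma zero_mode_schur W k (phi : W -> W) : simple_module W -> linear phi ->
  (forall u, mgr W k u -> mgr W k (phi u)) ->
  (forall a u, mgr W k u -> phi (zmode 0 a u) = zmode 0 a (phi u)) ->
  exists c, forall u, mgr W k u -> phi u = c *: u.
Proof.
move=> sW lphi Wphi cphi; apply: contrapT => nsc.
have ker c u : mgr W k u -> phi u = c *: u -> u = 0.
  move=> Wu eu; apply: contrapT => u0; apply: nsc; exists c => u' Wu'.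
  have [a <-] := simple_gen sW Wu u0 Wu'; rewrite subrr cphi // eu.
  by rewrite (linZ (zmode_lin _ _)).
have [w Ww w0] : exists2 w, mgr W k w & w <> 0.
  apply: contrapT => nw; apply: nsc; exists 0 => u Wu; rewrite scale0r.
  have -> : u = 0 by apply: contrapT => u0; apply: nw; exists u.
  exact: lin0.
have Wsub c u : mgr W k u -> mgr W k (phi u - c *: u).
  by move=> Wu; apply: subB; [exact: mgr_sub|exact: Wphi|apply: subZ => //; exact: mgr_sub].
have sub_neq0 c u : mgr W k u -> u <> 0 -> phi u - c *: u <> 0.
  by move=> Wu u0 /eqP; rewrite subr_eq0 => /eqP /(ker _ _ Wu).
(* [(phi - c) w] is nonzero, so a zero mode sends it to [w]; as [phi] commutes with zero modes, that
   mode applied to [w] is [(phi - c)^-1 w]. *)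
have solve c : exists a, phi (zmode 0 a w) - c *: zmode 0 a w = w.
  have [a ea] := simple_gen sW (Wsub c w Ww) (sub_neq0 c w Ww w0) Ww.
  rewrite subrr in ea; exists a; rewrite cphi // -[RHS]ea.
  by rewrite (linB (zmode_lin _ _)) (linZ (zmode_lin _ _)).
have [a aP] := choice solve.
have bnd c : exists n, forall p, (n <= p)%N -> Vcomp p (a c) = 0.
  by have [N [aN _]] := comp_sum (vgr_direct_sum V) (a c); exists N.
have [nb nbP] := choice bnd.
(* Some degree bound [n] serves arbitrarily many scalars [c], in particular more than the number [D]
   of generators of [V] below degree [n]. *)
have [n nP] := infinite_fiber nb; have [D [e eP]] := fin_dim_below n.
have [s [us ss sn]] := nP D.+1.
pose t (l : 'I_D.+1) := nth 0 s l.
have tl l : nb (t l) = n by apply: sn; rewrite mem_nth // ss.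
have E (l : 'I_D.+1) : exists c : 'rV[K]_D, a (t l) = \sum_(i < D) c 0 i *: e i.
  by apply: eP => p le; apply: nbP; rewrite tl.
have [M MP] := choice E.
pose MM : 'M[K]_(D.+1, D) := \matrix_(l, i) M l 0 i.
have [la la0 laM] : exists2 la : 'rV[K]_D.+1, la != 0 & la *m MM = 0.
  have : kermx MM != 0.
    rewrite kermx_eq0 /row_free; apply/negP => /eqP rk.
    by have := rank_leq_col MM; rewrite rk ltnn.
  by move=> /rowV0Pn[la /sub_kermxP ? ?]; exists la.
pose y l := zmode 0 (a (t l)) w.
have sy : \sum_l la 0 l *: y l = 0.
  rewrite /y; under eq_bigr => l _ do rewrite -(linZ (zmode_linl _ _)).
  rewrite -(lin_sum (zmode_linl _ _)).
  rewrite [X in zmode _ X _](_ : _ = 0) ?(lin0 (zmode_linl _ _)) //.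
  under eq_bigr => l _ do rewrite MP scaler_sumr.
  rewrite exchange_big big1 //= => i _.
  under eq_bigr => l _ do rewrite scalerA.
  have := congr1 (fun A : 'rV_D => A 0 i) laM; rewrite !mxE -scaler_suml => lM.
  rewrite [X in X *: _](_ : _ = 0) ?scale0r // -[RHS]lM.
  by apply: eq_bigr => l _; rewrite mxE.
(* Clearing denominators in the relation between the [(phi - t l)^-1 w] gives [P(phi) w = 0], where
   [P] does not vanish at any [t l] with [la l] nonzero. *)
pose Q l := \prod_(j < D.+1 | j != l) ('X - (t j)%:P).
pose P := \sum_l la 0 l *: Q l.
have P0 : P != 0.
  have [l ll0] : exists l, la 0 l != 0.
    apply: contrapT => nl; case/eqP: la0; apply/rowP => l; rewrite mxE.
    by apply: contrapT => /eqP ?; apply: nl; exists l.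
  apply: contraNneq ll0 => eP0; have := congr1 (horner^~ (t l)) eP0.
  rewrite /P horner0 horner_sum (bigD1 l) //= big1 ?addr0 => [|j ne]; last first.
    by rewrite hornerZ horner_prod (bigD1 l) 1?eq_sym //= hornerXsubC subrr mul0r mulr0.
  rewrite hornerZ => /eqP; rewrite mulf_eq0 => /orP[//|].
  rewrite horner_prod => /prodf_eq0[j ne]; rewrite !hornerE subr_eq0.
  by rewrite nth_uniq ?ss // => /eqP /val_inj el; rewrite el eqxx in ne.
have : pev phi P w = 0.
  rewrite /P (lin_sum (pev_linl _ _)).
  rewrite (eq_bigr (fun l => pev phi (\prod_j ('X - (t j)%:P)) (la 0 l *: y l))).
    by rewrite -(lin_sum (pev_lin lphi _)) sy (lin0 (pev_lin lphi _)).
  move=> l _; rewrite (linZ (pev_linl _ _)) (linZ (pev_lin lphi _)); congr (_ *: _).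
  by rewrite (bigD1 l) //= mulrC pev_root // /y aP.
(* [P] splits into linear factors, and each [phi - z] is injective in degree [k], which contradicts
   [P(phi) w = 0]. *)
have [r ->] := closed_field_poly_normal P.
rewrite (linZ (pev_linl _ _)) => /eqP; rewrite scaler_eq0 lead_coef_eq0 (negPf P0) /=.
move/eqP; clear -Ww w0 Wsub sub_neq0 lphi.
elim: r w Ww w0 => [|z r IH] w Ww w0; first by rewrite big_nil pev1.
by rewrite big_cons mulrC pev_root //; apply: IH; [exact: Wsub|exact: sub_neq0].
Qed.

End Dixmier.

(** * Simple submodules as normalized modules *)

Section SubmoduleAsModule.
Context {R : realType} {V : voa R} (W : adm_module V) (S : set W).
Hypothesis simS : simple_submodule S.
Local Notation K := (R[i]).
Local Notation Wcomp := (comp (mgr_direct_sum W)).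

Lemma graded_comp (W1 : adm_module V) (U : set W1) n w : graded_submodule U ->
  U w -> U (comp (mgr_direct_sum W1) n w).
Proof.
move=> [sU _ [_ /(_ w)dec _]] /dec[s [x [_ Ux ->]]].
rewrite (lin_sum (comp_linear _ n)); apply: sub_sum => // i _.
have [Ui Wi] := Ux i; rewrite (comp_hom _ _ Wi).
by case: ifP => _ //; exact: (sub0 sU).
Qed.

Lemma simple_subspace : subspace S. Proof. by have [[]] := simS. Qed.
Let sS := simple_subspace.

Let S_act a n w : S w -> S (act a n w).
Proof. by have [[_ + _] _ _] := simS; apply. Qed.

Let S_comp n w : S w -> S (Wcomp n w).
Proof. by have [gS _ _] := simS; exact: graded_comp. Qed.

Lemma lowest_degree : exists c : nat, (exists w, [/\ S w, mgr W c w & w <> 0]) /\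
  forall n w, S w -> mgr W n w -> w <> 0 -> (c <= n)%N.
Proof.
pose P n := `[< exists w, [/\ S w, mgr W n w & w <> 0] >].
have exP : exists n, P n.
  have [_ [w Sw w0] _] := simS; apply: contrapT => nP; apply: w0.
  have [N [_ ->]] := comp_sum (mgr_direct_sum W) w; apply: big1 => n _.
  apply: contrapT => ne; apply: nP; exists n; apply/asboolP; exists (Wcomp n w).
  by split=> //; [exact: S_comp|exact: comp_in].
exists (ex_minn exP); case: ex_minnP => c /asboolP Pc minc; split=> // n w Sw Ww w0.
by apply: minc; apply/asboolP; exists w.
Qed.

Let c := sval (cid lowest_degree).
Let cP : (exists w, [/\ S w, mgr W c w & w <> 0]) /\
  forall n w, S w -> mgr W n w -> w <> 0 -> (c <= n)%N := svalP (cid lowest_degree).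

Let low0 n w : S w -> mgr W n w -> (n < c)%N -> w = 0.
Proof.
move=> Sw Ww lt; apply: contrapT => w0.
by have := cP.2 n w Sw Ww w0; rewrite leqNgt lt.
Qed.

Let T : lmodType K := sub_lmod sS.
Let v : T -> W := @sub_val _ _ S sS.
Let lv : linear v := @sub_val_lin _ _ S sS.
Let iv : injective v := @sub_val_inj _ _ S sS.
Let Sv x : S (v x) := sub_valU x.

Definition sub_act (a : V) (n : int) (x : T) : T := to_sub sS (S_act a n (Sv x)).
(** Shifting by the lowest degree [c] of [S] makes the module normalized; degrees only go down, so a
    bound by [d] survives. *)
Definition sub_mgr (n : nat) : set T := fun x => mgr W (n + c)%N (v x).

Lemma sub_act_bilinear : bilinear_modes sub_act.
Proof.
split=> [n x k a b|a n k x y]; apply: iv; rewrite lv.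
  exact: (act_linl _ _).
by rewrite -(act_lin _ _) -lv.
Qed.

Lemma sub_act_truncated : truncated sub_act.
Proof.
move=> a x; have [N aN] := act_truncated a (v x); exists N => n le.
by apply: iv; rewrite (lin0 lv); exact: aN.
Qed.

Lemma sub_act_vac n x : sub_act vac n x = if n == -1 then x else 0.
Proof. by apply: iv; rewrite [LHS]vac_act; case: eqP; rewrite ?(lin0 lv). Qed.

Lemma sub_act_borcherds : borcherds_identity (@mode R V) sub_act.
Proof.
move=> a b x m n k; have [N0 H] := @act_borcherds R V W a b (v x) m n k.
exists N0 => N le; apply: iv; rewrite !(lin_sum lv).
transitivity (\sum_(j < N) binz m j *: act (mode a (k + j%:Z) b) (m + n - j%:Z) (v x)).
  by apply: eq_bigr => j _; rewrite (linZ lv).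
by rewrite H.
Qed.

Lemma sub_mgr_direct_sum : is_direct_sum sub_mgr setT.
Proof.
split=> [n|x _|s x us Mx x0 n ns].
- split=> //; split; first by rewrite /sub_mgr (lin0 lv); exact: (sub0 (mgr_sub _ _)).
  by move=> k x y Mx My; rewrite /sub_mgr lv; exact: (mgr_sub _ _).2.
- have [N [xN ex]] := comp_sum (mgr_direct_sum W) (v x).
  exists (iota 0 N), (fun n => to_sub sS (S_comp (n + c) (Sv x))); split.
  + exact: iota_uniq.
  + by move=> n; exact: comp_in.
  apply: iv; rewrite (lin_sum lv); apply: (comp_eq (hG := mgr_direct_sum W)) => n.
  rewrite (lin_sum (comp_linear _ n)).
  have [lt|le] := ltnP n c.
    rewrite (low0 (S_comp n (Sv x)) (comp_in _ _ _) lt) big1 // => i _.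
    rewrite (comp_hom _ _ (comp_in (mgr_direct_sum W) (i + c) (v x))) ifF //.
    by apply/negbTE; lia.
  have [ltN|leN] := ltnP (n - c) N; last first.
    rewrite xN ?big1_seq //; last by lia.
    move=> i; rewrite mem_iota => /andP[_ lti].
    rewrite (comp_hom _ _ (comp_in (mgr_direct_sum W) (i + c) (v x))) ifF //.
    by apply/negbTE; lia.
  rewrite (bigD1_seq (n - c)%N) ?iota_uniq ?mem_iota //=.
  rewrite (comp_hom _ _ (comp_in (mgr_direct_sum W) (n - c + c) (v x))).
  rewrite subnK // eqxx big1 ?addr0 // => i ne.
  rewrite (comp_hom _ _ (comp_in (mgr_direct_sum W) (i + c) (v x))) ifF //.
  by apply/negbTE; lia.
apply: iv; rewrite (lin0 lv).
have := congr1 (fun y => Wcomp (n + c) (v y)) x0.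
rewrite (lin0 lv) (lin0 (comp_linear _ _)) (lin_sum lv) (lin_sum (comp_linear _ _)).
rewrite (bigD1_seq n) //= big1 ?addr0 => [|i ne].
  by rewrite (comp_id _ (Mx n : mgr W (n + c) (v (x n)))).
rewrite (comp_hom _ _ (Mx i : mgr W (i + c) (v (x i)))) ifF // eqn_add2r eq_sym.
exact/negbTE.
Qed.

Lemma sub_act_deg (p q : nat) n a x : vgr V p a -> sub_mgr q x ->
  gr_int sub_mgr (p%:Z + q%:Z - n - 1) (sub_act a n x).
Proof.
move=> Va Mx; have := act_deg n Va Mx.
case e : (p%:Z + (q + c)%N%:Z - n - 1) => [r|r] Wr; last first.
  have -> : sub_act a n x = 0 by apply: iv; rewrite (lin0 lv).
  case: (p%:Z + q%:Z - n - 1) => [s|s] //=.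
  by rewrite /sub_mgr (lin0 lv); exact: (sub0 (mgr_sub _ _)).
case e' : (p%:Z + q%:Z - n - 1) => [s|s] /=.
  by rewrite /sub_mgr; have -> : (s + c)%N = r by lia.
by apply: iv; rewrite (lin0 lv); apply: (low0 (S_act a n (Sv x)) Wr); lia.
Qed.

Definition sub_module : adm_module V :=
  AdmModule sub_act_bilinear sub_act_truncated sub_act_vac sub_act_borcherds
    sub_mgr_direct_sum sub_act_deg.

Lemma sub_module_zmode e a (x : sub_module) :
  v (zmode e a x) = zmode e a (v x).
Proof.
move: a; apply: (gr_ind (vgr_direct_sum V)) => [|p a Va].
  split=> [|k a b ea eb]; first by rewrite !(lin0 (zmode_linl _ _)) (lin0 lv).
  by rewrite (zmode_linl _ x) lv ea eb (zmode_linl _ (v x)).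
by rewrite !(zmode_hom _ _ Va).
Qed.

Lemma sub_module_normalized : normalized sub_module.
Proof.
have [w [Sw Ww w0]] := cP.1; exists (to_sub sS Sw) => // e; apply: w0.
by have := congr1 v e; rewrite (lin0 lv).
Qed.

Lemma sub_module_simple : simple_module sub_module.
Proof.
have [_ [w Sw w0] minS] := simS; split.
- split=> //; have := sub_mgr_direct_sum; congr is_direct_sum.
  by apply/funext => n; rewrite setTI.
- exists (to_sub sS Sw) => // e; apply: w0.
  by have := congr1 v e; rewrite (lin0 lv).
move=> U gU _; have [sU aU _] := gU.
pose U' : set W := fun w => exists2 x, U x & v x = w.
have sU' : subspace U'.
  split; first by exists 0; [exact: (sub0 sU)|exact: (lin0 lv)].
  by move=> k _ _ [x Ux <-] [y Uy <-]; exists (k *: x + y); [exact: sU.2|exact: lv].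
have vcomp n (x : sub_module) : v (comp (mgr_direct_sum sub_module) n x) = Wcomp (n + c) (v x).
  have [N [xN {2}->]] := comp_sum (mgr_direct_sum sub_module) x.
  rewrite (lin_sum lv) (lin_sum (comp_linear _ _)).
  have M i := comp_in (mgr_direct_sum sub_module) i x.
  rewrite (eq_bigr (fun i : 'I_N => if (i : nat) == n then
      v (comp (mgr_direct_sum sub_module) n x) else 0)).
    rewrite -big_mkcond /=; have [lt|le] := ltnP n N.
      by rewrite (big_pred1 (Ordinal lt)).
    rewrite big_pred0 ?xN ?(lin0 lv) // => i; apply/negbTE.
    by have := ltn_ord i; lia.
  move=> i _; rewrite (comp_hom _ _ (M i : mgr W (i + c) (v _))) eqn_add2r eq_sym.
  by case: eqP => // ->.
have [U0|US] : U' = [set 0]%classic \/ U' = S.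
  apply: minS => [|w' [x _ <-]]; last exact: Sv.
  split=> //; first by move=> a n _ [x Ux <-]; exists (sub_act a n x) => //; exact: aU.
  apply: (homogeneous_direct_sum (hG := mgr_direct_sum W)) => // n _ [x Ux <-].
  have [lt|le] := ltnP n c.
    by rewrite (low0 (S_comp n (Sv x)) (comp_in _ _ _) lt); exact: (sub0 sU').
  exists (comp (mgr_direct_sum sub_module) (n - c) x); first exact: graded_comp.
  by rewrite vcomp subnK.
- left; apply/seteqP; split=> [x Ux|_ ->]; last exact: (sub0 sU).
  have : U' (v x) by exists x.
  by rewrite U0 => vx; apply: iv; rewrite (lin0 lv).
right; apply/seteqP; split=> // x _.
by have : U' (v x) by [rewrite US; exact: Sv] => -[y Uy /iv <-].
Qed.

Lemma simple_sub_transfer n s : S s -> mgr W n s ->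
  exists (N : adm_module V) (k : nat) (x : N), [/\ simple_module N, normalized N,
    (k <= n)%N, mgr N k x & forall a, zmode 0 a x = 0 -> zmode 0 a s = 0].
Proof.
move=> Ss Ws; have [->|s0] := pselect (s = 0).
  exists sub_module, 0%N, 0; split=> //.
  - exact: sub_module_simple.
  - exact: sub_module_normalized.
  - exact: (sub0 (mgr_sub _ _)).
  - by move=> a _; exact: (lin0 (zmode_lin _ _)).
have le := cP.2 n s Ss Ws s0.
exists sub_module, (n - c)%N, (to_sub sS Ss); split.
- exact: sub_module_simple.
- exact: sub_module_normalized.
- exact: leq_subr.
- by rewrite /mgr /= /sub_mgr subnK.
- by move=> a /(congr1 v); rewrite sub_module_zmode (lin0 lv).
Qed.

End SubmoduleAsModule.

(** * The Zhu algebra *)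

Section QuotientModule.
Context {K : fieldType} {W : lmodType K} (U : set W) (hU : subspace U).

(** [zhu_algebra] is only an additive group, whereas functionals take values in a vector space; here
    a quotient of this kind is given its scalars. *)
Definition quo_lmod := Quotient.quot (sub_pred hU).
HB.instance Definition _ := GRing.Zmodule.on quo_lmod.

Definition quo_pi (w : W) : quo_lmod := \pi_(Quotient.quot (sub_pred hU))%qT w.

Lemma quo_pi_eq u w : U (u - w) <-> quo_pi u = quo_pi w.
Proof.
split=> [Uuw|/eqP]; first by apply/eqP; rewrite -Quotient.idealrBE; exact/asboolP.
by rewrite -Quotient.idealrBE => /asboolP.
Qed.

Lemma quo_piD u w : quo_pi (u + w) = quo_pi u + quo_pi w.
Proof. exact: raddfD. Qed.

Lemma quo_repr x : quo_pi (repr (x : Quotient.quot (sub_pred hU))) = x.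
Proof. exact: reprK. Qed.

Definition quo_scale (c : K) (x : quo_lmod) : quo_lmod :=
  quo_pi (c *: repr (x : Quotient.quot (sub_pred hU))).

Lemma quo_scaleE c w : quo_scale c (quo_pi w) = quo_pi (c *: w).
Proof.
apply/quo_pi_eq; rewrite -scalerBr; apply: subZ => //.
by apply/quo_pi_eq; rewrite quo_repr.
Qed.

Lemma quo_scaleA a b x : quo_scale a (quo_scale b x) = quo_scale (a * b) x.
Proof. by rewrite -[x]quo_repr !quo_scaleE scalerA. Qed.
Lemma quo_scale1 x : quo_scale 1 x = x.
Proof. by rewrite -[x]quo_repr quo_scaleE scale1r. Qed.
Lemma quo_scaleDr c x y : quo_scale c (x + y) = quo_scale c x + quo_scale c y.
Proof.
by rewrite -[x]quo_repr -[y]quo_repr -quo_piD !quo_scaleE scalerDr quo_piD.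
Qed.
Lemma quo_scaleDl x a b : quo_scale (a + b) x = quo_scale a x + quo_scale b x.
Proof. by rewrite -[x]quo_repr !quo_scaleE scalerDl quo_piD. Qed.

HB.instance Definition _ := GRing.Zmodule_isLmodule.Build K quo_lmod
  quo_scaleA quo_scale1 (fun c x y => quo_scaleDr c x y) (fun x a b => quo_scaleDl x a b).

Lemma quo_pi_lin : linear (quo_pi : W -> quo_lmod).
Proof. by move=> c u w; rewrite quo_piD -quo_scaleE. Qed.

Lemma quo_pi_eq0 u : U u <-> quo_pi u = 0.
Proof.
have <- : quo_pi 0 = 0 by exact: (lin0 quo_pi_lin).
by rewrite -quo_pi_eq subr0.
Qed.

End QuotientModule.

Section DerivativeSystem.
Context {K : numFieldType} {E : lmodType K}.

(** Integration by parts: [u'] holds the coefficients of the derivative, and a total derivative has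
    no residue. *)
Lemma X1_derivative (u u' : int -> E) : tr0 u ->
  (forall j, u' j = - (j%:~R *: u (j - 1))) -> forall n r,
  X1 u' n r = - (n%:~R *: X1 u (n - 1) r) - r%:~R *: X1 u n (r - 1).
Proof.
move=> tu u'E n r; have [N uN] := tu.
have u'N j : N + 1 <= j -> u' j = 0.
  by move=> le; rewrite u'E uN ?scaler0 ?oppr0 //; lia.
have tu' : tr0 u' by exists (N + 1).
have PX := X1_pascal tu.
pose D n r := X1 u' n r + (n%:~R *: X1 u (n - 1) r + r%:~R *: X1 u n (r - 1)).
suff D0 : D n r = 0.
  by apply/eqP; rewrite -opprD -addr_eq0; apply/eqP; exact: D0.
apply: (@pascal1_eq0 _ _ D (N + 1) 0).
- apply: pascalD; first exact: X1_pascal.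
  move=> n' r'; rewrite addrK.
  have e1 : X1 u n' r' = X1 u (n' - 1) (r' + 1) + X1 u (n' - 1) r'.
    by rewrite -PX subrK.
  have e2 : X1 u (n' + 1) (r' - 1) = X1 u n' r' + X1 u n' (r' - 1).
    by rewrite PX subrK.
  rewrite addrK e2 [RHS]addrACA -scalerDr -e1 !intrD !scalerDl scale1r scalerDr.
  by rewrite -!addrA; congr (_ + _); rewrite addrCA.
- move=> n' r' le; rewrite /D (X1_vanish (R := N + 1)) //.
  rewrite (X1_vanish (R := N)) //; last by lia.
  by rewrite (X1_vanish (R := N)) // ?scaler0 ?addr0 //; lia.
by move=> r'; rewrite /D !X1_0 u'E scale0r add0r addNr.
Qed.
End DerivativeSystem.

Section ZhuFunctional.
Context {R : realType} (V : voa R) (d : nat).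
Local Notation K := (R[i]).

Lemma zhu_O_sub : subspace (@zhu_O R V d).
Proof.
split; first by move=> A [[A0 _] _].
by move=> c u v Ou Ov A [sA GA]; apply: sA.2; [apply: Ou|apply: Ov].
Qed.

Let E : lmodType K := quo_lmod zhu_O_sub.
Definition zhu_pi : V -> E := quo_pi zhu_O_sub.

Let lpi : linear zhu_pi := quo_pi_lin zhu_O_sub.

Lemma zhu_pi_circ p a b : vgr V p a -> zhu_pi (zhu_circ d p a b) = 0.
Proof.
by move=> Va; apply: (quo_pi_eq0 zhu_O_sub _).1 => A [_ GA]; apply: GA; left; exists p, a, b.
Qed.

Lemma zhu_pi_L a : zhu_pi (mode conf 0 a + mode conf 1 a) = 0.
Proof. by apply: (quo_pi_eq0 zhu_O_sub _).1 => A [_ GA]; apply: GA; right; exists a. Qed.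

Lemma vgr_L1 p a : vgr V p a -> vgr V p.+1 (mode conf 0 a).
Proof.
move=> Va; have := mode_deg 0 (conf_deg V) Va.
by have -> : 2%:Z + p%:Z - 0 - 1 = p.+1%:Z by lia.
Qed.

(* [O_d(V)] contains the higher poles too, by replacing [a] by [L_(-1) a]. *)
Lemma zhu_pi_X1 s p a v : vgr V p a ->
  X1 (fun j => zhu_pi (mode a j v)) (p%:Z + d%:Z) (- (d.*2 + 2)%N%:Z - s%:Z) = 0.
Proof.
elim: s p a => [|s IH] p a Va.
  rewrite /X1 -PoszD bsum_nat -[RHS](zhu_pi_circ v Va) /zhu_circ (lin_sum lpi).
  apply: eq_bigr => i _; rewrite expr1n mul1r (linZ lpi).
  by congr (_ *: zhu_pi (mode _ _ _)); lia.
have tu := tr0_mode a v lpi; have PX := X1_pascal tu.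
(* The function of [L_(-1) a] is the derivative. Of the two terms, the first is the induction
   hypothesis for [a]; Pascal's rule brings the other to row [p + d], and its factor, the exponent
   of [x - 1], is nonzero. *)
have := IH _ _ (vgr_L1 Va).
rewrite (@X1_derivative _ _ (fun j => zhu_pi (mode a j v))) //; last first.
  by move=> j; rewrite translation scaleNr (linN lpi) (linZ lpi).
have -> : p.+1%:Z + d%:Z - 1 = p%:Z + d%:Z by lia.
rewrite IH // scaler0 oppr0 add0r.
have -> : p.+1%:Z + d%:Z = p%:Z + d%:Z + 1 by lia.
rewrite PX subrK IH // add0r => /eqP; rewrite oppr_eq0 scaler_eq0 intr_eq0.
have -> : (- (d.*2 + 2)%N%:Z - s%:Z == 0) = false by apply/negbTE; lia.
move=> /eqP; have -> // : - (d.*2 + 2)%N%:Z - s%:Z - 1 = - (d.*2 + 2)%N%:Z - s.+1%:Z by lia.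
Qed.

(** [zhu_circ] is the case where both inequalities in [functionals] are equalities. Lower [r] is
    [zhu_pi_X1], and larger [n] follows by the recurrence. *)
Lemma zhu_pi_functional : functionals d d%:Z zhu_pi.
Proof.
split=> [|p a v n r]; first exact: lpi.
case: p => [p|p] Va le1 le2; last first.
  apply: bsum_zero => i; have -> : a = 0 by exact: Va.
  by rewrite (lin0 (mode_linl _ _)) (lin0 lpi).
have PX := X1_pascal (tr0_mode a v lpi).
have : exists i : nat, n = p%:Z + d%:Z + i%:Z by exists (absz (n - (p%:Z + d%:Z))%R); lia.
case=> i en; rewrite {}en {le1} in le2 *.
elim: i r le2 => [|i IH] r le2.
  rewrite addr0; have -> : r = - (d.*2 + 2)%N%:Z - (absz (r + (d.*2 + 2)%N%:Z)%R)%:Z by lia.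
  exact: zhu_pi_X1.
have -> : p%:Z + d%:Z + i.+1%:Z = p%:Z + d%:Z + i%:Z + 1 by lia.
by rewrite PX !IH ?addr0 //; lia.
Qed.

Definition zhu_vector : @fam_module R V d E := fam_single zhu_pi_functional.

Lemma zhu_vector_deg : mgr (@fam_module R V d E) d zhu_vector.
Proof. by move=> k ne; rewrite /= (negPf ne). Qed.

Lemma zhu_vector_ann a : zmode 0 a zhu_vector = 0 -> @zhu_O R V d a.
Proof.
suff H : sub_val (zmode 0 a zhu_vector : @fam_lmod R V d E) d vac = zhu_pi a.
  by move=> e; apply: (quo_pi_eq0 zhu_O_sub a).2; rewrite -[LHS]H e.
move: a; apply: (gr_ind (vgr_direct_sum V)) => [|p a Va].
  split=> [|c a b ea eb].
    by rewrite (lin0 (zmode_linl _ _)) (lin0 lpi).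
  by rewrite (zmode_linl _ _) sub_valZD ea eb lpi.
rewrite (zmode_hom _ _ Va) subr0 /=.
rewrite (fam_act_hom _ _ _ (fam_single_fam zhu_pi_functional) Va).
have -> : d%:Z - p%:Z + (p%:Z - 1) + 1 = d%:Z by lia.
rewrite /= eqxx; apply: fmode1_at_vac => //; first exact: zhu_pi_functional.
exact: zhu_pi_L.
Qed.

End ZhuFunctional.

Section FiniteSeparation.
Context {R : realType} (V : voa R) (d : nat) (hrat : rational_voa V).
Variables (m : nat) (S : 'I_m -> adm_module V).
Hypothesis hall : forall W : adm_module V, simple_module W -> normalized W ->
  exists i, adm_iso W (S i).

(* By complete reducibility [zhu_vector] is a sum of finitely many vectors of
   simple submodules. *)
Lemma zhu_O_separation : exists r (x : 'I_r -> {i : 'I_m & (nat * S i)%type}),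
  (forall q, ((tagged (x q)).1 <= d)%N /\
     mgr (S (tag (x q))) (tagged (x q)).1 (tagged (x q)).2) /\
  forall a, (forall q, zmode 0 a (tagged (x q)).2 = 0) -> @zhu_O R V d a.
Proof.
pose M := @fam_module R V d (quo_lmod (@zhu_O_sub R V d)).
have [I [T [simT [_ span _]]]] := hrat M.
have [s [y [us Ty ez]]] := span (@zhu_vector R V d) Logic.I.
pose z i := comp (mgr_direct_sum M) d (y i).
have zP i : T i (z i) /\ mgr M d (z i).
  by split; [have [gT _ _] := simT i; exact: graded_comp|exact: comp_in].
have ez' : @zhu_vector R V d = \sum_(i <- s) z i.
  have := comp_id (mgr_direct_sum M) (@zhu_vector_deg R V d : mgr M d (@zhu_vector R V d : M)).
  by move=> <-; rewrite [X in comp _ _ X]ez (lin_sum (comp_linear _ _)).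
have H (q : 'I_(size s)) : exists x : {i : 'I_m & (nat * S i)%type},
   [/\ ((tagged x).1 <= d)%N, mgr (S (tag x)) (tagged x).1 (tagged x).2 &
     forall a, zmode 0 a (tagged x).2 = 0 -> zmode 0 a (z (tnth (in_tuple s) q)) = 0].
  set i := tnth _ _; have [Tz Mz] := zP i.
  have [N [k [x [sN nN lek Nx xP]]]] := simple_sub_transfer (simT i) Tz Mz.
  have [j [f [bf f_act f_gr]]] := hall sN nN.
  exists (Tagged (fun i => (nat * S i)%type) (k, f x)); split=> //=; first exact: f_gr.
  have [g fK gK] := bf.
  move=> a ea; apply: xP; apply: (can_inj fK); rewrite linear0 -ea.
  move: a {ea}; apply: (gr_ind (vgr_direct_sum V)) => [|p a Va].
    split=> [|c a b ea eb]; first by rewrite !(lin0 (zmode_linl _ _)) linear0.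
    by rewrite !(zmode_linl _ _) linearP ea eb.
  by rewrite !(zmode_hom _ _ Va) f_act.
have [x xP] := choice H.
exists (size s), x; split=> [q|a ax]; first by have [] := xP q.
apply: zhu_vector_ann; rewrite ez' (lin_sum (zmode_lin _ _)) big_tnth.
by apply: big1 => q _; have [_ _] := xP q; apply; exact: ax.
Qed.

End FiniteSeparation.

(** * Jacobson density for zero modes *)

Section Density.
Context {R : realType} (V : voa R) (m : nat) (S : 'I_m -> adm_module V).
Hypotheses (hsimple : forall i, simple_module (S i))
  (hnorm : forall i, normalized (S i))
  (hdistinct : forall i j, adm_iso (S i) (S j) -> i = j).
Local Notation K := (R[i]).

(** Normalization forces the two degrees to agree, and then [local_iso] identifies the modules. *)
Lemma same_component i i' j j' (w : S i) (w' : S i') : mgr (S i) j w -> w <> 0 ->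
  mgr (S i') j' w' -> w' <> 0 ->
  (forall a, zmode 0 a w = 0 -> zmode 0 a w' = 0) -> i = i' /\ j = j'.
Proof.
move=> Ww w0 Ww' w'0 loc.
have loc' := local_sym (hsimple i) Ww w0 Ww' w'0 loc.
have t1 := local_transfer (hsimple i') Ww Ww' w'0 loc.
have t2 := local_transfer (hsimple i) Ww' Ww w0 loc'.
have le1 := local_normalized (hsimple i) (hnorm i) Ww w0 Ww' t2.
have le2 := local_normalized (hsimple i') (hnorm i') Ww' w'0 Ww t1.
have ej : j = j' by apply/eqP; rewrite eqn_leq le1.
split=> //; rewrite -{}ej {le1 le2} in Ww'.
have [f [bf f_act f_gr _]] := local_iso (hsimple i) (hsimple i') Ww w0 Ww' w'0 loc.
by apply: hdistinct; exists f.
Qed.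

Section Vectors.
Variables (d : nat) (Q : eqType) (ii : Q -> 'I_m) (jj : Q -> nat) (xx : forall q, S (ii q)).
Hypotheses (xxP : forall q, mgr (S (ii q)) (jj q) (xx q)) (jjd : forall q, (jj q <= d)%N).

Definition ann (l : seq Q) (a : V) : Prop := forall q, q \in l -> zmode 0 a (xx q) = 0.

(** [ann l] behaves as a left ideal under composition of zero modes. *)
Lemma ann_mul l a b : ann l a -> exists c, ann l c /\ forall i k (w : S i), (k <= d)%N ->
  mgr (S i) k w -> zmode 0 b (zmode 0 a w) = zmode 0 c w.
Proof.
move=> la; have [c Hc] := zmode_mul d 0 0 a b; rewrite addr0 in Hc.
exists c; split=> [q ql|i k w le Ww]; last exact: (Hc _ k).
by rewrite -(Hc _ (jj q)) // la // (lin0 (zmode_lin _ _)).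
Qed.

(** The vectors live in different modules, so their span is replaced by an arbitrary family [U] of
    subspaces containing them. If [ann l] does not kill [w], then [a x_q |-> a w] for [a] in [ann l]
    is well defined and commutes with zero modes; it is a scalar [c] by Schur, and [ann l] kills
    [w - c x_q]. *)
Lemma density l (U : forall i, nat -> set (S i)) : (forall i j, subspace (U i j)) ->
  forall i j (w : S i), mgr (S i) j w -> (j <= d)%N ->
  (forall a, ann l a -> zmode 0 a w = 0) ->
  (forall q, q \in l -> U (ii q) (jj q) (xx q)) -> U i j w.
Proof.
move=> sU; elim: l => [|q l IH] i j w Ww led annw Ux.
  rewrite -[w]zmode_vac annw => [|q]; last by rewrite in_nil.
  exact: (sub0 (sU i j)).
have Uq : U (ii q) (jj q) (xx q) by apply: Ux; rewrite inE eqxx.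
have Ul q' : q' \in l -> U (ii q') (jj q') (xx q').
  by move=> ql; apply: Ux; rewrite inE ql orbT.
have loc a : ann l a -> zmode 0 a (xx q) = 0 -> zmode 0 a w = 0.
  by move=> al aq; apply: annw => q'; rewrite inE => /orP[/eqP -> //|/al].
have [annw'|] := pselect (forall a, ann l a -> zmode 0 a w = 0); first exact: IH.
move=> /existsNP[a1 /not_implyP[al1 w1]].
have x1 : zmode 0 a1 (xx q) <> 0 by move=> /(loc _ al1).
have Wx1 := zmode_deg0 a1 (xxP q); have Ww1 := zmode_deg0 a1 Ww.
have [ei ej] : ii q = i /\ jj q = j.
  apply: (same_component Wx1 x1 Ww1 w1) => b eb.
  have [c [lc Hc]] := ann_mul b al1.
  by rewrite (Hc _ j) //; apply: loc => //; rewrite -(Hc _ (jj q)).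
subst i j.
pose x := xx q.
have gen u : exists a, ann l a /\ zmode 0 a x = comp (mgr_direct_sum (S (ii q))) (jj q) u.
  have [b eb] := simple_gen (hsimple (ii q)) Wx1 x1
    (comp_in (mgr_direct_sum (S (ii q))) (jj q) u).
  rewrite subrr in eb; have [c [lc Hc]] := ann_mul b al1.
  by exists c; split=> //; rewrite -(Hc _ (jj q)) // eb.
have [A AP] := choice gen.
have Al u : ann l (A u) := (AP u).1.
have AE u : zmode 0 (A u) x = comp (mgr_direct_sum (S (ii q))) (jj q) u := (AP u).2.
have ann_lin c a b : ann l a -> ann l b -> ann l (c *: a + b).
  by move=> la lb q' ql; rewrite (zmode_linl _ _) la // lb // scaler0 addr0.
have eqw a b : ann l a -> ann l b -> zmode 0 a x = zmode 0 b x -> zmode 0 a w = zmode 0 b w.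
  move=> la lb /eqP; rewrite -subr_eq0 -(linB (zmode_linl _ _)) => /eqP e.
  apply/eqP; rewrite -subr_eq0 -(linB (zmode_linl _ _)); apply/eqP; apply: loc => //.
  by rewrite addrC -scaleN1r; exact: ann_lin.
pose phi u := zmode 0 (A u) w.
have [c cP] : exists c, forall u, mgr (S (ii q)) (jj q) u -> phi u = c *: u.
  apply: (zero_mode_schur (hsimple _)).
  - move=> c u v; rewrite /phi -(zmode_linl _ w); apply: eqw => //; first exact: ann_lin.
    by rewrite (zmode_linl _ x) !AE (comp_linear _ _).
  - by move=> u _; exact: zmode_deg0.
  - move=> a u Wu; have [c [lc Hc]] := ann_mul a (Al u).
    rewrite /phi (Hc _ (jj q)) //; apply: eqw => //.
    rewrite AE -(Hc _ (jj q)) // AE !comp_id //.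
    exact: zmode_deg0.
rewrite -[w](subrK (c *: x)); apply: subD => //; last exact: subZ.
apply: IH => //.
  by apply: subB => //; [exact: mgr_sub|apply: subZ => //; exact: mgr_sub].
move=> a la; rewrite (linB (zmode_lin _ _)) (linZ (zmode_lin _ _)).
rewrite -(cP _ (zmode_deg0 a (xxP q))) /phi; apply/eqP; rewrite subr_eq0; apply/eqP.
by apply: eqw => //; rewrite AE comp_id //; exact: zmode_deg0.
Qed.

End Vectors.
End Density.

(** * Finite dimension and matrices of zero modes *)

Section FiniteDimension.
Context {K : fieldType} {W : lmodType K}.

(** A spanning family of least size is a basis: two expansions of one vector would give a relation
    that eliminates a member. *)
Lemma span_has_dim (A : set W) r (y : 'I_r -> W) : (forall q, A (y q)) ->
  (forall w, A w -> exists c : 'rV[K]_r, w = \sum_q c 0 q *: y q) ->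
  exists n, has_dim A n.
Proof.
move=> Ay spany.
pose P n := `[< exists y : 'I_n -> W, (forall q, A (y q)) /\
  forall w, A w -> exists c : 'rV[K]_n, w = \sum_q c 0 q *: y q >].
have exP : exists n, P n by exists r; apply/asboolP; exists y.
exists (ex_minn exP); case: ex_minnP => n /asboolP[b [Ab spanb]] minn.
exists b; split=> // w Aw; have [c ec] := spanb w Aw; exists c; split=> // c' ec'.
apply: contrapT => ne; have /existsNP[i0 ni] : ~ (forall i, c 0 i = c' 0 i).
  by move=> e; apply: ne; apply/rowP.
case: n => [|n] in b Ab spanb c ec c' ec' ne i0 ni minn *; first by case: i0 ni.
suff : P n by move=> /minn; rewrite ltnn.
pose de i := c 0 i - c' 0 i.
have de0 : de i0 != 0 by rewrite subr_eq0; exact/eqP.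
have rel : \sum_i de i *: b i = 0.
  by under eq_bigr do rewrite scalerBl; rewrite sumrB -ec -ec' subrr.
have eb : b i0 = \sum_(k < n) (- (de (lift i0 k) / de i0)) *: b (lift i0 k).
  move: rel; rewrite (bigD1_ord i0) //= => /eqP; rewrite addr_eq0 => /eqP e.
  apply: (scalerI de0); rewrite e scaler_sumr -sumrN; apply: eq_bigr => k _.
  by rewrite scalerA mulrN mulrCA divff // mulr1 scaleNr.
apply/asboolP; exists (fun k => b (lift i0 k)); split=> // u Au.
have [c1 ->] := spanb u Au.
exists (\row_k (c1 0 (lift i0 k) - c1 0 i0 * (de (lift i0 k) / de i0))).
rewrite (bigD1_ord i0) //= eb scaler_sumr -big_split; apply: eq_bigr => k _ /=.
by rewrite mxE scalerBl scalerA mulrN scaleNr addrC.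
Qed.

End FiniteDimension.

Section ZeroModeMatrices.
Context {R : realType} {V : voa R} (W : adm_module V) (j n : nat).
Local Notation K := (R[i]).
Hypothesis hd : has_dim (mgr W j) n.
Local Notation Wcomp := (comp (mgr_direct_sum W) j).

Let b : 'I_n -> W := sval (cid hd).

Lemma basis_mgr i : mgr W j (b i).
Proof. by rewrite /b; case: cid => x [] /=. Qed.

Lemma basis_unique w : mgr W j w -> exists! c : 'rV[K]_n, w = \sum_(i < n) c 0 i *: b i.
Proof. by have [_ H] := svalP (cid hd); exact: H. Qed.

Lemma basis_ex w : exists c : 'rV[K]_n, Wcomp w = \sum_(i < n) c 0 i *: b i.
Proof. by have [c [ec _]] := basis_unique (comp_in (mgr_direct_sum W) j w); exists c. Qed.

(** Passing through the component of degree [j] makes the coordinates linear on the whole of [W]. *)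
Definition crd (w : W) : 'rV[K]_n := sval (cid (basis_ex w)).

Lemma crdE w : mgr W j w -> w = \sum_(i < n) crd w 0 i *: b i.
Proof.
move=> Ww; rewrite -[LHS](comp_id (mgr_direct_sum W) Ww).
exact: svalP (cid (basis_ex w)).
Qed.

Lemma crd_uniq w (c : 'rV[K]_n) : mgr W j w -> w = \sum_(i < n) c 0 i *: b i -> crd w = c.
Proof.
move=> Ww ec; have [c' [_ uc]] := basis_unique Ww.
by rewrite -(uc _ ec) -(uc _ (crdE Ww)).
Qed.

Lemma crd_lin : linear crd.
Proof.
move=> c u v; have e w : crd w = crd (Wcomp w).
  apply/esym/crd_uniq; first exact: comp_in.
  exact: svalP (cid (basis_ex w)).
rewrite e; apply: crd_uniq; first exact: comp_in.
rewrite (comp_linear _ j) (e u) (e v).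
rewrite {1}(crdE (comp_in (mgr_direct_sum W) j u)) {1}(crdE (comp_in (mgr_direct_sum W) j v)).
rewrite scaler_sumr -big_split; apply: eq_bigr => i _ /=.
by rewrite !mxE scalerDl scalerA.
Qed.

Lemma crd_basis i k : crd (b i) 0 k = (k == i)%:R.
Proof.
rewrite (@crd_uniq _ (delta_mx 0 i)) ?mxE ?eqxx //; first exact: basis_mgr.
rewrite (bigD1 i) //= mxE !eqxx scale1r big1 ?addr0 // => k' ne.
by rewrite mxE eqxx (negPf ne) scale0r.
Qed.

Definition zmx (a : V) : 'M[K]_n := \matrix_(r, c) crd (zmode 0 a (b c)) 0 r.

Lemma zmx_lin : linear zmx.
Proof.
by move=> k a a'; apply/matrixP => r c; rewrite !mxE (zmode_linl _ _) crd_lin !mxE.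
Qed.

Lemma zmx_vac : zmx vac = 1%:M.
Proof. by apply/matrixP => r c; rewrite !mxE zmode_vac crd_basis. Qed.

Lemma zmodeE a c : zmode 0 a (b c) = \sum_r zmx a r c *: b r.
Proof.
rewrite [LHS]crdE; last exact: zmode_deg0 (basis_mgr c).
by apply: eq_bigr => r _; rewrite mxE.
Qed.

Lemma zmx_mul a1 a2 a : (forall w, mgr W j w -> zmode 0 a w = zmode 0 a1 (zmode 0 a2 w)) ->
  zmx a = zmx a1 *m zmx a2.
Proof.
move=> aE; apply/matrixP => r c; rewrite !mxE aE; last exact: basis_mgr.
rewrite zmodeE (lin_sum (zmode_lin _ _)) (lin_sum crd_lin) summxE.
apply: eq_bigr => s _; rewrite (linZ (zmode_lin _ _)) (linZ crd_lin) !mxE.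
by rewrite mulrC.
Qed.

Lemma zmx_eq0 a : (forall w, mgr W j w -> zmode 0 a w = 0) <-> zmx a = 0.
Proof.
split=> [aE|e w Ww].
  by apply/matrixP => r c; rewrite !mxE aE ?(lin0 crd_lin) ?mxE //; exact: basis_mgr.
rewrite (crdE Ww) (lin_sum (zmode_lin _ _)) big1 // => c _.
rewrite (linZ (zmode_lin _ _)) zmodeE e big1 ?scaler0 // => r _.
by rewrite mxE scale0r.
Qed.

Definition zbasis := b.

End ZeroModeMatrices.

(** * The zero mode representation of the Zhu algebra *)

Section Main.
Context {R : realType} {V : voa R} (hrat : rational_voa V) {m : nat}.
Variable (S : 'I_m -> adm_module V).
Hypotheses (hsimple : forall i, simple_module (S i))
  (hnorm : forall i, normalized (S i))
  (hdistinct : forall i j, adm_iso (S i) (S j) -> i = j)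
  (hall : forall W : adm_module V, simple_module W -> normalized W ->
       exists i, adm_iso W (S i)).
Local Notation K := (R[i]).

(** Separation is used at level [j] itself: what kills all the [x q] lies in [O_j(V)] and so kills
    degree [j]. By density, those [x q] that lie in this component span it. *)
Lemma simple_fin_dim i j : exists n, has_dim (mgr (S i) j) n.
Proof.
have [r [x [xP sep]]] := zhu_O_separation j hrat hall.
(* [x q] where it belongs to the component [(i', j')], and zero elsewhere. *)
pose y i' j' (q : 'I_r) : S i' :=
  if @eqP _ (tag (x q)) i' is ReflectT e then
    if (tagged (x q)).1 == j' then ecast z (S z) e (tagged (x q)).2 else 0
  else 0.
have yself q : y (tag (x q)) (tagged (x q)).1 q = (tagged (x q)).2.
  by rewrite /y; case: eqP => // e; rewrite (eq_irrelevance e erefl) eqxx.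
have ymgr i' j' q : mgr (S i') j' (y i' j' q).
  rewrite /y; case: eqP => [e|_]; last exact: (sub0 (mgr_sub _ _)).
  case: eqP => [e'|_]; last exact: (sub0 (mgr_sub _ _)).
  by subst i' j'; exact: (xP q).2.
apply: (@span_has_dim _ _ _ r (y i j)) => [q|w Ww]; first exact: ymgr.
pose U i' j' : set (S i') := fun w => exists c : 'rV[K]_r, w = \sum_q c 0 q *: y i' j' q.
apply: (@density _ V _ S hsimple hnorm hdistinct j _ (fun q => tag (x q))
  (fun q => (tagged (x q)).1) (fun q => (tagged (x q)).2) _ _ (enum 'I_r) U) => //.
- by move=> q; exact: (xP q).2.
- by move=> q; exact: (xP q).1.
- move=> i' j'; split.
    by exists 0; rewrite big1 // => q _; rewrite mxE scale0r.
  move=> c u v [cu ->] [cv ->]; exists (c *: cu + cv).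
  rewrite scaler_sumr -big_split; apply: eq_bigr => q _ /=.
  by rewrite !mxE scalerDl scalerA.
- move=> a la; apply: zhu_O_zmode Ww (leqnn j); apply: sep => q.
  by apply: la; rewrite mem_enum.
move=> q _; exists (delta_mx 0 q).
rewrite (bigD1 q) //= yself mxE !eqxx scale1r big1 ?addr0 // => q' ne.
by rewrite mxE eqxx (negPf ne) scale0r.
Qed.

Section Level.
Variables (D : 'I_m -> nat -> nat) (hD : forall i j, has_dim (mgr (S i) j) (D i j)).
Variable d : nat.

Local Notation T := ('I_d.+1 * 'I_m)%type.
Local Notation P := (matrix_product K d D).

Definition zhu_rep (a : V) : P :=
  [ffun t : T => zmx (hD t.2 t.1) a : 'M[K]_(D t.2 t.1)].

Lemma zhu_repE a t : zhu_rep a t = zmx (hD t.2 t.1) a.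
Proof. by rewrite ffunE. Qed.

Lemma zhu_rep_eq0 a : zhu_rep a = 0 <-> zhu_O d a.
Proof.
split=> [e|Oa]; last first.
  apply/ffunP => t; rewrite zhu_repE ffunE; apply/zmx_eq0 => w Ww.
  by apply: zhu_O_zmode Oa Ww _; rewrite -ltnS.
have [r [x [xP sep]]] := zhu_O_separation d hrat hall.
apply: sep => q; have [le Wx] := xP q.
have lt : ((tagged (x q)).1 < d.+1)%N by rewrite ltnS.
have /ffunP/(_ (Ordinal lt, tag (x q))) := e.
by rewrite zhu_repE ffunE => /zmx_eq0; apply.
Qed.

Lemma zhu_repB a a' : zhu_rep (a - a') = zhu_rep a - zhu_rep a'.
Proof. by apply/ffunP => t; rewrite !ffunE (linB (zmx_lin _)). Qed.

Lemma zhu_rep_surj (M : P) : exists a, zhu_rep a = M.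
Proof.
pose Q := {t : T & 'I_(D t.2 t.1)}.
pose bb (q : Q) : S (tag q).2 := zbasis (hD (tag q).2 (tag q).1) (tagged q).
have bbP (q : Q) : mgr (S (tag q).2) (tag q).1 (bb q) by exact: basis_mgr.
(* Plain numbers allow basis indices from different components to be compared without casts. *)
pose key (q : Q) := ((tag q).2 : nat, (tag q).1 : nat, tagged q : nat).
have key_inj : injective key.
  move=> [[j i] c] [[j' i'] c'] [] /= /val_inj ei /val_inj ej; subst i' j'.
  by move=> /val_inj ->.
(* Otherwise density puts [bb q] into the subspaces where the coordinate of index [q] vanishes, as
   these contain all other basis vectors. *)
have sep (q : Q) : exists a, (forall q', q' != q -> zmode 0 a (bb q') = 0) /\
    zmode 0 a (bb q) <> 0.
  apply: contrapT => na.
  pose U i j : set (S i) := fun w => forall c : 'I_(D i j),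
    ((i : nat), j, (c : nat)) = key q -> crd (hD i j) w 0 c = 0.
  suff Uq : U (tag q).2 ((tag q).1 : nat) (bb q).
    by have /eqP := Uq (tagged q) erefl; rewrite crd_basis eqxx oner_eq0.
  apply: (@density _ V _ S hsimple hnorm hdistinct d _ (fun q : Q => (tag q).2)
    (fun q : Q => (tag q).1 : nat) bb bbP _ [seq q' <- enum {: Q} | q' != q] U).
  - by move=> q'; rewrite -ltnS.
  - move=> i j; split=> [c _|k u v Uu Uv c ec].
      by rewrite (lin0 (crd_lin _)) mxE.
    by rewrite (crd_lin _) !mxE Uu // Uv // mulr0 addr0.
  - exact: bbP.
  - by rewrite -ltnS.
  - move=> a la; apply: contrapT => ne; apply: na; exists a; split=> // q' ne'.
    by apply: la; rewrite mem_filter ne' mem_enum.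
  move=> q'; rewrite mem_filter => /andP[ne' _] c ec.
  rewrite crd_basis; case: eqP => // ecc; case/eqP: ne'; apply: key_inj.
  by rewrite -ec /key -ecc.
(* Composing with a further zero mode on the left reaches any target [y], and the other basis
   vectors remain killed. *)
have hit (q : Q) (y : S (tag q).2) : mgr (S (tag q).2) (tag q).1 y ->
    exists a, (forall q', q' != q -> zmode 0 a (bb q') = 0) /\ zmode 0 a (bb q) = y.
  move=> Wy; have [a [a0 ane]] := sep q.
  have [b] := simple_gen (hsimple _) (zmode_deg0 a (bbP q)) ane Wy; rewrite subrr => eb.
  have [c Hc] := zmode_mul d 0 0 a b; rewrite addr0 in Hc.
  have led (q' : Q) : ((tag q').1 <= d)%N by rewrite -ltnS.
  exists c; split=> [q' ne|].
    by rewrite -(Hc _ _ _ (led q') (bbP q')) a0 // (lin0 (zmode_lin _ _)).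
  by rewrite -(Hc _ _ _ (led q) (bbP q)).
pose y (q : Q) : S (tag q).2 := \sum_r M (tag q) r (tagged q) *:
  zbasis (hD (tag q).2 (tag q).1) r.
have yP (q : Q) : mgr (S (tag q).2) (tag q).1 (y q).
  apply: sub_sum => [|r _]; first exact: mgr_sub.
  by apply: subZ; [exact: mgr_sub|exact: basis_mgr].
have [A AP] := choice (fun q => hit q (y q) (yP q)).
exists (\sum_q A q); apply/ffunP => t; rewrite zhu_repE; apply/matrixP => r c.
pose q : Q := Tagged (fun t : T => 'I_(D t.2 t.1)) c.
have e : zmode 0 (\sum_q A q) (bb q) = y q.
  rewrite (lin_sum (zmode_linl _ _)) (bigD1 q) //= big1 ?addr0 ?(AP q).2 //.
  by move=> q' ne; rewrite ((AP q').1 q) // eq_sym.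
rewrite mxE -/(bb q) e /y (lin_sum (crd_lin _)) summxE (bigD1 r) //= big1 ?addr0.
  by rewrite (linZ (crd_lin _)) mxE crd_basis eqxx mulr1.
by move=> r' ne; rewrite (linZ (crd_lin _)) mxE crd_basis eq_sym (negPf ne) mulr0.
Qed.

Lemma zhu_rep_repr a : zhu_rep (repr (zhu_class d a)) = zhu_rep a.
Proof.
apply/eqP; rewrite -subr_eq0 -zhu_repB; apply/eqP/zhu_rep_eq0.
have : repr (zhu_class d a) - a \in @zhu_O_pred R V d.
  by rewrite Quotient.idealrBE reprK.
by move/asboolP.
Qed.

Lemma zhu_rep_iso : zhu_ring_iso V d P.
Proof.
pose phi (x : zhu_algebra V d) : P := zhu_rep (repr x).
have phi_class a : phi (zhu_class d a) = zhu_rep a by exact: zhu_rep_repr.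
have classK (x : zhu_algebra V d) : zhu_class d (repr x) = x by exact: reprK.
have phiB : zmod_morphism phi.
  move=> x y; rewrite -[x]classK -[y]classK.
  have <- : zhu_class d (repr x - repr y) = zhu_class d (repr x) - zhu_class d (repr y).
    exact: raddfB.
  by rewrite !phi_class zhu_repB.
pose Phi : {additive zhu_algebra V d -> P} :=
  HB.pack phi (GRing.isZmodMorphism.Build _ _ phi phiB).
exists Phi; split.
- have [g gP] := choice zhu_rep_surj.
  exists (fun M => zhu_class d (g M)) => [x|M]; last by rewrite /= phi_class gP.
  apply/eqP; rewrite -subr_eq0 -[x in _ - x]classK.
  have <- : zhu_class d (g (Phi x) - repr x) = zhu_class d (g (Phi x)) - zhu_class d (repr x).
    exact: raddfB.
  have : g (Phi x) - repr x \in @zhu_O_pred R V d.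
    by apply/asboolP/zhu_rep_eq0; rewrite zhu_repB gP subrr.
  rewrite -[X in X \in _]subr0 Quotient.idealrBE => /eqP e.
  by apply/eqP; rewrite /zhu_class e; exact: raddf0.
- rewrite /= phi_class; apply/ffunP => t; rewrite zhu_repE zmx_vac.
  by rewrite ffunE.
move=> p a b Va; rewrite /= !phi_class; apply/ffunP => t.
rewrite zhu_repE ffunE !zhu_repE; apply: zmx_mul => w Ww.
by apply: zhu_mul_zmode Va Ww _; rewrite -ltnS.
Qed.

End Level.
End Main.

Theorem corollary5p0p1 (R : realType) (V : voa R) (hcft : CFT_type V)
    (hrat : rational_voa V) (m : nat) (S : 'I_m -> adm_module V)
    (hsimple : forall i, simple_module (S i))
    (hnorm : forall i, normalized (S i))
    (hdistinct : forall i j, adm_iso (S i) (S j) -> i = j)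
    (hall : forall W : adm_module V, simple_module W -> normalized W ->
       exists i, adm_iso W (S i)) :
  exists D : 'I_m -> nat -> nat,
    (forall i j, has_dim (mgr (S i) j) (D i j)) /\
    forall d : nat, zhu_ring_iso V d (matrix_product R[i] d D).
Proof.
have fin i := choice (simple_fin_dim hrat hsimple hnorm hdistinct hall i).
exists (fun i => projT1 (fin i)); split=> [i j|d]; first exact: (projT2 (fin i)).
by apply: (zhu_rep_iso hrat hsimple hnorm hdistinct hall) => i j; exact: (projT2 (fin i)).
Qed.
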